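(* Let $W\in C^1(\mathbb{R})$ satisfy $W(-1)=W(1)=0$ and $W(s)>0$ for $s\neq\pm1$. Let $a:\mathbb{R}\to\mathbb{R}$ be measurable and let $a_1,a_2\in\mathbb{R}$ be such that $0<a_1\le a(t)\le a_2$ for all $t\in\mathbb{R}$. If in addition $$\lim_{|t|\to+\infty}a(t)=a_2,$$ then $\mathcal{L}_a$ attains its infimum over $\mathcal{X}_1$ at some $u_a\in\mathcal{X}_1$. Moreover, $u_a$ is a heteroclinic $C^1\cap W^{2,2}_{\mathrm{loc}}$ solution of $$\left(\frac{u'}{\sqrt{1-|u'|^2}}\right)'=a(t)W'(u)\quad\text{in }\mathbb{R},\qquad \lim_{t\to\pm\infty}\big(u(t),u'(t)\big)=(\pm1,0),$$ and $\|u_a'\|_{L^\infty}<1$.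
   Context: The space is $$\mathcal{X}_1=\Big\{u\in W^{1,\infty}(\mathbb{R})\ :\ \|u'\|_{L^\infty}\le1\ \text{ and }\ \lim_{t\to\pm\infty}u(t)=\pm1\Big\},$$ and $$\mathcal{L}_a(u)=\int_{-\infty}^{+\infty}\Big(1-\sqrt{1-|u'|^2}+a(t)W(u)\Big)\,\mathrm{d}t .$$ *)

(* Defs.v *)
From mathcomp Require Import all_boot all_order all_algebra.
From mathcomp Require Import all_classical all_reals all_analysis.

Set Implicit Arguments.
Unset Strict Implicit.
Unset Printing Implicit Defensive.

Import Order.TTheory GRing.Theory Num.Theory.
Import numFieldNormedType.Exports.

Local Open Scope classical_set_scope.
Local Open Scope ring_scope.

(* Measurability over the Lebesgue sigma-algebra (the domain of
   [completed_lebesgue_measure]); the library's default sigma-algebra on [R]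
   is the Borel one. *)
Definition lebesgue_measurable_fun {R : realType} (f : R -> R) : Prop :=
  measurable_fun
    [set: caratheodory_type (@wlength R idfun)^*%mu] f.

Definition C1_fun {R : realType} (f : R -> R) : Prop :=
  (forall x, derivable f x 1) /\ continuous (derive1 f).

(* Test functions are C^1 with compact support, as is usual for Sobolev spaces
   in one dimension. *)
Definition test_fun {R : realType} (phi : R -> R) : Prop :=
  C1_fun phi /\ compact (closure [set x | phi x != 0]).

(* [locally_integrable] asks for Borel representatives. This is no restriction:
   a weak derivative is only determined up to a null set. *)
Definition weak_derivative {R : realType} (f g : R -> R) : Prop :=
  [/\ locally_integrable setT f, locally_integrable setT g &
      forall phi, test_fun phi ->
        \int[lebesgue_measure]_x (f x * derive1 phi x) =
        - \int[lebesgue_measure]_x (g x * phi x)].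

(* A chosen representative; the default [cst 0] is only reached when [f] has no
   weak derivative. *)
Definition wderiv {R : realType} (f : R -> R) : R -> R :=
  xget (cst 0) [set g | weak_derivative f g].

Definition W1infty {R : realType} (u : R -> R) : Prop :=
  u \in Lfun lebesgue_measure +oo%E /\
  exists2 g, weak_derivative u g & g \in Lfun lebesgue_measure +oo%E.

Definition L2loc {R : realType} (f : R -> R) : Prop :=
  measurable_fun setT f /\
  forall K : set R, compact K ->
    (\int[lebesgue_measure]_(x in K) (`|f x| ^+ 2)%:E < +oo)%E.

Definition W22loc {R : realType} (u : R -> R) : Prop :=
  exists u1 u2 : R -> R,
    [/\ weak_derivative u u1, weak_derivative u1 u2,
        L2loc u, L2loc u1 & L2loc u2].

(* An element of W^{1,oo} is identified with its continuous representative, to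
   which the pointwise limits refer. *)
Definition X1 {R : realType} : set (R -> R) :=
  [set u | [/\ continuous u, W1infty u,
     ('N[lebesgue_measure]_+oo[EFin \o wderiv u] <= 1)%E,
     u t @[t --> +oo] --> (1 : R) & u t @[t --> -oo] --> (- 1 : R)]].

(* The completed measure is needed because [a] is only Lebesgue measurable. *)
Definition action {R : realType} (a W u : R -> R) : \bar R :=
  (\int[completed_lebesgue_measure]_t
    (1 - Num.sqrt (1 - `|wderiv u t| ^+ 2) + a t * W (u t))%:E)%E.

(* The equation (u' / sqrt (1 - u'^2))' = a W'(u): the weak derivative of the
   left-hand flux equals the right-hand side almost everywhere. *)
Definition solves_EL {R : realType} (a W u : R -> R) : Prop :=
  exists2 h : R -> R,
    weak_derivative (fun t => derive1 u t / Num.sqrt (1 - `|derive1 u t| ^+ 2)) h &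
    {ae lebesgue_measure, forall t, h t = a t * derive1 W (u t)}.

(* Main.v *)
Require Import Defs.
From mathcomp Require Import all_boot all_order all_algebra.
From mathcomp Require Import all_classical all_reals all_analysis.
From mathcomp Require Import measurable_realfun ess_sup_inf ring lra.

(** The minimizer is obtained by the direct method. An element [u] of the space
    is carried together with a Borel slope [w], bounded by 1, of which it is a
    primitive ([prim], [adm]), and [a] is replaced by a Borel function [b] equal
    to it off a null set. The derivative of [Phi p = 1 - sqrt (1 - p^2)] is
    [p / sqrt (1 - p^2)], with inverse [gam], and [Phi] is strongly convex
    ([Phi_young]).

    Compactness. A curve that has reached 1 has already spent the minimal action,
    since it could stay there for free; hence a near-minimizer exceeds 1, or
    passes below -1, by very little ([near_min_bound]), and by the Lipschitz
    bound a minimizing sequence has a pointwise convergent subsequence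
    ([lip_cvg_subseq]). On an interval [-k, k], let [c] be such that the
    slope [gam (c + int b W'(y))] leads from the left end point of a
    near-minimizer [y] to the right one; a variation of [y] towards the curve
    with this slope shows that it is close in L^2 to the slope of [y]
    ([near_min_flux]). Therefore the limit [u] satisfies the integrated
    Euler-Lagrange equation [u' = gam (c + int b W'(u))] and its action is at
    most the infimum ([minimizing_limit]).

    Limits at infinity. The limit could fail to join the wells if the transition
    escaped to infinity, where [b] is close to [a2]. Let [m] and [m2] be the
    infima for the coefficients [b] and [a2]. If [m < m2], an escaping
    transition costs almost [m2] ([far_transition_right],
    [far_transition_left]), too much for a minimizing sequence; so [u] stays
    away from the wrong well far out, and the finiteness of its action gives the
    limits ([act_lty_pinfty], [act_lty_ninfty]). If [m2 <= m], the autonomous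
    problem is solved by translating a minimizing sequence
    ([autonomous_minimizer]); as [b <= a2], its minimizer has action at most
    [m2 <= m] for [b] as well, and so is a minimizer for [b]
    ([exists_minimizer]).

    Regularity. The flux [q = u' / sqrt (1 - u'^2)] has bounded derivative
    [b W'(u)], and [u] stays in [[-1, 1]], so [q] is bounded ([flux_bounded]) and
    [|u'|] stays away from 1. As [u' = gam q] is Lipschitz and [u]
    converges at infinity, [u'] tends to 0 ([prim_lip_cvg0]). *)

Set Implicit Arguments.
Unset Strict Implicit.
Unset Printing Implicit Defensive.

Import Order.TTheory GRing.Theory Num.Theory.
Import numFieldNormedType.Exports.

Local Open Scope classical_set_scope.
Local Open Scope ring_scope.

(** * Integrals of locally bounded functions *)

Section LocallyBounded.
Context {R : realType}.
Implicit Types f g h : R -> R.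
Notation mu := (@lebesgue_measure R).

(** A class of functions that is stable under all the operations used below and
    integrable on every compact interval, which spares integrability conditions. *)
Definition locbdd f := measurable_fun setT f /\
  forall r, exists M, forall x, `|x| <= r -> `|f x| <= M.

Lemma locbdd_continuous f : continuous f -> locbdd f.
Proof.
move=> cf; split; first exact: continuous_measurable_fun.
move=> r.
have [r0|r0] := leP 0 r; last first.
  by exists 0 => x xr; have := normr_ge0 x; lra.
have cF : {within `[- r, r], continuous (fun x => `|f x|)}.
  apply: continuous_subspaceT => x; apply: continuous_comp; first exact: cf.
  exact: norm_continuous.
have [|c _ Hc] := EVT_max _ cF; first lra.
exists `|f c| => x; rewrite ler_norml => xr; exact: Hc.
Qed.

Lemma locbdd_cst (c : R) : locbdd (fun=> c).
Proof. by apply: locbdd_continuous => x; exact: cvg_cst. Qed.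

Lemma locbddD f g : locbdd f -> locbdd g -> locbdd (fun x => f x + g x).
Proof.
move=> [mf bf] [mg bg]; split; first exact: measurable_funD.
move=> r; have [M HM] := bf r; have [N HN] := bg r; exists (M + N) => x xr.
by rewrite (le_trans (ler_normD _ _))// lerD ?HM ?HN.
Qed.

Lemma locbddM f g : locbdd f -> locbdd g -> locbdd (fun x => f x * g x).
Proof.
move=> [mf bf] [mg bg]; split; first exact: measurable_funM.
move=> r; have [M HM] := bf r; have [N HN] := bg r; exists (M * N) => x xr.
by rewrite normrM ler_pM ?HM ?HN.
Qed.

Lemma locbdd_comp g f : continuous g -> locbdd f -> locbdd (fun x => g (f x)).
Proof.
move=> cg [mf bf]; split.
  by apply: measurableT_comp => //; exact: continuous_measurable_fun.
move=> r; have [M HM] := bf r; have [_ /(_ M)[N HN]] := locbdd_continuous cg.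
by exists N => x xr; apply/HN/HM.
Qed.

Lemma locbddN f : locbdd f -> locbdd (fun x => - f x).
Proof. by apply: locbdd_comp; exact: opp_continuous. Qed.

Lemma locbddB f g : locbdd f -> locbdd g -> locbdd (fun x => f x - g x).
Proof. by move=> lf lg; apply: locbddD => //; exact: locbddN. Qed.

Lemma locbddZ c f : locbdd f -> locbdd (fun x => c * f x).
Proof. exact/locbddM/locbdd_cst. Qed.

Lemma locbdd_integrable f s t : locbdd f -> mu.-integrable `[s, t] (EFin \o f).
Proof.
move=> [mf bf]; apply: measurable_bounded_integrable => //.
- exact: (compact_finite_measure (@segment_compact _ s t)).
- exact: measurable_funTS.
have [M HM] := bf (`|s| + `|t|); exists M; split; first exact: num_real.
move=> N MN x /=; rewrite in_itv/= => /andP[sx xt].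
apply: (le_trans _ (ltW MN)); apply: HM.
rewrite ler_norml.
by have := ler_norm (- s); have := ler_norm t; rewrite normrN; have := normr_ge0 s; have := normr_ge0 t; lra.
Qed.

(** Meant for [s <= t]: there is no sign convention, the value is 0 if [t < s]. *)
Definition int f (s t : R) : R := \int[mu]_(x in `[s, t]) f x.

Lemma eq_int f g s t : (forall x, s <= x <= t -> f x = g x) -> int f s t = int g s t.
Proof.
by move=> fg; apply: eq_Rintegral => x; rewrite inE/= in_itv/=; exact: fg.
Qed.

Lemma int_split f s r t : locbdd f -> s <= r <= t ->
  int f s t = int f s r + int f r t.
Proof.
move=> lf /andP[sr rt].
have := @Rintegral_itvB _ f (BLeft s) (BRight t) r (locbdd_integrable s t lf).
rewrite !bnd_simp => /(_ sr rt); rewrite Rintegral_itv_obnd_cbnd; last first.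
  by apply: integrableS (locbdd_integrable r t lf) => //; apply: subset_itvr; rewrite bnd_simp.
by rewrite /int => <-; lra.
Qed.

Lemma int_cst c s t : s <= t -> int (fun=> c) s t = c * (t - s).
Proof.
move=> st; rewrite /int Rintegral_cst// [X in fine X](lebesgue_measure_itv `[s, t])/= lte_fin.
case: ltP => [_|ts]/=; [by [] | by rewrite (le_anti (introT andP (conj ts st))) subrr].
Qed.

Lemma intD f g s t : locbdd f -> locbdd g ->
  int (fun x => f x + g x) s t = int f s t + int g s t.
Proof. by move=> lf lg; apply: RintegralD => //; exact: locbdd_integrable. Qed.

Lemma intB f g s t : locbdd f -> locbdd g ->
  int (fun x => f x - g x) s t = int f s t - int g s t.
Proof. by move=> lf lg; apply: RintegralB => //; exact: locbdd_integrable. Qed.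

Lemma intZ c f s t : locbdd f ->
  int (fun x => c * f x) s t = c * int f s t.
Proof. by move=> lf; apply: RintegralZl => //; exact: locbdd_integrable. Qed.

Lemma le_int f g s t : locbdd f -> locbdd g ->
  (forall x, s <= x <= t -> f x <= g x) -> int f s t <= int g s t.
Proof.
move=> lf lg fg; apply: le_Rintegral => //; exact: locbdd_integrable.
Qed.

Lemma int_ge0 f s t : (forall x, s <= x <= t -> 0 <= f x) -> 0 <= int f s t.
Proof. by move=> f0; apply: Rintegral_ge0 => x /=; rewrite in_itv; exact: f0. Qed.

Lemma int_bound f M s t : locbdd f -> s <= t ->
  (forall x, s <= x <= t -> `|f x| <= M) -> `|int f s t| <= M * (t - s).
Proof.
move=> lf st fM; rewrite ler_norml -mulNr -!int_cst//.
by apply/andP; split; apply: le_int => //; [exact: locbdd_cst| |exact: locbdd_cst|];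
  move=> x /fM; rewrite ler_norml => /andP[].
Qed.

Lemma int_cvg (f_ : nat -> R -> R) f (M : R) s t : (forall n, locbdd (f_ n)) -> locbdd f ->
  (forall n x, s <= x <= t -> `|f_ n x| <= M) ->
  (forall x, s <= x <= t -> f_ n x @[n --> \oo] --> f x) ->
  int (f_ n) s t @[n --> \oo] --> int f s t.
Proof.
move=> lf_ lf fM fcvg.
have [||||_ _ H] := @dominated_convergence _ _ R mu `[s, t]%classic (measurable_itv _)
  (fun n x => (f_ n x)%:E) (EFin \o f) (cst M%:E) _ _ _ (locbdd_integrable s t (locbdd_cst M)).
- by move=> n; apply/measurable_EFinP/measurable_funTS; exact: (lf_ n).1.
- by apply/measurable_EFinP/measurable_funTS; exact: lf.1.
- apply: aeW => x /=; rewrite in_itv => xst; have fx := fcvg x xst.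
  by apply/fine_cvgP; split; [exact: nearW|exact: fx].
- by apply: aeW => x n /=; rewrite in_itv lee_fin; exact: fM.
apply: fine_cvg; rewrite fineK; first exact: H.
by apply: integrable_fin_num => //; exact: locbdd_integrable.
Qed.

End LocallyBounded.

(** * Primitives of locally bounded functions *)

Section Primitives.
Context {R : realType}.
Implicit Types F G f g : R -> R.

(** First-order expansions can be added and compared more easily than limits of
    difference quotients. *)
Lemma is_derive_approxP F (x d : R) : is_derive x 1 F d <->
  forall e, 0 < e -> exists2 r, 0 < r & forall y, `|y - x| < r ->
    `|F y - F x - d * (y - x)| <= e * `|y - x|.
Proof.
split=> [[dF <-] e e0|H].
  move: dF; rewrite /derivable => /cvgP; rewrite -/('D_1 F x) => /cvgrPdist_le /(_ _ e0).
  move=> [r /= r0 Hr]; exists r => // y yx.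
  have [->|ynx] := eqVneq y x; first by rewrite !subrr mulr0 subr0 normr0 mulr0.
  have yx0 : y - x != 0 by rewrite subr_eq0.
  have := Hr (y - x); rewrite /ball_/= sub0r normrN => /(_ yx yx0).
  rewrite /GRing.scale/= mulr1 subrK => Hy.
  have -> : F y - F x - 'D_1 F x * (y - x) =
     - ('D_1 F x - (y - x)^-1 * (F y - F x)) * (y - x).
    by rewrite opprB mulrBl mulrAC mulVf// mul1r.
  by rewrite normrM normrN ler_pM2r ?normr_gt0.
suff Hc : (fun h => h^-1 *: (F (h *: (1 : R) + x) - F x)) @ 0^' --> d.
  by apply: DeriveDef; [exact: (cvgP d Hc)|exact: (cvg_lim (@Rhausdorff R) Hc)].
apply/cvgrPdist_le => e e0; have [r r0 Hr] := H e e0.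
exists r => //= h; rewrite /ball_/= sub0r normrN => hr h0.
have := Hr (h + x); rewrite addrK => /(_ hr) Hh.
rewrite /GRing.scale/= mulr1.
have -> : d - h^-1 * (F (h + x) - F x) = - ((F (h + x) - F x - d * h) * h^-1).
  by rewrite mulrBl mulfK// opprB [h^-1 * _]mulrC.
by rewrite normrN normrM normfV ler_pdivrMr ?normr_gt0.
Qed.

(** For [f] locally bounded, [F] is a locally Lipschitz function with weak
    derivative [f]. Keeping the pair makes it unnecessary to differentiate [F]. *)
Definition prim F f := forall s t : R, s <= t -> F t - F s = int f s t.

Lemma prim_lip F f M x y : locbdd f -> prim F f ->
  (forall z, `|z - x| <= `|y - x| -> `|f z| <= M) ->
  `|F y - F x| <= M * `|y - x|.
Proof.
move=> lf Ff fM; have [xy|yx] := leP x y.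
  rewrite Ff// (ger0_norm (x := y - x)) ?subr_ge0//; apply: int_bound => // z /andP[xz zy].
  by apply: fM; rewrite !ger0_norm ?subr_ge0// lerB.
rewrite distrC Ff ?(ltW yx)// (distrC y) (ger0_norm (x := x - y)) ?subr_ge0 ?(ltW yx)//.
apply: int_bound => //; first exact: ltW.
move=> z /andP[yz zx]; apply: fM; rewrite distrC (distrC y).
by rewrite !ger0_norm ?subr_ge0// ?(ltW yx)// lerB.
Qed.

Lemma prim_bound F f M : locbdd f -> prim F f -> (forall z, `|f z| <= M) ->
  forall x y, `|F y - F x| <= M * `|y - x|.
Proof. by move=> lf Ff fM x y; apply: prim_lip Ff _. Qed.

Lemma prim_continuous F f : locbdd f -> prim F f -> continuous F.
Proof.
move=> lf Ff x; have [_ /(_ (`|x| + 1))[M HM]] := lf.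
apply/cvgrPdist_le => e e0.
have M0 : 0 <= M.
  by apply: le_trans (HM x _); rewrite ?normr_ge0// lerDl.
exists (Num.min 1 (e / (M + 1))) => /=; first by rewrite lt_min ltr01 divr_gt0//; lra.
move=> y; rewrite /ball_/= lt_min => /andP[xy1 xye].
rewrite distrC (le_trans (prim_lip (M := M) lf Ff _))//.
  move=> z zxy; apply: HM; rewrite -(subrK x z) (le_trans (ler_normD _ _))// addrC lerD2l.
  by rewrite (le_trans zxy)// distrC ltW.
rewrite distrC; apply: (@le_trans _ _ ((M + 1) * `|x - y|)).
  by apply: ler_wpM2r => //; lra.
by rewrite mulrC -ler_pdivlMr ?ltW//; lra.
Qed.

Lemma prim_locbdd F f : locbdd f -> prim F f -> locbdd F.
Proof. by move=> lf /(prim_continuous lf); exact: locbdd_continuous. Qed.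

Definition antider f (t : R) : R := if 0 <= t then int f 0 t else - int f t 0.

Lemma prim_antider f : locbdd f -> prim (antider f) f.
Proof.
move=> lf s t st; rewrite /antider; case: (leP 0 s) => s0.
  rewrite (le_trans s0 st) (int_split (r := s) (s := 0) (t := t))// ?s0//; lra.
case: (leP 0 t) => t0.
  rewrite (int_split (r := 0) (s := s) (t := t))//; first lra.
  by rewrite t0 ltW.
by rewrite (int_split (r := t) (s := s) (t := 0))//; [lra|rewrite st ltW].
Qed.

Lemma antider0 f : antider f 0 = 0.
Proof. by rewrite /antider lexx /int set_itv1 Rintegral_set1. Qed.

Lemma primD F G f g : locbdd f -> locbdd g -> prim F f -> prim G g ->
  prim (fun t => F t + G t) (fun t => f t + g t).
Proof. by move=> lf lg Ff Gg s t st; rewrite intD// -Ff// -Gg//; lra. Qed.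

Lemma primB F G f g : locbdd f -> locbdd g -> prim F f -> prim G g ->
  prim (fun t => F t - G t) (fun t => f t - g t).
Proof. by move=> lf lg Ff Gg s t st; rewrite intB// -Ff// -Gg//; lra. Qed.

Lemma primZ c F f : locbdd f -> prim F f -> prim (fun t => c * F t) (fun t => c * f t).
Proof. by move=> lf Ff s t st; rewrite intZ// -Ff//; lra. Qed.

Lemma primDc c F f : prim F f -> prim (fun t => c + F t) f.
Proof. by move=> Ff s t st; rewrite -Ff//; lra. Qed.

Lemma prim_line (c : R) : prim (fun t => c * t) (fun=> c).
Proof. by move=> s t st; rewrite int_cst//; lra. Qed.

Lemma prim_cst (c : R) : prim (fun=> c) (fun=> 0).
Proof. by move=> s t st; rewrite int_cst//; lra. Qed.

Lemma prim_is_derive F f x : locbdd f -> prim F f -> {for x, continuous f} ->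
  is_derive x 1 F (f x).
Proof.
move=> lf Ff cf; apply/is_derive_approxP => e e0.
move/cvgrPdist_le : cf => /(_ _ e0)[r /= r0 Hr]; exists r => // y yx.
have lg := locbddB lf (locbdd_cst (f x)).
have := prim_lip (M := e) (x := x) (y := y) lg (primB lf (locbdd_cst _) Ff (prim_line (f x))).
move=> H; apply: le_trans (H _); first by rewrite le_eqVlt; apply/orP; left; apply/eqP; congr `|_|; ring.
by move=> z zx; rewrite distrC; apply: Hr; rewrite /ball_/= distrC (le_lt_trans zx).
Qed.

(** Subtracting from [G \o F] a primitive of the claimed derivative leaves a
    function with derivative 0 at every point [x], even where [F] is not
    differentiable: since [F] is Lipschitz near [x] and [G' \o F] is continuous,
    both increments are [G' (F x) * (F y - F x)] up to a term small with respect
    to [y - x]. *)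
Lemma prim_chain G F f : (forall x, derivable G x 1) -> continuous (derive1 G) ->
  locbdd f -> prim F f -> prim (G \o F) (fun t => derive1 G (F t) * f t).
Proof.
move=> dG cG lf Ff.
have cF := prim_continuous lf Ff.
have lF := prim_locbdd lf Ff.
have lh : locbdd (fun t => derive1 G (F t) * f t) by apply: locbddM => //; exact: locbdd_comp.
set h := fun t => _ in lh *.
have Ph := prim_antider lh.
suff K0 : forall x y, G (F x) - antider h x = G (F y) - antider h y.
  by move=> s t st; rewrite -Ph//=; have := K0 s t; lra.
move=> y0 y1; apply: (is_derive_0_is_cst (f := fun x => G (F x) - antider h x)) => x {y0 y1}.
apply/is_derive_approxP => e e0.
have [_ /(_ (`|x| + 1))[M0 HM0]] := lf.
pose M := `|M0| + 1.
have M_gt0 : 0 < M by rewrite /M ltr_wpDl.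
have HM z : `|z - x| <= 1 -> `|f z| <= M.
  move=> zx; apply: (@le_trans _ _ M0).
    by apply: HM0; rewrite -(subrK x z) (le_trans (ler_normD _ _))// addrC lerD2l.
  by rewrite /M (le_trans (ler_norm _))// lerDl.
pose e' := e / (M + M).
have e'0 : 0 < e' by rewrite divr_gt0// addr_gt0.
have /is_derive_approxP /(_ _ e'0)[r1 r10 Hr1] : is_derive (F x) 1 G (derive1 G (F x)).
  by rewrite derive1E; apply: DeriveDef.
have cGF : {for x, continuous (fun t => derive1 G (F t))} by apply: continuous_comp; [exact: cF|exact: cG].
move/cvgrPdist_le : cGF => /(_ _ e'0)[r2 /= r20 Hr2].
move/(_ x)/cvgrPdist_lt : cF => /(_ _ r10)[r3 /= r30 Hr3].
exists (Num.min 1 (Num.min r2 r3)) => [|y]; first by rewrite !lt_min ltr01 r20 r30.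
rewrite !lt_min => /and3P[y1 y2 y3].
have FyFx : `|F y - F x| <= M * `|y - x|.
  by apply: prim_lip lf Ff _ => z zx; apply: HM; rewrite (le_trans zx) ?ltW.
have A1 := Hr1 (F y).
have {}A1 : `|G (F y) - G (F x) - derive1 G (F x) * (F y - F x)| <= e' * (M * `|y - x|).
  apply: le_trans (A1 _) _.
    by rewrite distrC; apply: Hr3; rewrite /ball_/= distrC.
  by rewrite ler_pM2l.
have lk : locbdd (fun t => h t - derive1 G (F x) * f t) by apply: locbddB => //; exact: locbddZ.
have A2 := prim_lip (M := e' * M) (x := x) (y := y) lk (primB lh (locbddZ _ lf) Ph (primZ (derive1 G (F x)) lf Ff)).
have {}A2 := A2 _.
have -> : G (F y) - antider h y - (G (F x) - antider h x) - 0 * (y - x) =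
   (G (F y) - G (F x) - derive1 G (F x) * (F y - F x)) -
   (antider h y - derive1 G (F x) * F y - (antider h x - derive1 G (F x) * F x)) by ring.
apply: le_trans (ler_normB _ _) _.
have -> : e * `|y - x| = e' * (M * `|y - x|) + e' * M * `|y - x|.
  by rewrite [e' * (M * _)]mulrA -mulrDl -mulrDr /e' mulfVK// gt_eqF// addr_gt0.
apply: lerD => //; apply: A2 => z zx.
rewrite /h -mulrBl normrM ler_pM// ?HM//; last by rewrite (le_trans zx) ?ltW.
by rewrite distrC; apply: Hr2; rewrite /ball_/= distrC (le_lt_trans zx).
Qed.

Lemma prim_C1 F : C1_fun F -> prim F (derive1 F).
Proof.
move=> [dF cF]; have := prim_chain dF cF (locbdd_cst 1) (prim_line 1).
move=> H s t st; have := H s t st; rewrite /= !mul1r => ->.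
by apply: eq_int => x _; rewrite mul1r mulr1.
Qed.

Lemma prim_sqr F f : locbdd f -> prim F f -> prim (fun t => F t ^+ 2) (fun t => 2 * F t * f t).
Proof.
move=> lf Ff.
have dG (x : R) : is_derive x 1 (fun x : R => x ^+ 2) (2 * x).
  apply: is_derive_eq; rewrite /GRing.scale/=; ring.
have E : derive1 (fun x : R => x ^+ 2) = (fun x => 2 * x).
  by apply/funext => x; rewrite derive1E (derive_val (is_derive := dG x)).
have H := @prim_chain (fun x => x ^+ 2) F f (fun x => ex_derive (is_derive := dG x)) _ lf Ff.
have {}H := H _; rewrite E in H.
by apply: H => x; apply: mulrl_continuous.
Qed.

(** Polarization of the chain rule for squares. *)
Lemma prim_mul F G f g : locbdd f -> locbdd g -> prim F f -> prim G g ->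
  prim (fun t => F t * G t) (fun t => F t * g t + f t * G t).
Proof.
move=> lf lg Ff Gg.
have lF := prim_locbdd lf Ff; have lG := prim_locbdd lg Gg.
have lFG := locbddD lf lg; have PFG := prim_sqr lFG (primD lf lg Ff Gg).
have PF := prim_sqr lf Ff; have PG := prim_sqr lg Gg.
move=> s t st.
have l1 : locbdd (fun t => 2 * (F t + G t) * (f t + g t)).
  by apply: locbddM => //; apply: locbddZ; apply: locbddD.
have l2 : locbdd (fun t => 2 * F t * f t) by apply: locbddM => //; apply: locbddZ.
have l3 : locbdd (fun t => 2 * G t * g t) by apply: locbddM => //; apply: locbddZ.
have l4 := locbddB (locbddB l1 l2) l3.
have -> : int (fun t => F t * g t + f t * G t) s t =
  int (fun x => 2^-1 * (2 * (F x + G x) * (f x + g x) - 2 * F x * f x - 2 * G x * g x)) s t.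
  by apply: eq_int => x _; field.
by rewrite intZ// (intB _ _ (locbddB l1 l2) l3) (intB _ _ l1 l2) -PFG// -PF// -PG//; field.
Qed.

End Primitives.

(** * The Lagrangian and its flux *)

Section Lagrangian.
Context {R : realType}.
Implicit Types p q w x y : R.

Definition Phi p : R := 1 - Num.sqrt (1 - p ^+ 2).
(** Inverse of the flux [p / sqrt (1 - p^2)], the derivative of [Phi] at [p];
    also the derivative of the Legendre transform [sqrt (1 + q^2) - 1] of [Phi]. *)
Definition gam q : R := q / Num.sqrt (1 + q ^+ 2).

Lemma Phi_ge0 p : 0 <= Phi p.
Proof.
rewrite subr_ge0 -[leRHS]sqrtr1; apply: ler_wsqrtr.
by rewrite gerBl sqr_ge0.
Qed.

Lemma Phi_le1 p : Phi p <= 1.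
Proof. by rewrite gerBl sqrtr_ge0. Qed.

Lemma Phi0 : Phi 0 = 0.
Proof. by rewrite /Phi expr0n subr0 sqrtr1 subrr. Qed.

Lemma Phi_continuous : continuous Phi.
Proof.
move=> p; apply: cvgB; first exact: cvg_cst.
apply: (@continuous_comp _ _ _ (fun p => 1 - p ^+ 2)); last exact: sqrt_continuous.
apply: cvgB; first exact: cvg_cst.
exact: exprn_continuous.
Qed.

Lemma subr1_sqr_ge0 p : `|p| <= 1 -> 0 <= 1 - p ^+ 2.
Proof.
by rewrite ler_norml => p1; nra.
Qed.

Let S q : R := Num.sqrt (1 + q ^+ 2).

Let S2 q : S q ^+ 2 = 1 + q ^+ 2.
Proof. by rewrite sqr_sqrtr// addr_ge0// sqr_ge0. Qed.

Let S1 q : 1 <= S q.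
Proof.
by rewrite -[leLHS]sqrtr1 ler_wsqrtr// lerDl sqr_ge0.
Qed.

Let S0 q : 0 < S q. Proof. exact: lt_le_trans (S1 q). Qed.

Let gamE q : gam q * S q = q.
Proof. by rewrite /gam mulfVK// gt_eqF// S0. Qed.

Lemma gamN q : gam (- q) = - gam q.
Proof. by rewrite /gam sqrrN mulNr. Qed.

Let subr1_gam2 q : 1 - gam q ^+ 2 = (S q)^-1 ^+ 2.
Proof.
have s0 : S q != 0 by rewrite gt_eqF.
rewrite /gam -/(S q) expr_div_n exprVn S2; field.
by rewrite gt_eqF// ltr_pwDl// sqr_ge0.
Qed.

Lemma sqrt_gam q : Num.sqrt (1 - gam q ^+ 2) = (Num.sqrt (1 + q ^+ 2))^-1.
Proof. by rewrite subr1_gam2 sqrtr_sqr ger0_norm// invr_ge0 ltW. Qed.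

Lemma gamK q : gam q / Num.sqrt (1 - gam q ^+ 2) = q.
Proof. by rewrite sqrt_gam invrK gamE. Qed.

Lemma gam_lt1 q : `|gam q| < 1.
Proof.
rewrite /gam normrM normfV (ger0_norm (ltW (S0 q))) ltr_pdivrMr ?mul1r//.
rewrite -sqrtr_sqr ltr_sqrt ?ltrDr//.
by rewrite ltr_pwDl// sqr_ge0.
Qed.

Let dS q : is_derive q 1 S (gam q).
Proof.
have H : 0 < 1 + q ^+ 2 by rewrite ltr_pwDl// sqr_ge0.
have D := is_derive1_sqrt H.
have E : is_derive q 1 (fun q => 1 + q ^+ 2) (2 * q).
  by apply: is_derive_eq; rewrite /GRing.scale/=; ring.
have H1 := @is_derive1_comp _ _ (fun q => 1 + q ^+ 2) q _ _ D E.
apply: (is_derive_eq H1); rewrite /gam -/(S q).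
by have := S0 q => s0; field; rewrite gt_eqF.
Qed.

Definition dgam q : R := ((Num.sqrt (1 + q ^+ 2)) ^+ 3)^-1.

Lemma is_derive_gam q : is_derive q 1 gam (dgam q).
Proof.
have s0 : S q != 0 by rewrite gt_eqF.
have D := @is_deriveV _ S q _ 1 s0 (dS q).
have H1 := @is_deriveM _ _ (fun x : R => x) (fun x => (S x)^-1) q 1 _ _ (is_derive_id (q : R^o) 1) D.
apply: (is_derive_eq H1); rewrite /GRing.scale/= /dgam -/(S q) /gam -/(S q).
have -> : q * (- (S q ^+ 2)^-1 * (q / S q)) + (S q)^-1 * 1 = (S q ^+ 2 - q ^+ 2) / S q ^+ 3.
  by field.
by rewrite S2 addrK mul1r.
Qed.

Lemma derive1_gam : derive1 gam = dgam.
Proof.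
by apply/funext => q; rewrite derive1E (derive_val (is_derive := is_derive_gam q)).
Qed.

Let S_continuous : continuous S.
Proof.
move=> q; apply: (@continuous_comp _ _ _ (fun q => 1 + q ^+ 2)); last exact: sqrt_continuous.
apply: cvgD; [exact: cvg_cst|exact: exprn_continuous].
Qed.

Lemma dgam_continuous : continuous dgam.
Proof.
move=> q; apply: cvgV; first by rewrite expf_neq0// gt_eqF// (S0 q).
apply: (@continuous_comp _ _ _ S (fun s => s ^+ 3)); first exact: S_continuous.
exact: exprn_continuous.
Qed.

Lemma C1_gam : C1_fun gam.
Proof.
split=> [q|]; first exact: (ex_derive (is_derive := is_derive_gam q)).
by rewrite derive1_gam; exact: dgam_continuous.
Qed.

Lemma gam_continuous : continuous gam.
Proof.
by move=> q; apply: differentiable_continuous; apply/derivable1_diffP; exact: (C1_gam.1 q).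
Qed.

Lemma dgam_ge0 q : 0 <= dgam q.
Proof. by rewrite invr_ge0 exprn_ge0// ltW// (S0 q). Qed.

Lemma dgam_le1 q : dgam q <= 1.
Proof. by rewrite invf_le1 ?exprn_gt0 ?(S0 q)// exprn_ege1// (S1 q). Qed.

Let prim_gam : prim gam dgam.
Proof. by have := prim_C1 C1_gam; rewrite derive1_gam. Qed.

Lemma gam_lip x y : `|gam y - gam x| <= `|y - x|.
Proof.
rewrite -[leRHS]mul1r; apply: prim_bound prim_gam _ _ _.
  exact/locbdd_continuous/dgam_continuous.
by move=> z; rewrite ger0_norm ?dgam_ge0// dgam_le1.
Qed.

Lemma gam_homo x y : x <= y -> gam x <= gam y.
Proof.
move=> xy; rewrite -subr_ge0 prim_gam//; apply: int_ge0 => z _; exact: dgam_ge0.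
Qed.

(** Gives a definite slope where the flux is at least 1: over a length 4 it moves
    a curve by more than 2, the distance between the wells. *)
Lemma gam1_ge : 2 / 3 <= gam 1.
Proof.
have H : Num.sqrt (1 + 1 ^+ 2) ^+ 2 = 1 + 1 ^+ 2 :> R by exact: S2.
rewrite /gam ler_pdivlMr ?(S0 1)//.
rewrite -/(S 1); have := S0 1; have := S2 1; nra.
Qed.

(** The linear part is the tangent of [Phi] at [gam q]. With
    [s = sqrt (1 + q^2)], the points [(w, sqrt (1 - w^2))] and [(gam q, 1 / s)]
    lie on the unit circle, and the gap between [Phi] and its tangent is exactly
    [s / 2 >= 1 / 2] times their squared distance. *)
Lemma Phi_young q w : `|w| <= 1 ->
  Phi (gam q) + q * (w - gam q) + (w - gam q) ^+ 2 / 2 <= Phi w.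
Proof.
move=> w1; rewrite /Phi sqrt_gam -/(S q).
have := gamE q; have := S2 q; have := S1 q.
set s := S q; set p := gam q => s1 s2 ps.
have s0 : 0 < s by lra.
have r2 := sqr_sqrtr (subr1_sqr_ge0 w1).
set r := Num.sqrt _ in r2 *.
have si : s * s^-1 = 1 by rewrite divff// gt_eqF.
set i := s^-1 in si *.
(* the points (w, r) and (p, i) of the unit circle *)
have E : r = s - q * w - s / 2 * ((w - p) ^+ 2 + (r - i) ^+ 2).
  have p2 : p ^+ 2 + i ^+ 2 = 1.
    have -> : i = i * i * s by rewrite -mulrA (mulrC i s) si mulr1.
    apply: (mulfI (x := s ^+ 2)); first by rewrite expf_neq0// gt_eqF.
    rewrite mulr1 {2}s2 mulrDr -exprMn (mulrC s p) ps.
    have -> : s ^+ 2 * (i * i * s) ^+ 2 = (s * i) ^+ 4 by ring.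
    by rewrite si expr1n addrC.
  have -> : (w - p) ^+ 2 + (r - i) ^+ 2 = 2 - 2 * w * p - 2 * r * i.
    have -> : (w - p) ^+ 2 + (r - i) ^+ 2 = (w ^+ 2 + r ^+ 2) + (p ^+ 2 + i ^+ 2) - 2 * w * p - 2 * r * i by ring.
    by rewrite r2 p2; ring.
  have -> : s - q * w - s / 2 * (2 - 2 * w * p - 2 * r * i) = r * (s * i) + w * (p * s - q) by field.
  by rewrite si ps; ring.
have qp : q * p + i = s.
  have -> : q * p + i = s * (p ^+ 2 + i ^+ 2) - (p * s - q) * p + i * (1 - s * i) by ring.
  have p2 : s ^+ 2 * (p ^+ 2 + i ^+ 2) = s ^+ 2.
    by rewrite mulrDr -!exprMn (mulrC s p) ps si expr1n s2 addrC.
  have p2' : p ^+ 2 + i ^+ 2 = 1.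
    by apply: (mulfI (x := s ^+ 2)); [rewrite expf_neq0// gt_eqF|rewrite mulr1].
  by rewrite p2' ps si; ring.
have A : 0 <= (s - 1) * (w - p) ^+ 2 by rewrite mulr_ge0 ?sqr_ge0//; lra.
have B : 0 <= s * (r - i) ^+ 2 by rewrite mulr_ge0 ?sqr_ge0// ltW.
lra.
Qed.

(** The half circle is concave because [a * b + x * y <= 1] for two points
    [(x, a)] and [(y, b)] of the unit circle. *)
Lemma Phi_convex (l : R) x y : 0 <= l <= 1 -> `|x| <= 1 -> `|y| <= 1 ->
  Phi ((1 - l) * x + l * y) <= (1 - l) * Phi x + l * Phi y.
Proof.
move=> /andP[l0 l1] x1 y1; rewrite /Phi.
have := sqr_sqrtr (subr1_sqr_ge0 x1); have := sqr_sqrtr (subr1_sqr_ge0 y1).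
have := sqrtr_ge0 (1 - x ^+ 2); have := sqrtr_ge0 (1 - y ^+ 2).
set a := Num.sqrt (1 - x ^+ 2); set b := Num.sqrt (1 - y ^+ 2) => b0 a0 b2 a2.
suff : (1 - l) * a + l * b <= Num.sqrt (1 - ((1 - l) * x + l * y) ^+ 2) by lra.
have c0 : 0 <= (1 - l) * a + l * b by rewrite addr_ge0// mulr_ge0//; lra.
rewrite -[leLHS]ger0_norm// -sqrtr_sqr; apply: ler_wsqrtr.
have xy : a * b + x * y <= 1.
  have := sqr_ge0 (a - b); have := sqr_ge0 (x - y).
  by rewrite !sqrrB a2 b2; lra.
have -> : ((1 - l) * a + l * b) ^+ 2 = (1 - l) ^+ 2 * a ^+ 2 + l ^+ 2 * b ^+ 2 + 2 * (l * (1 - l)) * (a * b) by ring.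
rewrite a2 b2.
have : 0 <= 2 * (l * (1 - l)) * (1 - (a * b + x * y)).
  by rewrite mulr_ge0 ?subr_ge0// !mulr_ge0// subr_ge0.
nra.
Qed.

End Lagrangian.

(** * Weak derivatives and primitives *)

Section WeakDerivatives.
Context {R : realType}.
Implicit Types u w f g phi : R -> R.
Notation mu := (@lebesgue_measure R).

Lemma locbdd_locally_integrable f : locbdd f -> locally_integrable setT f.
Proof.
move=> [mf bf]; split => //; first exact: openT.
move=> K _ cK.
have [N [_ /(_ (`|N| + 1))HN]] := compact_bounded cK.
have {}HN x : K x -> `|x| <= `|N| + 1.
  by apply: HN; rewrite (le_lt_trans (ler_norm _))// ltrDl.
have [M HM] := bf (`|N| + 1).
have mK : measurable K by exact: compact_measurable.
have : mu.-integrable K (EFin \o f).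
  apply: measurable_bounded_integrable => //.
  - exact: compact_finite_measure.
  - exact: measurable_funTS.
  exists M; split; first exact: num_real.
  by move=> M' MM' x /= Kx; rewrite (le_trans _ (ltW MM'))// HM// HN.
by move=> /integrableP[].
Qed.

Lemma locally_integrable_itv f s t : locally_integrable setT f ->
  mu.-integrable `[s, t] (EFin \o f).
Proof.
move=> [mf _ lf]; apply/integrableP; split.
  by apply/measurable_EFinP; exact: measurable_funTS.
by apply: lf => //; exact: segment_compact.
Qed.

Lemma Rintegral_supp f r : (forall x, r < `|x| -> f x = 0) ->
  \int[mu]_x f x = int f (- r) r.
Proof.
move=> f0; rewrite /int [RHS]Rintegral_mkcond; apply: eq_Rintegral => x _.
rewrite patchE; case: ifPn => //; rewrite notin_setE/= in_itv/= -ler_norml => /negP.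
by rewrite -ltNge => /f0.
Qed.

Lemma test_fun_supp phi : test_fun phi -> exists2 r, 0 < r &
  forall x, r < `|x| -> phi x = 0 /\ derive1 phi x = 0.
Proof.
move=> [_ /compact_bounded[N [_ /(_ (`|N| + 1))HN]]].
have {}HN x : closure [set x | phi x != 0] x -> `|x| <= `|N| + 1.
  by apply: HN; rewrite (le_lt_trans (ler_norm _))// ltrDl.
have H0 x : `|N| + 1 < `|x| -> phi x = 0.
  move=> xr; apply: contrapT => /eqP phx.
  by have := HN x (@subset_closure _ [set x | phi x != 0] _ phx); rewrite leNgt xr.
exists (`|N| + 1); first by rewrite ltr_wpDl.
move=> x xr; split; first exact: H0.
rewrite derive1E (@near_eq_derive _ _ _ phi (cst 0)) ?derive_cst//.
near=> y; apply: H0; near: y.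
by apply: (cvgr_gt `|x|) => //; exact: norm_continuous.
Unshelve. all: by end_near. Qed.

Lemma prim_weak_derivative u w : locbdd w -> prim u w -> weak_derivative u w.
Proof.
move=> lw uw; have lu := prim_locbdd lw uw.
split; [exact: locbdd_locally_integrable..|].
move=> phi tphi; have [r r0 Hr] := test_fun_supp tphi.
have [C1phi _] := tphi.
have ld : locbdd (derive1 phi) by exact: locbdd_continuous C1phi.2.
have lphi := prim_locbdd ld (prim_C1 C1phi).
(* beyond r the test function vanishes, so that the boundary terms at r + 1
   and - (r + 1) are 0 *)
rewrite (Rintegral_supp (r := r + 1)); last first.
  by move=> x xr; rewrite (Hr x _).2 ?mulr0//; lra.
rewrite (Rintegral_supp (r := r + 1)); last first.
  by move=> x xr; rewrite (Hr x _).1 ?mulr0//; lra.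
apply/eqP; rewrite -addr_eq0 -intD; [|exact: locbddM..].
rewrite -(prim_mul lw ld uw (prim_C1 C1phi)); last lra.
rewrite (Hr (r + 1) _).1 ?ger0_norm; [|lra..].
by rewrite (Hr (- (r + 1)) _).1 ?normrN ?ger0_norm; [rewrite !mulr0 subrr|lra..].
Qed.

(** The normalized primitive of the positive part of [(x - c) * (c + e - x)]. *)
Lemma smooth_step (c e : R) : 0 < e -> exists H : R -> R,
  [/\ C1_fun H, forall x, x <= c -> H x = 0, forall x, c + e <= x -> H x = 1,
      forall x, 0 <= H x <= 1 & forall x, 0 <= derive1 H x].
Proof.
move=> e0.
pose rho (x : R) : R := Num.max 0 ((x - c) * (c + e - x)).
have crho : continuous rho.
  move=> x; apply: (@continuous_max _ _ (cst 0) (fun x => (x - c) * (c + e - x))); first exact: cvg_cst.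
  apply: cvgM; apply: cvgB; [exact: cvg_id|exact: cvg_cst|exact: cvg_cst|exact: cvg_id].
have lrho := locbdd_continuous crho.
have rho0 x : 0 <= rho x by rewrite le_max lexx.
pose A := antider rho.
have PA : prim A rho := prim_antider lrho.
have Ale s t : s <= t -> A s <= A t.
  by move=> st; rewrite -subr_ge0 PA//; exact: int_ge0.
have Aconst s t : s <= t -> (t <= c \/ c + e <= s) -> A s = A t.
  move=> st ct; apply/eqP; rewrite eq_sym -subr_eq0 PA//.
  rewrite (@eq_int _ _ (fun=> 0)) ?int_cst ?mul0r// => x /andP[sx xt].
  rewrite /rho max_l//; case: ct => ct.
    by apply: mulr_le0_ge0; lra.
  by apply: mulr_ge0_le0; lra.
pose k := A (c + e) - A c.
have k0 : 0 < k.
  have h1 : A c <= A (c + e / 4) by apply: Ale; lra.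
  have h3 : A (c + 3 * e / 4) <= A (c + e) by apply: Ale; lra.
  (* on the middle half of [c, c + e] the bump is at least 3 e^2 / 16 *)
  have h2 : e ^+ 2 / 16 * (e / 2) <= A (c + 3 * e / 4) - A (c + e / 4).
    rewrite PA; last lra.
    apply: (@le_trans _ _ (int (fun=> e ^+ 2 / 16) (c + e / 4) (c + 3 * e / 4))).
      rewrite int_cst; last lra.
      by apply: ler_wpM2l; [rewrite divr_ge0// sqr_ge0|lra].
    apply: le_int => //; first exact: locbdd_cst.
    move=> x /andP[x1 x2]; rewrite /rho le_max; apply/orP; right.
    have : 0 <= (x - c - e / 4) * (c + 3 * e / 4 - x) by rewrite mulr_ge0//; lra.
    nra.
  have : 0 < e ^+ 2 / 16 * (e / 2) by rewrite mulr_gt0 ?divr_gt0// exprn_gt0.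
  by rewrite /k; lra.
pose H (x : R) : R := k^-1 * (A x - A c).
have dH (x : R) : is_derive x 1 H (k^-1 * rho x).
  have lk : locbdd (fun x => k^-1 * rho x) by exact: locbddZ.
  apply: (prim_is_derive lk); last by apply: cvgM; [exact: cvg_cst|exact: crho].
  have -> : H = (fun t => - (k^-1 * A c) + k^-1 * A t).
    by apply/funext => y; rewrite /H; ring.
  exact/primDc/primZ.
have dHE : derive1 H = (fun x => k^-1 * rho x).
  by apply/funext => x; rewrite derive1E (derive_val (is_derive := dH x)).
exists H; split.
- split; first by move=> x; exact: (ex_derive (is_derive := dH x)).
  by rewrite dHE => x; apply: cvgM; [exact: cvg_cst|exact: crho].
- by move=> x xc; rewrite /H (Aconst x c)// ?subrr ?mulr0//; left.
- move=> x xc; rewrite /H -(Aconst (c + e) x)// ?mulVf ?gt_eqF//; by right.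
- have k1 : 0 <= k^-1 by rewrite invr_ge0 ltW.
  move=> x; have [xc|xc] := leP x c.
    by rewrite /H (Aconst x c)// ?subrr ?mulr0 ?lexx ?ler01//; left.
  rewrite /H mulr_ge0 ?subr_ge0 ?Ale ?(ltW xc)//= mulrC ler_pdivrMr// mul1r lerB//.
  have [xe|xe] := leP x (c + e); first exact: Ale.
  by rewrite (Aconst (c + e) x (ltW xe) (or_intror (lexx _))).
- by move=> x; rewrite dHE mulr_ge0// invr_ge0 ltW.
Qed.

Lemma smooth_step_derive0 (H : R -> R) (c e x : R) : 0 < e ->
  (forall x, x <= c -> H x = 0) -> (forall x, c + e <= x -> H x = 1) ->
  (x < c) || (c + e < x) -> derive1 H x = 0.
Proof.
move=> e0 H0 H1 /orP[xc|xc]; rewrite derive1E.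
  rewrite (@near_eq_derive _ _ _ H (cst 0)) ?derive_cst//.
  by near=> y; apply: H0; apply/ltW; near: y; apply: (cvgr_lt x) => //; exact: cvg_id.
rewrite (@near_eq_derive _ _ _ H (cst 1)) ?derive_cst//.
by near=> y; apply: H1; apply/ltW; near: y; apply: (cvgr_gt x) => //; exact: cvg_id.
Unshelve. all: by end_near. Qed.

End WeakDerivatives.

Section Representation.
Context {R : realType}.
Implicit Types u w f g phi : R -> R.
Notation mu := (@lebesgue_measure R).

(** The derivatives of the steps form an approximate identity at [c]. *)
Lemma cvg_int_smooth_step u (c d : R) (e : nat -> R) (H : nat -> R -> R) :
  continuous u -> (forall n, 0 < e n) -> e n @[n --> \oo] --> 0 ->
  (forall n, c + e n <= d) ->
  (forall n, C1_fun (H n)) -> (forall n x, x <= c -> H n x = 0) ->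
  (forall n x, c + e n <= x -> H n x = 1) ->
  (forall n x, 0 <= derive1 (H n) x) ->
  forall b, b <= c ->
  int (fun x => u x * derive1 (H n) x) b d @[n --> \oo] --> u c.
Proof.
move=> cu e0 ecvg ed C1H H0 H1 dH0 b bc.
have bd : b <= d by have := ed 0%N; have := e0 0%N; lra.
apply/cvgrPdist_le => eps eps0.
have /cvgrPdist_le /(_ _ eps0)[r /= r0 Hr] := cu c.
have : \forall n \near \oo, e n < r by apply: (cvgr_lt 0).
apply: filterS => n enr.
have lD : locbdd (derive1 (H n)) by exact/locbdd_continuous/(C1H n).2.
have lu := locbdd_continuous cu.
have I1 : int (derive1 (H n)) b d = 1.
  by rewrite -(prim_C1 (C1H n))// (H1 n d (ed n)) (H0 n b bc) subr0.
have -> : u c = int (fun x => u c * derive1 (H n) x) b d by rewrite intZ// I1 mulr1.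
rewrite -intB; [|exact: locbddZ|exact: locbddM].
have lr : locbdd (fun x => eps * derive1 (H n) x) by exact: locbddZ.
have K x : `|u c * derive1 (H n) x - u x * derive1 (H n) x| <= eps * derive1 (H n) x.
  rewrite -mulrBl normrM (ger0_norm (dH0 n x)).
  have [|xc] := boolP ((x < c) || (c + e n < x)).
    by move=> /(smooth_step_derive0 (e0 n) (H0 n) (H1 n)) ->; rewrite !mulr0.
  apply: ler_wpM2r => //; apply: Hr; rewrite /ball_/= distrC.
  move: xc; rewrite negb_or -!leNgt => /andP[xc1 xc2].
  by rewrite ger0_norm ?subr_ge0//; lra.
have -> : eps = int (fun x => eps * derive1 (H n) x) b d by rewrite intZ// I1 mulr1.
have l0 : locbdd (fun x => u c * derive1 (H n) x - u x * derive1 (H n) x).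
  by apply: locbddB; [exact: locbddZ|exact: locbddM].
rewrite intZ// -intZ//; rewrite ler_norml -mulN1r -intZ//.
apply/andP; split; apply: le_int => //; first exact: locbddZ.
  by move=> x _; have := K x; rewrite ler_norml mulN1r => /andP[].
by move=> x _; have := K x; rewrite ler_norml => /andP[].
Qed.

(** Testing with the difference of two steps placed at [s] and at [t], and letting
    their widths tend to 0, the left-hand side tends to [u s - u t] by continuity
    and the right-hand side to minus the integral of [g] over [`]s, t]] by
    dominated convergence. *)
Lemma weak_derivative_prim u g : continuous u -> weak_derivative u g -> prim u g.
Proof.
move=> cu [_ lg ug] s t; rewrite le_eqVlt => /predU1P[->|st].
  by rewrite subrr /int set_itv1 Rintegral_set1.
pose e n := (t - s) / n.+1%:R.
have e0 n : 0 < e n by rewrite divr_gt0// subr_gt0.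
have ets n : e n <= t - s.
  by rewrite ler_pdivrMr// ler_peMr ?ler1n// subr_ge0 ltW.
have ecvg : e n @[n --> \oo] --> 0.
  rewrite -(mulr0 (t - s)); apply: cvgM; first exact: cvg_cst.
  exact: cvg_harmonic.
have /choice[Hs HHs] : forall n, exists H : R -> R, [/\ C1_fun H, forall x, x <= s -> H x = 0, forall x, s + e n <= x -> H x = 1,
      forall x, 0 <= H x <= 1 & forall x, 0 <= derive1 H x].
  by move=> n; exact: smooth_step.
have /choice[Ht HHt] : forall n, exists H : R -> R, [/\ C1_fun H, forall x, x <= t -> H x = 0, forall x, t + e n <= x -> H x = 1,
      forall x, 0 <= H x <= 1 & forall x, 0 <= derive1 H x].
  by move=> n; exact: smooth_step.
pose d := t + (t - s).
pose phi n (x : R) : R := Hs n x - Ht n x.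
have dphi n (x : R) : is_derive x 1 (phi n) (derive1 (Hs n) x - derive1 (Ht n) x).
  have [[D1 _] _ _ _ _] := HHs n; have [[D2 _] _ _ _ _] := HHt n.
  by rewrite !derive1E; apply: is_deriveB; apply: DeriveDef.
have dphiE n : derive1 (phi n) = (fun x => derive1 (Hs n) x - derive1 (Ht n) x).
  by apply/funext => x; rewrite derive1E (derive_val (is_derive := dphi n x)).
have phi0 n x : x <= s \/ d <= x -> phi n x = 0.
  have [_ s0 s1 _ _] := HHs n; have [_ t0 t1 _ _] := HHt n.
  rewrite /phi; case=> H; first by rewrite s0// t0 ?subrr//; lra.
  have := ets n; have := e0 n; rewrite /d in H => *.
  by rewrite s1 ?t1 ?subrr//; lra.
have dphi0 n x : x < s \/ d < x -> derive1 (phi n) x = 0.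
  have [_ s0 s1 _ _] := HHs n; have [_ t0 t1 _ _] := HHt n.
  have := ets n; have := e0 n; rewrite dphiE /d => en0 ent.
  case=> H; rewrite (smooth_step_derive0 en0 s0 s1) ?(smooth_step_derive0 en0 t0 t1) ?subrr//;
    apply/orP; by [left; lra|right; lra].
have tphi n : test_fun (phi n).
  have [[D1 E1] _ _ _ _] := HHs n; have [[D2 E2] _ _ _ _] := HHt n.
  split; first split.
  - by move=> x; exact: (ex_derive (is_derive := dphi n x)).
  - by rewrite dphiE => x; apply: cvgB; [exact: E1|exact: E2].
  - apply: (@subclosed_compact _ _ `[s, d]).
    + exact: closed_closure.
    + exact: segment_compact.
    + rewrite closureE => x /= /(_ `[s, d]%classic); apply; split; first exact: itv_closed.
      move=> y /= /eqP phiy; rewrite in_itv/=; apply/andP; split.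
        by rewrite leNgt; apply/negP => ys; apply: phiy; apply: phi0; left; exact: ltW.
      by rewrite leNgt; apply/negP => ys; apply: phiy; apply: phi0; right; exact: ltW.
have sd : s <= d by rewrite /d; lra.
pose L n := int (fun x => u x * derive1 (phi n) x) s d.
have L1 : L n @[n --> \oo] --> u s - u t.
  have -> : L = (fun n => int (fun x => u x * derive1 (Hs n) x) s d - int (fun x => u x * derive1 (Ht n) x) s d).
    apply/funext => n; rewrite /L.
    have [[_ E1] _ _ _ _] := HHs n; have [[_ E2] _ _ _ _] := HHt n.
    have lu := locbdd_continuous cu.
    rewrite -intB; [|exact/locbddM/locbdd_continuous|exact/locbddM/locbdd_continuous].
    by apply: eq_int => x _; rewrite dphiE mulrBr.
  apply: cvgB.
    apply: (cvg_int_smooth_step cu e0 ecvg) => // [n|n|n x|n x|n x]; try by case: (HHs n) => //; auto.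
    by have := ets n; rewrite /d; lra.
  apply: (cvg_int_smooth_step cu e0 ecvg) => // [n|n|n x|n x|n x|]; try by case: (HHt n) => //; auto.
    by have := ets n; rewrite /d; lra.
  exact: ltW.
have supp_int f : (forall x, x < s \/ d < x -> f x = 0) -> \int[mu]_x f x = int f s d.
  move=> f0; rewrite /int [RHS]Rintegral_mkcond; apply: eq_Rintegral => x _.
  rewrite patchE; case: ifPn => //; rewrite notin_setE/= in_itv/= => /negP.
  by rewrite negb_and -!ltNge => /orP /f0.
have LE n : L n = - int (fun x => g x * phi n x) s d.
  rewrite /L -!supp_int; first exact: ug.
    by move=> x [H|H]; rewrite (phi0 n) ?mulr0//; [left|right]; exact: ltW.
  by move=> x H; rewrite dphi0 ?mulr0.
have ig := locally_integrable_itv s d lg.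
have [mg _ _] := lg.
have lphi n : locbdd (phi n).
  apply: locbdd_continuous => x.
  by apply: differentiable_continuous; apply/derivable1_diffP; exact: (ex_derive (is_derive := dphi n x)).
have L2 : int (fun x => g x * phi n x) s d @[n --> \oo] --> int (g \_ `]s, t]) s d.
  have mgi : measurable_fun `[s, d] (g \_ `]s, t]).
    apply: measurable_funTS; apply: (measurable_restrictT g (measurable_itv `]s, t])).1.
    exact: measurable_funTS.
  have phi1 n x : `|phi n x| <= 1.
    have [_ s0 s1 s01 _] := HHs n; have [_ t0 t1 t01 _] := HHt n.
    rewrite /phi; have := s01 x; have := t01 x; rewrite ler_norml; lra.
  have [||||ih _ H] := @dominated_convergence _ _ R mu `[s, d]%classic (measurable_itv _)
    (fun n x => (g x * phi n x)%:E) (EFin \o (g \_ `]s, t])) (fun x => `|g x|%:E) _ _ _ (integrable_abse ig).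
  - by move=> n; apply/measurable_EFinP/measurable_funTS; exact: measurable_funM mg (lphi n).1.
  - by apply/measurable_EFinP.
  - apply: aeW => x /=; rewrite in_itv/= => /andP[sx xd].
    apply/fine_cvgP; split; first exact: nearW.
    apply: cvg_near_cst; rewrite patchE.
    case: ifPn => xst.
      move: xst; rewrite inE/= in_itv/= => /andP[sx' xt].
      have : \forall n \near \oo, e n < x - s by apply: (cvgr_lt 0) => //; rewrite subr_gt0.
      apply: filterS => n en /=.
      have [_ s0 s1 s01 _] := HHs n; have [_ t0 t1 t01 _] := HHt n.
      by rewrite /phi s1 ?t0 ?subr0 ?mulr1//; lra.
    have [xs|xns] := eqVneq x s.
      by apply: nearW => n /=; rewrite (phi0 n) ?mulr0//; left; rewrite xs.
    have tx : t < x.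
      rewrite ltNge; apply/negP => xt; move: xst; rewrite notin_setE/=; apply.
      by rewrite in_itv/= xt andbT lt_neqAle sx eq_sym xns.
    have : \forall n \near \oo, e n < x - t by apply: (cvgr_lt 0) => //; rewrite subr_gt0.
    apply: filterS => n en /=.
    have [_ s0 s1 s01 _] := HHs n; have [_ t0 t1 t01 _] := HHt n.
    by rewrite /phi s1 ?t1 ?subrr ?mulr0//; lra.
  - apply: aeW => x n /= _; rewrite lee_fin normrM.
    by rewrite ler_piMr.
  apply: fine_cvg; rewrite fineK; first exact: H.
  by apply: integrable_fin_num.
have E : u s - u t = - int (g \_ `]s, t]) s d.
  apply: (cvg_unique _ L1); first exact: Rhausdorff.
  rewrite (_ : L = fun n => - int (fun x => g x * phi n x) s d); last exact/funext.
  exact: cvgN.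
have : int (g \_ `]s, t]) s d = int g s t.
  rewrite /int -Rintegral_mkcondr (_ : `[s, d] `&` `]s, t] = `]s, t]%classic).
    rewrite Rintegral_itv_obnd_cbnd//; apply: integrableS (locally_integrable_itv s t lg) => //.
    by apply: subset_itvr; rewrite bnd_simp.
  apply/seteqP; split => [x []//|x/=]; rewrite !in_itv/= => /andP[sx xt]; split.
    by rewrite (ltW sx)/= /d; lra.
  by rewrite sx.
by move=> <-; lra.
Qed.

(** At its Lebesgue points, hence almost everywhere, each of the two functions is
    the derivative of [u]. *)
Lemma prim_ae_unique u f g : locally_integrable setT f -> locally_integrable setT g ->
  prim u f -> prim u g -> {ae mu, forall x, f x = g x}.
Proof.
move=> lf lg uf ug.
have := lebesgue_differentiation lg; have := lebesgue_differentiation lf.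
apply: filterS2; first exact: (ae_filter_ringOfSetsType mu).
move=> x fx gx.
have D h : locally_integrable setT h -> lebesgue_pt h x ->
    derive1 (int h (x - 1)) x = h x.
  move=> lh hx.
  have [//||//|_] := @FTC1_lebesgue_pt R h (BLeft (x - 1)) x (x + 1) _ _ _ hx.
  - by rewrite ltrDl.
  - exact: locally_integrable_itv.
  - by rewrite lte_fin ltrBlDr ltrDl.
  - by [].
rewrite -(D f)// -(D g)//; congr (derive1 _ x); apply/funext => y.
have [xy|yx] := leP (x - 1) y; first by rewrite -uf// -ug.
by rewrite /int !set_itv_ge ?bnd_simp -?ltNge// !Rintegral_set0.
Qed.

End Representation.

(** * Lebesgue measurable functions and the completed measure *)

Section Completion.
Context {R : realType}.
Notation mu := (@lebesgue_measure R).
Notation cmu := (@completed_lebesgue_measure R).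
Notation cara := (caratheodory_type (@wlength R idfun)^*%mu).

(** Each set [q < f] with [q] rational is Borel up to a Borel null set; the union
    of these countably many null sets works for all levels. *)
Lemma lebesgue_measurable_borel_off_null (f : R -> R) :
  lebesgue_measurable_fun f -> exists2 N : set R,
    measurable N /\ mu N = 0 &
    forall c, measurable_fun setT (fun t => if t \in N then c else f t).
Proof.
move=> mf.
have E q : exists XN : set R * set R, [/\ measurable XN.1, measurable XN.2, mu XN.2 = 0 &
    [set t | ratr q < f t] `\` XN.2 = XN.1 `\` XN.2].
  have : measurable ([set t | ratr q < f t] : set cara).
    have := mf measurableT `]ratr q, +oo[%classic (measurable_itv _).
    rewrite setTI; congr (measurable _); apply/seteqP; split => t /=; rewrite in_itv/= andbT//.
  rewrite -[measurable _]/(((wlength idfun)^*%mu).-cara.-measurable _).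
  rewrite -completed_caratheodory_measurable g_sigma_completed_algebra_genE.
  move=> [X mX [N' [N [mN N0 NN]]]] <-.
  exists (X, N); split => //=; apply/seteqP; split => t /=.
    by move=> [[//|/NN]].
  by move=> [Xt Nt]; split => //; left.
have /choice[XN HXN] := E.
pose N := \bigcup_q (XN q).2.
have mN : measurable N by apply: bigcupT_measurable_rat => q; have [] := HXN q.
exists N.
  split => //; apply/negligibleP => //.
  pose F n := if @unpickle rat n is Some q then (XN q).2 else set0.
  have -> : N = \bigcup_n F n.
    apply/seteqP; split => t [q _ Xq]; first by exists (pickle q); [exact: I|rewrite /F pickleK].
    by move: Xq; rewrite /F; case: unpickle => // q' Xq'; exists q'.
  apply: negligible_bigcup => n; rewrite /F; case: unpickle => [q|]; last exact: negligible_set0.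
  by apply/negligibleP; have [] := HXN q.
move=> c; apply: (measurability _ (RGenOInfty.measurableE R)) => _ [_ [x ->] <-].
rewrite setTI.
have -> : (fun t => if t \in N then c else f t) @^-1` `]x, +oo[ =
   ((\bigcup_q (if x < ratr q then (XN q).1 `\` N else set0)) `|`
    (if x < c then N else set0)).
  have K q t : ~ N t -> ratr q < f t <-> (XN q).1 t.
    move=> Nt; have [_ _ _ /seteqP[H1 H2]] := HXN q.
    have Nq : ~ (XN q).2 t by move=> ?; apply: Nt; exists q.
    by split=> [h|h]; [have [] := H1 t (conj h Nq)|have [] := H2 t (conj h Nq)].
  apply/seteqP; split => t /=.
    rewrite in_itv/= andbT; case: ifPn => [|].
      by rewrite inE => Nt xc; right; rewrite xc.
    rewrite notin_setE => Nt xf; left.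
    have [q] := rat_in_itvoo xf; rewrite in_itv/= => /andP[xq qf].
    by exists q => //; rewrite xq; split => //; apply/(K q t).
  rewrite in_itv/= andbT => -[[q _]|].
    case: ifPn => // xq [Xt Nt]; rewrite memNset//.
    by rewrite (lt_trans xq)//; apply/K.
  by case: ifPn => // xc Nt; rewrite mem_set.
apply: measurableU; last by case: ifP.
apply: bigcupT_measurable_rat => q; case: ifP => // _; apply: measurableD => //.
by have [] := HXN q.
Qed.

Lemma measurable_cara_id : measurable_fun [set: cara] (id : cara -> measurableTypeR R).
Proof.
by move=> _ A mA; rewrite setTI; exact: sub_caratheodory mA.
Qed.

(** The identity pushes the completed measure forward to the measure on the Borel
    sets. *)
Lemma ge0_integral_completed (f : R -> \bar R) : measurable_fun setT f ->
  (forall t, (0 <= f t)%E) -> (\int[cmu]_t f t = \int[mu]_t f t)%E.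
Proof.
move=> mf f0.
rewrite (@eq_measure_integral _ (measurableTypeR R) R setT
  (measure_function_pushforward__canonical__measure_function_Measure cmu measurable_cara_id) mu).
  by rewrite [RHS](ge0_integral_pushforward measurable_cara_id).
by [].
Qed.

Lemma ae_completed (P : R -> Prop) : {ae mu, forall t, P t} -> {ae cmu, forall t, P t}.
Proof.
move=> [N [mN N0 PN]]; exists N; split => //; exact: sub_caratheodory mN.
Qed.

(** Lets an integrand that is only Lebesgue measurable be replaced by a Borel one. *)
Lemma ge0_integral_completed_ae (f g : R -> \bar R) : measurable_fun setT g ->
  (forall t, (0 <= f t)%E) -> (forall t, (0 <= g t)%E) ->
  {ae mu, forall t, g t = f t} -> (\int[cmu]_t f t = \int[mu]_t g t)%E.
Proof.
move=> mg f0 g0 gf.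
have mg' : measurable_fun [set: cara] g.
  by move=> _ A mA; rewrite setTI; apply: sub_caratheodory; rewrite -[_ @^-1` _]setTI; exact: mg.
have gf' : ae_eq cmu setT g f.
  by move: (ae_completed gf) => [N [mN N0 PN]]; exists N; split => // t /= H; apply: PN => /= H'; apply: H.
rewrite -ge0_integral_completed//; apply: ge0_ae_eq_integral => //.
  exact: (ae_measurable_fun completed_lebesgue_measure_is_complete gf').
by move: gf' => [N [mN N0 PN]]; exists N; split => // t /= H; apply: PN => /= H'; apply: H => ?; rewrite H'.
Qed.

End Completion.

(** * Admissible pairs and their action *)

Section Admissible.
Context {R : realType}.
Implicit Types u w y a b W : R -> R.
Notation mu := (@lebesgue_measure R).

Lemma ae_impl (P Q : R -> Prop) : (forall t, P t -> Q t) ->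
  {ae mu, forall t, P t} -> {ae mu, forall t, Q t}.
Proof. by apply: filterS; exact: (ae_filter_ringOfSetsType mu). Qed.

(** The space [X1], with a slope chosen for each element that is Borel and bounded
    by 1 at every point. *)
Definition adm y w := [/\ measurable_fun setT w, forall t, `|w t| <= 1, prim y w,
  y t @[t --> +oo] --> (1 : R) & y t @[t --> -oo] --> (- 1 : R)].

Lemma bounded_locbdd (M : R) w : measurable_fun setT w -> (forall t, `|w t| <= M) -> locbdd w.
Proof. by move=> mw wM; split => // r; exists M. Qed.

Lemma adm_locbdd y w : adm y w -> locbdd w.
Proof. by case=> mw w1 _ _ _; exact: bounded_locbdd w1. Qed.

Lemma adm_continuous y w : adm y w -> continuous y.
Proof. by move=> yw; apply: prim_continuous (adm_locbdd yw) _; case: yw. Qed.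

Lemma prim_1lip y w : measurable_fun setT w -> (forall t, `|w t| <= 1) -> prim y w ->
  forall s t, `|y t - y s| <= `|t - s|.
Proof.
move=> mw w1 yw s t; rewrite -[leRHS]mul1r.
exact: (prim_bound (bounded_locbdd mw w1) yw w1).
Qed.

Lemma adm_lip y w : adm y w -> forall s t, `|y t - y s| <= `|t - s|.
Proof. by case=> mw w1 yw _ _; exact: prim_1lip w1 yw. Qed.

Lemma adm_bounded y w : adm y w -> exists M, forall t, `|y t| <= M.
Proof.
move=> yw; have [_ /(_ _)H] := prim_locbdd (adm_locbdd yw) (let: And5 _ _ p _ _ := yw in p).
have [_ _ _ yp yn] := yw.
have /cvgrPdist_le /(_ _ ltr01) [A [_ HA]] := yp.
have /cvgrPdist_le /(_ _ ltr01) [B [_ HB]] := yn.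
have [M HM] := H (`|A| + `|B| + 1).
exists (Num.max M 2) => t; rewrite le_max.
have := ler_norm A; have := ler_norm (- B); rewrite normrN => nB nA.
have := normr_ge0 A; have := normr_ge0 B => pB pA.
have [tA|tA] := ltP A t.
  have := HA t tA => /= H1; apply/orP; right.
  by move: H1; rewrite ler_norml => H1; rewrite ler_norml; lra.
have [tB|tB] := ltP t B.
  have := HB t tB => /= H1; apply/orP; right.
  by move: H1; rewrite ler_norml => H1; rewrite ler_norml; lra.
apply/orP; left; apply: HM; rewrite ler_norml; lra.
Qed.

Let muT_gt0 : (0 < mu setT)%E.
Proof. by rewrite -set_itvNyy [X in (_ < X)%E](lebesgue_measure_itv `]-oo, +oo[)/= ltry. Qed.

Lemma Lnorm_oo_le f (M : \bar R) : ('N[mu]_+oo[f] <= M)%E <-> {ae mu, forall t, (`|f t| <= M)%E}.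
Proof.
rewrite unlock /= muT_gt0; split => [/ess_supP//|H]; exact/ess_supP.
Qed.

Lemma bounded_Lfun_oo (f : R -> R) (M : R) : measurable_fun setT f -> (forall t, `|f t| <= M) ->
  f \in Lfun mu +oo%E.
Proof.
move=> mf fM; rewrite inE/=; apply/andP; split; first by rewrite inE.
rewrite inE/=; apply: (@le_lt_trans _ _ M%:E); last exact: ltry.
by apply/Lnorm_oo_le; apply: aeW => t; rewrite lee_fin.
Qed.

Lemma wderiv_weak_derivative u w : weak_derivative u w -> weak_derivative u (wderiv u).
Proof. by move=> uw; apply: xgetPex; exists w. Qed.

Lemma wderiv_ae_prim u w : locbdd w -> prim u w -> {ae mu, forall t, wderiv u t = w t}.
Proof.
move=> lw uw; have W := prim_weak_derivative lw uw; have := wderiv_weak_derivative W => W'.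
have cu := prim_continuous lw uw.
apply: (prim_ae_unique _ _ (weak_derivative_prim cu W')) => //; first by case: W'.
exact: locbdd_locally_integrable.
Qed.

(** The weak derivative exceeds 1 in modulus on a null set only, so it may be
    truncated. *)
Lemma X1_adm u : X1 u -> exists2 w, adm u w & {ae mu, forall t, wderiv u t = w t}.
Proof.
move=> [cu [_ [g ug _]] /Lnorm_oo_le u1 up un].
have W := wderiv_weak_derivative ug.
pose w t := Num.max (-1) (Num.min (wderiv u t) 1).
have [_ lD _] := W; have [mD _ _] := lD.
have mw : measurable_fun setT w.
  by apply: measurable_maxr => //; exact: measurable_minr.
have w1 t : `|w t| <= 1.
  by rewrite ler_norml le_max lexx/= ge_max ge_min lexx orbT andbT; lra.
have Dw : {ae mu, forall t, wderiv u t = w t}.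
  apply: ae_impl u1 => t; rewrite lee_fin ler_norml => /andP[t1 t2].
  by rewrite /w min_l// max_r.
exists w => //; split => // s t st.
rewrite (weak_derivative_prim cu W st) /int /Rintegral; congr fine.
apply: ae_eq_integral => //.
- by apply/measurable_EFinP; exact: measurable_funTS.
- by apply/measurable_EFinP; exact: measurable_funTS.
- by apply: ae_impl Dw => x /= -> _.
Qed.

Lemma adm_X1 u w : adm u w -> X1 u.
Proof.
move=> uw; have [mw w1 p up un] := uw; have lw := adm_locbdd uw.
have cu := adm_continuous uw; have [M HM] := adm_bounded uw.
split => //.
- split; first by apply: bounded_Lfun_oo HM; exact: continuous_measurable_fun.
  by exists w; [exact: prim_weak_derivative|exact: bounded_Lfun_oo w1].
- apply/Lnorm_oo_le; have := wderiv_ae_prim lw p.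
  by apply: ae_impl => t /= ->; rewrite lee_fin.
Qed.

Definition lag b W y w t := Phi (w t) + b t * W (y t).

(** The slope is an argument of its own, so that curves can be cut and glued
    without reference to the weak derivative of the result. *)
Definition act b W y w (D : set R) : \bar R := (\int[mu]_(t in D) (lag b W y w t)%:E)%E.

Lemma measurable_lag b W y w : measurable_fun setT b -> continuous W ->
  continuous y -> measurable_fun setT w -> measurable_fun setT (lag b W y w).
Proof.
move=> mb cW cy mw; apply: measurable_funD.
  apply: measurableT_comp => //; apply: continuous_measurable_fun; exact: Phi_continuous.
apply: measurable_funM => //; apply: continuous_measurable_fun => t.
by apply: continuous_comp; [exact: cy|exact: cW].
Qed.

Lemma lag_ge0 b W y w : (forall t, 0 <= b t) -> (forall s, 0 <= W s) ->
  forall t, 0 <= lag b W y w t.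
Proof. by move=> b0 W0 t; rewrite addr_ge0 ?Phi_ge0// mulr_ge0. Qed.

Lemma action_act a b W u w (N : set R) : measurable N -> mu N = 0 ->
  (forall t, ~ N t -> a t = b t) -> measurable_fun setT b ->
  (forall t, 0 <= a t) -> (forall t, 0 <= b t) ->
  continuous W -> (forall s, 0 <= W s) -> continuous u -> measurable_fun setT w ->
  {ae mu, forall t, wderiv u t = w t} -> action a W u = act b W u w setT.
Proof.
move=> mN N0 ab mb a0 b0 cW W0 cu mw Dw.
apply: ge0_integral_completed_ae.
- by apply/measurable_EFinP; exact: measurable_lag.
- move=> t; rewrite lee_fin; have := lag_ge0 u (wderiv u) a0 W0 t.
  by rewrite /lag /Phi real_normK// num_real.
- by move=> t; rewrite lee_fin; exact: lag_ge0.
have aeb : {ae mu, forall t, a t = b t}.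
  by exists N; split => // t /= H; apply: contrapT => /ab.
apply: (@filterS2 _ _ (ae_filter_ringOfSetsType mu) _ _ _ _ Dw aeb).
by move=> t /= -> ->; rewrite real_normK// num_real.
Qed.

End Admissible.

(** * Splicing curves *)

Section Splicing.
Context {R : realType}.
Implicit Types (u w y b f g : R -> R) (D : set R).

Definition glue (s : R) f g (t : R) : R := if t <= s then f t else g t.

Lemma measurable_glue s f g : measurable_fun setT f -> measurable_fun setT g ->
  measurable_fun setT (glue s f g).
Proof.
move=> mf mg; apply: measurable_fun_ifT => //.
by apply: measurable_fun_ler => //; exact: measurable_cst.
Qed.

Lemma glue_norm_le s f g (M : R) : (forall t, `|f t| <= M) -> (forall t, `|g t| <= M) ->
  forall t, `|glue s f g t| <= M.
Proof. by move=> fM gM t; rewrite /glue; case: ifP. Qed.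

Lemma glue_l s f g t : t <= s -> glue s f g t = f t.
Proof. by rewrite /glue => ->. Qed.

Lemma glue_r s f g t : s < t -> glue s f g t = g t.
Proof. by rewrite /glue leNgt => ->. Qed.

(** Splicing is ambiguous at the junction only, the left end point here. *)
Lemma eq_int_oc f g (s t : R) : locbdd f -> locbdd g ->
  (forall x, s < x <= t -> f x = g x) -> int f s t = int g s t.
Proof.
move=> lf lg fg; rewrite /int -!Rintegral_itv_obnd_cbnd.
- by apply: eq_Rintegral => x; rewrite inE/= in_itv/=; exact: fg.
- by apply: integrableS (locbdd_integrable s t lg) => //; apply: subset_itvr; rewrite bnd_simp.
- by apply: integrableS (locbdd_integrable s t lf) => //; apply: subset_itvr; rewrite bnd_simp.
Qed.

Lemma locbdd_glue s f g : locbdd f -> locbdd g -> locbdd (glue s f g).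
Proof.
move=> [mf bf] [mg bg]; split; first exact: measurable_glue.
move=> r; have [M HM] := bf r; have [N HN] := bg r; exists (Num.max M N) => x xr.
by rewrite le_max /glue; case: ifP => _; rewrite ?HM ?HN ?orbT.
Qed.

Lemma prim_glue s y1 w1 y2 w2 : locbdd w1 -> locbdd w2 -> prim y1 w1 -> prim y2 w2 ->
  y1 s = y2 s -> prim (glue s y1 y2) (glue s w1 w2).
Proof.
move=> l1 l2 p1 p2 ys r t rt; have lg := locbdd_glue s l1 l2.
have [ts|st] := leP t s.
  rewrite !glue_l//; last exact: le_trans ts.
  by rewrite p1//; apply: eq_int => x /andP[_ xt]; rewrite glue_l// (le_trans xt).
have [rs|sr] := leP r s.
  rewrite glue_r// glue_l// (int_split (r := s) lg); last by rewrite rs ltW.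
  rewrite (@eq_int _ _ w1 r s); last by move=> x /andP[_ xs]; rewrite glue_l.
  rewrite (@eq_int_oc _ w2 s t)//; last by move=> x /andP[sx _]; rewrite glue_r.
  rewrite -p1// -p2 ?(ltW st)//; lra.
rewrite !glue_r// p2//; apply: eq_int_oc => // x /andP[rx _].
by rewrite glue_r// (lt_trans sr).
Qed.

Lemma cvg_glue_pinfty s f g (l : R) : g t @[t --> +oo] --> l -> glue s f g t @[t --> +oo] --> l.
Proof.
apply: cvg_trans; apply: near_eq_cvg.
have : \forall t \near +oo, s < t by apply: nbhs_pinfty_gt; exact: num_real.
by apply: filterS => t st; rewrite glue_r.
Qed.

Lemma cvg_glue_ninfty s f g (l : R) : f t @[t --> -oo] --> l -> glue s f g t @[t --> -oo] --> l.
Proof.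
apply: cvg_trans; apply: near_eq_cvg.
have : \forall t \near -oo, t <= s by apply: nbhs_ninfty_le; exact: num_real.
by apply: filterS => t st; rewrite glue_l.
Qed.

Lemma adm_glue s y1 w1 y2 w2 : measurable_fun setT w1 -> (forall t, `|w1 t| <= 1) -> prim y1 w1 ->
  measurable_fun setT w2 -> (forall t, `|w2 t| <= 1) -> prim y2 w2 -> y1 s = y2 s ->
  y1 t @[t --> -oo] --> (- 1 : R) -> y2 t @[t --> +oo] --> (1 : R) ->
  adm (glue s y1 y2) (glue s w1 w2).
Proof.
move=> m1 b1 p1 m2 b2 p2 ys c1 c2; split.
- exact: measurable_glue.
- exact: glue_norm_le.
- by apply: prim_glue => //; exact: bounded_locbdd.
- exact: cvg_glue_pinfty.
- exact: cvg_glue_ninfty.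
Qed.

End Splicing.

(** * The action on subsets of the line *)

Section Action.
Context {R : realType}.
Variables (W : R -> R) (cW : continuous W) (W0 : forall s, 0 <= W s).
Implicit Types (u w y b f g : R -> R) (D : set R).
Notation mu := (@lebesgue_measure R).

Lemma act_ge0 b y w D : (forall t, 0 <= b t) -> (0 <= act b W y w D)%E.
Proof. by move=> b0; apply: integral_ge0 => t _; rewrite lee_fin lag_ge0. Qed.

Lemma measurable_lag_EFin b y w D : measurable_fun setT b -> continuous y ->
  measurable_fun setT w -> measurable_fun D (fun t => (lag b W y w t)%:E).
Proof.
by move=> mb cy mw; apply/measurable_EFinP; apply: measurable_funTS; exact: measurable_lag.
Qed.

Lemma act_setU b y w D1 D2 : measurable_fun setT b -> (forall t, 0 <= b t) ->
  continuous y -> measurable_fun setT w -> measurable D1 -> measurable D2 ->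
  (forall t, D1 t -> D2 t -> False) ->
  act b W y w (D1 `|` D2) = (act b W y w D1 + act b W y w D2)%E.
Proof.
move=> mb b0 cy mw m1 m2 d12; apply: ge0_integral_setU => //.
- exact: measurable_lag_EFin.
- by move=> t _; rewrite lee_fin lag_ge0.
- by apply/disj_setPS => t [/d12].
Qed.

Lemma act_split b y w s : measurable_fun setT b -> (forall t, 0 <= b t) ->
  continuous y -> measurable_fun setT w ->
  act b W y w setT = (act b W y w `]-oo, s] + act b W y w `]s, +oo[)%E.
Proof.
move=> mb b0 cy mw; rewrite -act_setU//.
  by congr act; apply/esym/seteqP; split => // t _; rewrite /= !in_itv/= andbT; have [ts|ts] := leP t s; [left|right].
by move=> t /=; rewrite !in_itv/= andbT leNgt => /negP.
Qed.

Lemma act_subset b y w D1 D2 : measurable_fun setT b -> (forall t, 0 <= b t) ->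
  continuous y -> measurable_fun setT w -> measurable D1 -> measurable D2 ->
  D1 `<=` D2 -> (act b W y w D1 <= act b W y w D2)%E.
Proof.
move=> mb b0 cy mw m1 m2 d12; apply: ge0_subset_integral => //.
- exact: measurable_lag_EFin.
- by move=> t _; rewrite lee_fin lag_ge0.
Qed.

Lemma eq_act b y w y' w' D : (forall t, D t -> y t = y' t) -> (forall t, D t -> w t = w' t) ->
  act b W y w D = act b W y' w' D.
Proof.
by move=> yy ww; apply: eq_integral => t /[!inE] Dt; rewrite /lag yy// ww.
Qed.

Lemma le_act b b' y w y' w' D : measurable_fun setT b -> (forall t, 0 <= b t) ->
  continuous y -> measurable_fun setT w ->
  measurable_fun setT b' -> continuous y' -> measurable_fun setT w' -> measurable D ->
  (forall t, D t -> lag b W y w t <= lag b' W y' w' t) ->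
  (act b W y w D <= act b' W y' w' D)%E.
Proof.
move=> mb b0 cy mw mb' cy' mw' mD H; apply: ge0_le_integral => //.
- by move=> t _; rewrite lee_fin lag_ge0.
- exact: measurable_lag_EFin.
- exact: measurable_lag_EFin.
Qed.

Lemma act_le_cst b y w D (c : R) : measurable_fun setT b -> (forall t, 0 <= b t) ->
  continuous y -> measurable_fun setT w -> measurable D ->
  (forall t, D t -> lag b W y w t <= c) -> (act b W y w D <= c%:E * mu D)%E.
Proof.
move=> mb b0 cy mw mD H; have [->|/set0P[t0 Dt0]] := eqVneq D set0.
  by rewrite /act integral_set0 measure0 mule0.
have c0 : 0 <= c by rewrite (le_trans _ (H _ Dt0))// lag_ge0.
rewrite -integral_cst//; apply: ge0_le_integral => //.
- by move=> t _; rewrite lee_fin lag_ge0.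
- exact: measurable_lag_EFin.
Qed.

Lemma act_ge_cst b y w D (c : R) : 0 <= c -> measurable_fun setT b -> (forall t, 0 <= b t) ->
  continuous y -> measurable_fun setT w -> measurable D ->
  (forall t, D t -> c <= lag b W y w t) -> (c%:E * mu D <= act b W y w D)%E.
Proof.
move=> c0 mb b0 cy mw mD H.
rewrite -integral_cst//; apply: ge0_le_integral => //.
- exact: measurable_lag_EFin.
Qed.

Lemma act_int b y w s t : locbdd b -> continuous y -> locbdd w ->
  act b W y w `[s, t] = (int (lag b W y w) s t)%:E.
Proof.
move=> lb cy lw; rewrite /int /Rintegral fineK//.
apply: integrable_fin_num => //; apply: locbdd_integrable; apply: locbddD.
  by apply: locbdd_comp => //; exact: Phi_continuous.
apply: locbddM => //; apply: locbdd_comp => //; exact: locbdd_continuous.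
Qed.

End Action.

(** * Intermediate values of functions with limits at infinity *)

Section IntermediateValues.
Context {R : realType}.
Implicit Types (y : R -> R).

Lemma cvg_ninfty_lt y (l v : R) : y t @[t --> -oo] --> l -> l < v ->
  exists A, forall t, t <= A -> y t < v.
Proof.
move=> yl lv; have [A [_ HA]] : \forall t \near -oo, y t < v by exact: (cvgr_lt l).
exists (A - 1) => t tA; apply: HA; lra.
Qed.

Lemma cvg_ninfty_gt y (l v : R) : y t @[t --> -oo] --> l -> v < l ->
  exists A, forall t, t <= A -> v < y t.
Proof.
move=> yl lv; have [A [_ HA]] : \forall t \near -oo, v < y t by exact: (cvgr_gt l).
exists (A - 1) => t tA; apply: HA; lra.
Qed.

Lemma cvg_pinfty_lt y (l v : R) : y t @[t --> +oo] --> l -> l < v ->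
  exists A, forall t, A <= t -> y t < v.
Proof.
move=> yl lv; have [A [_ HA]] : \forall t \near +oo, y t < v by exact: (cvgr_lt l).
exists (A + 1) => t tA; apply: HA; lra.
Qed.

Lemma cvg_pinfty_gt y (l v : R) : y t @[t --> +oo] --> l -> v < l ->
  exists A, forall t, A <= t -> v < y t.
Proof.
move=> yl lv; have [A [_ HA]] : \forall t \near +oo, v < y t by exact: (cvgr_gt l).
exists (A + 1) => t tA; apply: HA; lra.
Qed.

Lemma IVT_continuous y (s t v : R) : continuous y -> s <= t ->
  (y s <= v <= y t) || (y t <= v <= y s) -> exists2 r, s <= r <= t & y r = v.
Proof.
move=> cy st H; have [] := @IVT R y s t v st (continuous_subspaceT cy).
  by rewrite ge_min le_max; case/orP: H => /andP[-> ->]; rewrite ?orbT.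
by move=> r; rewrite in_itv/= => rst yr; exists r.
Qed.

Lemma IVT_ninfty y (l v t : R) : continuous y -> y t @[t --> -oo] --> l ->
  (l < v <= y t) || (y t <= v < l) -> exists2 s, s <= t & y s = v.
Proof.
move=> cy yl /orP[]/andP[h1 h2].
  have [A HA] := cvg_ninfty_lt yl h1; have := HA (Num.min A t).
  rewrite ge_min lexx => /(_ isT) => h3.
  have mt : Num.min A t <= t by rewrite ge_min lexx orbT.
  have [|r /andP[_ rt] yr] := IVT_continuous (v := v) cy mt; last by exists r.
  by rewrite (ltW h3) h2.
have [A HA] := cvg_ninfty_gt yl h2; have := HA (Num.min A t).
rewrite ge_min lexx => /(_ isT) => h3.
have mt : Num.min A t <= t by rewrite ge_min lexx orbT.
have [|r /andP[_ rt] yr] := IVT_continuous (v := v) cy mt; last by exists r.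
by rewrite (ltW h3) h1 orbT.
Qed.

Lemma IVT_pinfty y (l v t : R) : continuous y -> y t @[t --> +oo] --> l ->
  (l < v <= y t) || (y t <= v < l) -> exists2 s, t <= s & y s = v.
Proof.
move=> cy yl /orP[]/andP[h1 h2].
  have [A HA] := cvg_pinfty_lt yl h1; have := HA (Num.max A t).
  rewrite le_max lexx => /(_ isT) => h3.
  have mt : t <= Num.max A t by rewrite le_max lexx orbT.
  have [|r /andP[rt _] yr] := IVT_continuous (v := v) cy mt; last by exists r.
  by rewrite (ltW h3) h2 orbT.
have [A HA] := cvg_pinfty_gt yl h2; have := HA (Num.max A t).
rewrite le_max lexx => /(_ isT) => h3.
have mt : t <= Num.max A t by rewrite le_max lexx orbT.
have [|r /andP[rt _] yr] := IVT_continuous (v := v) cy mt; last by exists r.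
by rewrite (ltW h3) h1.
Qed.

End IntermediateValues.

(** * Completing a part of a curve into a competitor *)

Section Competitors.
Context {R : realType}.
Variables (W : R -> R) (cW : continuous W) (W0 : forall s, 0 <= W s).
Variables (Wm1 : W (- 1) = 0) (W1 : W 1 = 0).
Variable (Wgt0 : forall s, s != 1 -> s != - 1 -> 0 < W s).
Variables (a1 a2 : R) (a1_gt0 : 0 < a1).
Implicit Types (u w y b f g : R -> R) (D : set R).
Notation mu := (@lebesgue_measure R).

Definition coeff b := measurable_fun setT b /\ forall t, a1 <= b t <= a2.

Definition minact b : \bar R :=
  ereal_inf [set act b W p.1 p.2 setT | p in [set p : (R -> R) * (R -> R) | adm p.1 p.2]].

Definition curve y w := [/\ measurable_fun setT w, forall t, `|w t| <= 1 & prim y w].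

Lemma adm_curve y w : adm y w -> curve y w.
Proof. by case. Qed.

Lemma curve_locbdd y w : curve y w -> locbdd w.
Proof. by case=> mw w1 _; exact: bounded_locbdd w1. Qed.

Lemma curve_continuous y w : curve y w -> continuous y.
Proof. by move=> c; case: (c) => _ _; apply: prim_continuous; exact: curve_locbdd c. Qed.

Lemma curve_lip y w : curve y w -> forall s t, `|y t - y s| <= `|t - s|.
Proof. by case=> mw w1 yw; exact: prim_1lip w1 yw. Qed.

Lemma curve_cst c : curve (fun=> c) (fun=> 0).
Proof. by split; [exact: measurable_cst|move=> t; rewrite normr0|exact: prim_cst]. Qed.

Lemma curve_line c : curve (fun t => c + 1 * t) (fun=> 1).
Proof. by split; [exact: measurable_cst|move=> t; rewrite normr1|exact/primDc/prim_line]. Qed.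

Lemma curve_glue s y1 w1 y2 w2 : curve y1 w1 -> curve y2 w2 -> y1 s = y2 s ->
  curve (glue s y1 y2) (glue s w1 w2).
Proof.
move=> c1 c2 ys; have l1 := curve_locbdd c1; have l2 := curve_locbdd c2.
case: c1 c2 => m1 b1 p1 [m2 b2 p2].
by split; [exact: measurable_glue|exact: glue_norm_le|exact: prim_glue].
Qed.

Lemma coeff_ge0 b : coeff b -> forall t, 0 <= b t.
Proof. by move=> [_ H] t; have /andP[bt _] := H t; rewrite (le_trans _ bt)// ltW. Qed.

Lemma coeff_a2 b : coeff b -> 0 < a2.
Proof. by move=> [_ H]; have /andP[h1 h2] := H 0; rewrite (lt_le_trans a1_gt0)// (le_trans h1). Qed.

Lemma coeff_locbdd b : coeff b -> locbdd b.
Proof.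
move=> cb; case: (cb) => mb H; apply: (@bounded_locbdd _ a2) => // t.
by rewrite ger0_norm ?coeff_ge0//; case/andP: (H t).
Qed.

Lemma minact_le b y w : adm y w -> (minact b <= act b W y w setT)%E.
Proof. by move=> yw; apply: ereal_inf_lbound; exists (y, w). Qed.

Lemma minact_ge0 b : coeff b -> (0 <= minact b)%E.
Proof.
move=> cb; apply: le_ereal_inf_tmp => _ [[y w] _ <-] /=.
by apply: act_ge0 => //; exact: coeff_ge0.
Qed.

Lemma mu_itv_oc (s t : R) : s <= t -> mu `]s, t] = (t - s)%:E.
Proof.
move=> st; rewrite [LHS](lebesgue_measure_itv `]s, t])/= lte_fin.
by case: ltP => // ts; rewrite (le_anti (introT andP (conj st ts))) subrr.
Qed.

Lemma mu_itv_cc (s t : R) : s <= t -> mu `[s, t] = (t - s)%:E.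
Proof.
move=> st; rewrite [LHS](lebesgue_measure_itv `[s, t])/= lte_fin.
by case: ltP => // ts; rewrite (le_anti (introT andP (conj st ts))) subrr.
Qed.

(** Bounds the Lagrangian at all points between the wells, whatever the slope: the
    chosen value is a bound of [W] on [[-1, 1]], which exists by compactness. *)
Definition ramp_cost := 1 + a2 * (xget 0 [set M | forall s, -1 <= s <= 1 -> W s <= M]).

Lemma ramp_costP (p s : R) (t : R) b : coeff b -> -1 <= s <= 1 -> Phi p + b t * W s <= ramp_cost.
Proof.
move=> cb s1; have [_ /(_ t)/andP[_ ba]] := cb.
have /xgetPex H : exists M, forall s, -1 <= s <= 1 -> W s <= M.
  have [|c _ Hc] := @EVT_max R W (-1) 1 _ (continuous_subspaceT cW); first lra.
  by exists (W c).
rewrite /ramp_cost lerD ?Phi_le1// (@le_trans _ _ (a2 * W s)) ?ler_wpM2r//.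
by rewrite ler_wpM2l ?H// ltW// (coeff_a2 cb).
Qed.

Lemma ramp_cost_gt0 b : coeff b -> 0 < ramp_cost.
Proof.
move=> cb; apply: (@lt_le_trans _ _ (Phi 1 + b 0 * W 1)).
  by rewrite W1 mulr0 addr0 /Phi expr1n subrr sqrtr0 subr0.
apply: ramp_costP => //; lra.
Qed.

(** Competitor: follow [y] until [s], climb to 1 with slope 1 during the time [d],
    and rest at 1, which costs nothing. So a curve that comes close to 1 at time
    [s] has spent almost the minimal action by then. *)
Lemma complete_right b y w s d : coeff b -> curve y w -> y t @[t --> -oo] --> (- 1 : R) ->
  0 <= d <= 2 -> y s = 1 - d ->
  (minact b <= act b W y w `]-oo, s] + (ramp_cost * d)%:E)%E.
Proof.
move=> cb cyw yl /andP[d0 d2] ys.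
have [mb _] := cb; have b0 := coeff_ge0 cb.
pose z := glue (s + d) (fun t => (1 - d - s) + 1 * t) (fun=> 1).
pose v := glue (s + d) (fun=> 1) (fun=> (0 : R)).
have zv : curve z v.
  by apply: curve_glue; [exact: curve_line|exact: curve_cst|ring].
have Z : adm (glue s y z) (glue s w v).
  have [m1 b1 p1] := cyw; have [m2 v1 p2] := zv; apply: adm_glue => //.
    by rewrite ys /z glue_l; [ring|rewrite lerDl].
  by apply: cvg_glue_pinfty; exact: cvg_cst.
apply: le_trans (minact_le b Z) _.
have cyz := adm_continuous Z; have [mz z1 _ _ _] := Z.
rewrite (act_split cW W0 s mb b0 cyz mz)//; apply: leeD.
  by rewrite (@eq_act _ W b _ _ y w)// => t; rewrite /= in_itv/= => ts; rewrite glue_l.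
have -> : `]s, +oo[%classic = `]s, s + d] `|` `]s + d, +oo[ :> set R.
  apply/seteqP; split => t /=; rewrite !in_itv/= ?andbT => H.
    by have [ts|ts] := leP t (s + d); [left; rewrite H|right].
  by case: H => [/andP[]//|]; apply: le_lt_trans; rewrite lerDl.
rewrite act_setU//; last first.
  by move=> t /=; rewrite !in_itv/= andbT leNgt => /andP[_ /negP].
rewrite -[leRHS]adde0; apply: leeD.
  apply: le_trans (act_le_cst cW W0 mb b0 cyz mz (measurable_itv _) (c := ramp_cost) _) _.
    move=> t /=; rewrite in_itv/= => /andP[st td]; apply: ramp_costP => //.
    by rewrite glue_r// /z glue_l//; lra.
  rewrite mu_itv_oc ?lerDl// EFinM lee_fin; apply: ler_wpM2l; first exact/ltW/ramp_cost_gt0/cb.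
  lra.
apply: le_trans (act_le_cst cW W0 mb b0 cyz mz (measurable_itv _) (c := 0) _) _; last by rewrite mul0e.
move=> t /=; rewrite in_itv/= andbT => st; have st' : s < t by apply: le_lt_trans st; rewrite lerDl.
by rewrite /lag !glue_r// /z /v !glue_r// Phi0 W1 mulr0 addr0.
Qed.

(** Mirror image of [complete_right]: rest at -1, climb to [y s] during the time
    [d], then follow [y]. *)
Lemma complete_left b y w s d : coeff b -> curve y w -> y t @[t --> +oo] --> (1 : R) ->
  0 <= d <= 2 -> y s = - 1 + d ->
  (minact b <= act b W y w `]s, +oo[ + (ramp_cost * d)%:E)%E.
Proof.
move=> cb cyw yl /andP[d0 d2] ys.
have [mb _] := cb; have b0 := coeff_ge0 cb.
pose z := glue (s - d) (fun=> -1) (fun t => (- 1 + d - s) + 1 * t).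
pose v := glue (s - d) (fun=> (0 : R)) (fun=> 1).
have zv : curve z v.
  by apply: curve_glue; [exact: curve_cst|exact: curve_line|ring].
have zs : z s = y s.
  rewrite ys /z; move: d0; rewrite le_eqVlt => /predU1P[<-|d0].
    by rewrite glue_l ?subr0// addr0.
  by rewrite glue_r; [ring|rewrite ltrBlDr ltrDl].
have Z : adm (glue s z y) (glue s v w).
  have [m1 b1 p1] := cyw; have [m2 v1 p2] := zv; apply: adm_glue => //.
  by apply: cvg_glue_ninfty; exact: cvg_cst.
apply: le_trans (minact_le b Z) _.
have cyz := adm_continuous Z; have [mz z1 _ _ _] := Z.
rewrite (act_split cW W0 s mb b0 cyz mz)// addeC; apply: leeD.
  by rewrite (@eq_act _ W b _ _ y w)// => t; rewrite /= in_itv/= andbT => ts; rewrite glue_r.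
have -> : `]-oo, s]%classic = `]-oo, s - d] `|` `]s - d, s] :> set R.
  apply/seteqP; split => t /=; rewrite !in_itv/= ?andbT => H.
    by have [ts|ts] := leP t (s - d); [left|right; rewrite H].
  by case: H => [|/andP[]//] H; apply: le_trans H _; rewrite gerBl.
rewrite act_setU//; last first.
  by move=> t /=; rewrite !in_itv/= leNgt => /negP + /andP[].
rewrite addeC -[leRHS]adde0; apply: leeD.
  apply: le_trans (act_le_cst cW W0 mb b0 cyz mz (measurable_itv _) (c := ramp_cost) _) _.
    move=> t /=; rewrite in_itv/= => /andP[st td]; apply: ramp_costP => //.
    by rewrite glue_l// /z glue_r//; lra.
  rewrite mu_itv_oc ?gerBl// EFinM lee_fin; apply: ler_wpM2l; first exact/ltW/ramp_cost_gt0/cb.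
  lra.
apply: le_trans (act_le_cst cW W0 mb b0 cyz mz (measurable_itv _) (c := 0) _) _; last by rewrite mul0e.
move=> t /=; rewrite in_itv/= => st; have st' : t <= s by apply: le_trans st _; rewrite gerBl.
by rewrite /lag !glue_l// /z /v !glue_l// Phi0 Wm1 mulr0 addr0.
Qed.

(** The constant -1 costs nothing, and a ramp of length 2 completes it. *)
Lemma minact_fin_num b : coeff b -> minact b \is a fin_num.
Proof.
move=> cb; rewrite ge0_fin_numE ?minact_ge0//.
have [mb _] := cb; have b0 := coeff_ge0 cb.
have H : (minact b <= act b W (fun=> (- 1)%R) (fun=> 0%R) `]-oo, 0%R] + (ramp_cost * 2)%:E)%E.
  by apply: complete_right => //; [exact: curve_cst|exact: cvg_cst|lra|lra].
apply: (le_lt_trans H).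
rewrite (_ : act _ _ _ _ _ = 0%E) ?add0e ?ltry//.
apply: integral0_eq => t _; by rewrite /lag Phi0 Wm1 mulr0 addr0.
Qed.

Lemma W_ge_pos (lo hi : R) : lo <= hi -> (forall s, lo <= s <= hi -> s != 1 /\ s != -1) ->
  exists2 c, 0 < c & forall s, lo <= s <= hi -> c <= W s.
Proof.
move=> lh H; have [|c ch Hc] := @EVT_min R W lo hi lh; first exact: continuous_subspaceT.
exists (W c) => [|s sh]; last exact: Hc.
by have [] := H c ch; exact: Wgt0.
Qed.

Lemma act_itv_ge b y w (s t c : R) : coeff b -> curve y w -> s <= t -> 0 <= c ->
  (forall r, s <= r <= t -> c <= W (y r)) ->
  ((a1 * c * (t - s))%:E <= act b W y w `[s, t])%E.
Proof.
move=> cb cyw st c0 H; have [mb bb] := cb; have b0 := coeff_ge0 cb.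
rewrite EFinM -mu_itv_cc//; apply: act_ge_cst => //.
- by rewrite mulr_ge0// ltW.
- exact: curve_continuous cyw.
- by case: cyw.
move=> r /=; rewrite in_itv/= => /H cr; rewrite /lag.
have := Phi_ge0 (w r); have /andP[br _] := bb r.
by have := @ler_pM _ a1 (b r) c (W (y r)) (ltW a1_gt0) c0 br cr; lra.
Qed.

(** If [y] passes above [1 + eta], it takes the value 1 at some earlier time [s]
    and the value [1 + eta] at a later time [r]. The minimal action is spent
    before [s], by [complete_right] with [d = 0]; as [y] is 1-Lipschitz, it stays
    at a distance at least [eta / 2] from the wells on [`[r - eta / 2, r]], which
    costs a fixed amount more. The other side is symmetric. The bound is uniform
    in the coefficient and the curve. *)
Lemma near_min_bound (eta : R) : 0 < eta -> exists2 eps : R, 0 < eps &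
  forall b y w, coeff b -> adm y w -> (act b W y w setT <= minact b + eps%:E)%E ->
  forall t, -1 - eta <= y t <= 1 + eta.
Proof.
move=> e0.
have [|s sh|c1 c10 Hc1] := @W_ge_pos (1 + eta / 2) (1 + 3 * eta / 2); first lra.
  by split; apply/eqP; lra.
have [|s sh|c2 c20 Hc2] := @W_ge_pos (- 1 - 3 * eta / 2) (- 1 - eta / 2); first lra.
  by split; apply/eqP; lra.
pose c := Num.min c1 c2.
have c0 : 0 < c by rewrite lt_min c10.
pose K := a1 * c * (eta / 2).
have K0 : 0 < K by rewrite !mulr_gt0//; lra.
exists (K / 2) => [|b y w cb yw ymin t]; first by rewrite divr_gt0.
have cyw := adm_curve yw; have cy := curve_continuous cyw.
have [mw w1 _ yp yn] := yw.
have [mb _] := cb; have b0 := coeff_ge0 cb.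
have mf := minact_fin_num cb.
have half (r : R) : (forall x : R, r - eta / 2 <= x <= r -> c <= W (y x)) ->
    (K%:E <= act b W y w `[(r - eta / 2)%R, r])%E.
  move=> H; have := @act_itv_ge b y w (r - eta / 2) r c cb cyw _ (ltW c0) H.
  have -> : r - (r - eta / 2) = eta / 2 by ring.
  by apply; lra.
have contra D1 D2 (r : R) : measurable D1 -> measurable D2 -> (forall t, D1 t -> D2 t -> False) ->
  (minact b <= act b W y w D1)%E -> `[r - eta / 2, r] `<=` D2 ->
  (forall x : R, r - eta / 2 <= x <= r -> c <= W (y x)) -> False.
  move=> m1 m2 d12 h1 h2 /half h3.
  have H : (minact b + K%:E <= minact b + (K / 2)%:E)%E.
    apply: le_trans ymin; apply: (@le_trans _ _ (act b W y w (D1 `|` D2))).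
      rewrite act_setU//; apply: leeD => //; apply: le_trans h3 _.
      exact: act_subset.
    by apply: act_subset => //; exact: measurableU.
  by move: H; rewrite leeD2lE// lee_fin; lra.
have cl (r x : R) : r - eta / 2 <= x <= r -> `|y x - y r| <= eta / 2.
  move=> /andP[x1 x2]; apply: le_trans (curve_lip cyw r x) _.
  by rewrite distrC ger0_norm ?subr_ge0//; lra.
apply/andP; split; rewrite leNgt; apply/negP => yt.
  have [|s ts ys] := IVT_pinfty (v := -1) (t := t) cy yp; first by apply/orP; right; lra.
  have [|r /andP[tr rs] yr] := IVT_continuous (v := -1 - eta) cy ts; first by apply/orP; left; lra.
  have rs' : r < s.
    rewrite lt_neqAle rs andbT; apply/eqP => E; move: ys; rewrite -E; lra.
  apply: (contra `]s, +oo[%classic `]-oo, s]%classic r) => //.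
  - by move=> x /=; rewrite !in_itv/= andbT leNgt => + /negP.
  - have := @complete_left b y w s 0 cb cyw yp; rewrite mulr0 adde0; apply; lra.
  - by move=> x /=; rewrite !in_itv/= => /andP[_ xr]; exact: le_trans rs.
  - move=> x /cl; rewrite ler_norml yr => H; apply: (le_trans _ (Hc2 _ _)); last lra.
    by rewrite ge_min lexx orbT.
have [|s ts ys] := IVT_ninfty (v := 1) (t := t) cy yn; first by apply/orP; left; lra.
have [|r /andP[sr rt] yr] := IVT_continuous (v := 1 + eta) cy ts; first by apply/orP; left; lra.
have rs' : eta <= r - s.
  by have := curve_lip cyw s r; rewrite yr ys ger0_norm ?(ger0_norm (x := r - s)) ?subr_ge0//; lra.
apply: (contra `]-oo, s]%classic `]s, +oo[%classic r) => //.
- by move=> x /=; rewrite !in_itv/= andbT leNgt => /negP.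
- have := @complete_right b y w s 0 cb cyw yn; rewrite mulr0 adde0; apply; lra.
- by move=> x /=; rewrite !in_itv/= andbT => /andP[xr _]; lra.
- move=> x /cl; rewrite ler_norml yr => H; apply: (le_trans _ (Hc1 _ _)); last lra.
  by rewrite ge_min lexx.
Qed.

End Competitors.

(** * Variations of near-minimizers on an interval *)

Section NearMinimizers.
Context {R : realType}.
Variables (W : R -> R) (C1W : C1_fun W) (W0 : forall s, 0 <= W s).
Variables (a1 a2 : R) (a1_gt0 : 0 < a1).
Implicit Types (u w y v b f g : R -> R) (D : set R).
Notation minact := (minact W).
Notation coeff := (coeff a1 a2).

Let cW' : continuous (derive1 W) := C1W.2.

Lemma C1_continuous f : C1_fun f -> continuous f.
Proof. by move=> [df _] x; apply: differentiable_continuous; apply/derivable1_diffP; exact: df. Qed.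

Let cW : continuous W := C1_continuous C1W.

(** Compactness of [`[- M, M]] makes the threshold [s] uniform in [x] and [d]. *)
Lemma C1_taylor (M D k : R) : 0 < k -> 0 <= D -> exists2 s : R, 0 < s <= 1 &
  forall x d, `|x| <= M -> `|d| <= D -> W (x + s * d) - W x <= s * (derive1 W x * d + k).
Proof.
move=> k0 D0.
have : compact `[- M, M] by exact: segment_compact.
move/compact_near_coveringP => /(_ R (0^'+) (fun s x => forall d, `|d| <= D ->
   W (x + s * d) - W x <= s * (derive1 W x * d + k)) _) [].
  move=> x0 _.
  pose e := k / (2 * (D + 1)).
  have e0 : 0 < e by rewrite divr_gt0// mulr_gt0//; lra.
  have /cvgrPdist_le /(_ _ e0)[r /= r0 Hr] := cW' (x := x0).
  exists ([set x | `|x0 - x| < r / 2], [set s | 0 < s /\ s * (D + 1) < r / 2]) => /=.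
    split; first by exists (r / 2) => //=; rewrite divr_gt0.
    have h : 0 < r / 2 / (D + 1) by rewrite !divr_gt0//; lra.
    exists (r / 2 / (D + 1)) => //= s; rewrite /ball_/= sub0r normrN => s1 s2; split => //.
    rewrite ger0_norm ?(ltW s2)// in s1.
    by rewrite -ltr_pdivlMr//; lra.
  move=> [x s] /= [xr [s0 sD]] d dD.
  have sd : `|s * d| < r / 2.
    rewrite normrM (ger0_norm (ltW s0)); apply: le_lt_trans sD.
    by rewrite ler_pM2l//; lra.
  have lW := locbdd_continuous cW'.
  have lk := locbddB lW (locbdd_cst (derive1 W x)).
  have := prim_lip (M := 2 * e) (x := x) (y := x + s * d) lk
    (primB lW (locbdd_cst _) (prim_C1 C1W) (prim_line (derive1 W x))).
  have -> : x + s * d - x = s * d by ring.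
  move=> H; have {}H := H _.
  have {}H : `|W (x + s * d) - derive1 W x * (x + s * d) - (W x - derive1 W x * x)| <= 2 * e * `|s * d|.
    apply: H => z zx.
    have h1 := Hr x; have h2 := Hr z; rewrite /ball_/= in h1 h2.
    have {}h1 : `|derive1 W x0 - derive1 W x| <= e by apply: h1; lra.
    have {}h2 : `|derive1 W x0 - derive1 W z| <= e.
      apply: h2; rewrite -(subrKA x); apply: le_lt_trans (ler_normD _ _) _.
      by rewrite (distrC x); lra.
    rewrite -(subrKA (derive1 W x0)) (le_trans (ler_normD _ _))// (distrC (derive1 W z)).
    by lra.
  have h3 : 2 * e * `|s * d| <= s * k.
    rewrite normrM (ger0_norm (ltW s0)) mulrCA ler_pM2l// /e.
    have -> : 2 * (k / (2 * (D + 1))) = k / (D + 1) by field; lra.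
    rewrite mulrAC ler_pdivrMr; last lra.
    by rewrite ler_pM2l//; lra.
  move: H; rewrite ler_norml => /andP[_ H]; rewrite mulrDr.
  have -> : s * (derive1 W x * d) = derive1 W x * (x + s * d) - derive1 W x * x by ring.
  lra.
move=> r /= r0 Hr.
pose s := Num.min (r / 2) 1.
have s0 : 0 < s by rewrite lt_min ltr01 andbT divr_gt0.
exists s => [|x d xM dD]; first by rewrite s0 ge_min lexx orbT.
apply: (Hr s) => //=.
  rewrite /ball_/= sub0r normrN ger0_norm ?ltW// /s gt_min; apply/orP; left; lra.
by rewrite in_itv/= -ler_norml.
Qed.

Lemma act_int_oc b y w (s t : R) : coeff b -> curve y w -> s <= t ->
  act b W y w `]s, t] = (int (lag b W y w) s t)%:E.
Proof.
move=> cb c st; rewrite -(@act_int _ _ cW).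
- by apply: integral_itv_obnd_cbnd; apply: measurable_lag_EFin => //; [case: cb|exact: curve_continuous c|case: c].
- exact: coeff_locbdd cb.
- exact: curve_continuous c.
- exact: curve_locbdd c.
Qed.

Lemma act_split3 b y w (s t : R) : coeff b -> curve y w -> s <= t ->
  act b W y w setT = (act b W y w `]-oo, s] + (int (lag b W y w) s t)%:E + act b W y w `]t, +oo[)%E.
Proof.
move=> cb c st; have [mb _] := cb; have b0 := coeff_ge0 a1_gt0 cb.
have cy := curve_continuous c; have [mw _ _] := c.
rewrite (act_split cW W0 t)// -act_int_oc//; congr (_ + _)%E.
rewrite -act_setU//; last by move=> r /=; rewrite !in_itv/= leNgt => /negP + /andP[].
congr act; apply/seteqP; split => r /=; rewrite !in_itv/=.
  by move=> rt; have [rs|rs] := leP r s; [left|right; rewrite ?rs rt].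
by case=> [rs|/andP[]//]; exact: le_trans st.
Qed.

(** Outside the interval the two curves agree, and their finite actions there
    cancel. *)
Lemma replace_on_interval b y w v p (s t e : R) : coeff b -> adm y w -> curve v p -> s <= t ->
  v s = y s -> v t = y t -> (act b W y w setT <= minact b + e%:E)%E ->
  W 1 = 0 -> W (- 1) = 0 ->
  int (lag b W y w) s t <= int (lag b W v p) s t + e.
Proof.
move=> cb yw vp st vs vt ymin W1 Wm1.
have cyw := adm_curve yw.
pose z := glue s y (glue t v y); pose q := glue s w (glue t p w).
have vs' : y s = glue t v y s by rewrite glue_l.
have Z : adm z q.
  have [mw w1 yp yi yn] := yw; have [mi qi pi] := curve_glue vp cyw vt.
  by apply: adm_glue => //; exact: cvg_glue_pinfty.
have czq := adm_curve Z.
have b0 := coeff_ge0 a1_gt0 cb; have [mb _] := cb; have [mw _ _] := cyw.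
have mf := minact_fin_num cW W0 Wm1 W1 a1_gt0 cb.
have sub_fin D : measurable D -> act b W y w D \is a fin_num.
  move=> mD; rewrite ge0_fin_numE ?act_ge0//.
  have h : (act b W y w D <= act b W y w setT)%E.
    by apply: act_subset => //; exact: curve_continuous cyw.
  apply: le_lt_trans h (le_lt_trans ymin _).
  by rewrite lte_add_pinfty ?ltry// ltey_eq mf.
have := minact_le W b Z; rewrite (act_split3 cb czq st).
have -> : act b W z q `]-oo, s] = act b W y w `]-oo, s].
  by apply: eq_act => r /=; rewrite in_itv/= => rs; rewrite /z /q glue_l.
have -> : act b W z q `]t, +oo[ = act b W y w `]t, +oo[.
  apply: eq_act => r /=; rewrite in_itv/= andbT => tr; have sr := le_lt_trans st tr;
  by rewrite /z /q !glue_r.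
have -> : int (lag b W z q) s t = int (lag b W v p) s t.
  have E : act b W z q `]s, t] = act b W v p `]s, t].
    by apply: eq_act => r /=; rewrite in_itv/= => /andP[sr rt]; rewrite /z /q glue_r// glue_l.
  by move: E; rewrite !act_int_oc// => -[].
move: ymin; rewrite (act_split3 cb cyw st).
rewrite -(fineK mf) -(fineK (sub_fin _ (measurable_itv `]-oo, s]))).
rewrite -(fineK (sub_fin _ (measurable_itv `]t, +oo[))) -!EFinD !lee_fin; lra.
Qed.

End NearMinimizers.

Section Flux.
Context {R : realType}.
Variables (W : R -> R) (C1W : C1_fun W) (W0 : forall s, 0 <= W s).
Variables (Wm1 : W (- 1) = 0) (W1 : W 1 = 0).
Variables (a1 a2 : R) (a1_gt0 : 0 < a1).
Implicit Types (u w y v b f g : R -> R) (D : set R).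
Notation minact := (minact W).
Notation coeff := (coeff a1 a2).

Let cW' : continuous (derive1 W) := C1W.2.
Let cW : continuous W := C1_continuous C1W.

Definition force b u t := b t * derive1 W (u t).
(** The solutions [q] of [q' = b W'(u)], with [c] their value at 0. An extremal [u]
    has slope [gam q] for one of them. *)
Definition flux b u c t := c + antider (force b u) t.

Lemma locbdd_force b u : coeff b -> continuous u -> locbdd (force b u).
Proof.
move=> cb cu; apply: locbddM; first exact: coeff_locbdd cb.
by apply: locbdd_comp => //; exact: locbdd_continuous.
Qed.

Lemma prim_flux b u c : coeff b -> continuous u -> prim (flux b u c) (force b u).
Proof. by move=> cb cu; apply/primDc/prim_antider/locbdd_force. Qed.

Lemma flux_continuous b u c : coeff b -> continuous u -> continuous (flux b u c).
Proof. by move=> cb cu; exact: (prim_continuous (locbdd_force cb cu) (prim_flux _ cb cu)). Qed.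

Lemma force_bound : exists2 K, 0 <= K & forall b u, coeff b -> forall t, `|u t| <= 2 -> `|force b u t| <= K.
Proof.
have [_ /(_ 2)[M HM]] := locbdd_continuous cW'.
exists (Num.max (a2 * M) 0) => [|b u cb t ut]; first by rewrite le_max lexx orbT.
rewrite le_max; apply/orP; left; rewrite /force normrM.
have [_ /(_ t)/andP[h1 h2]] := cb.
apply: ler_pM => //; last exact: HM.
by rewrite ger0_norm// (coeff_ge0 a1_gt0 cb).
Qed.

Lemma curve_gam_flux b u c : coeff b -> continuous u -> forall d,
  curve (fun t => d + antider (fun t => gam (flux b u c t)) t) (fun t => gam (flux b u c t)).
Proof.
move=> cb cu d; have cq := flux_continuous (c := c) cb cu.
have cp : continuous (fun t => gam (flux b u c t)).
  by move=> t; apply: (@continuous_comp _ _ _ (flux b u c) gam); [exact: cq|exact: gam_continuous].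
split; first exact: continuous_measurable_fun.
- by move=> t; exact/ltW/gam_lt1.
- exact/primDc/prim_antider/locbdd_continuous.
Qed.

(** Shooting in [c]: the displacement over [`[- k, k]] depends continuously on [c].
    For [c = 1 + K * k] the flux is at least 1 on the interval, and the
    displacement at least [2 / 3 * (2 * k) >= 4]; for the opposite value it is at
    most -4; and the displacement of [y] lies between. *)
Lemma flux_bvp (k K : R) b y : 4 <= k -> coeff b -> continuous y ->
  0 <= K -> (forall t, `|force b y t| <= K) -> (forall t, `|y t| <= 2) ->
  exists2 c, `|c| <= 1 + K * k &
    int (fun t => gam (flux b y c t)) (- k) k = y k - y (- k).
Proof.
move=> k4 cb cy K0 HK y2.
have lf := locbdd_force cb cy.
have lg c : locbdd (fun t => gam (flux b y c t)).
  apply: locbdd_comp; first exact: gam_continuous.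
  exact/locbdd_continuous/flux_continuous.
pose G c := int (fun t => gam (flux b y c t)) (- k) k.
have kk : - k <= k by lra.
have cG : continuous G.
  move=> c; apply/cvgrPdist_le => e e0.
  exists (e / (2 * k)) => /=; first by rewrite divr_gt0//; lra.
  move=> d; rewrite /ball_/= => cd.
  rewrite /G -intB//.
  have h := int_bound (M := e / (2 * k)) (locbddB (lg c) (lg d)) kk.
  apply: le_trans (h _) _.
    move=> t _; apply: le_trans (gam_lip _ _) _; apply: ltW; apply: le_lt_trans cd.
    by rewrite /flux opprD addrACA subrr addr0.
  by rewrite le_eqVlt; apply/orP; left; apply/eqP; field; lra.
have Fb t : - k <= t <= k -> `|antider (force b y) t| <= K * k.
  move=> tk; rewrite -[X in `|X|]subr0 -(antider0 (force b y)).
  apply: le_trans (prim_bound lf (prim_antider lf) HK _ _) _.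
  by rewrite subr0 ler_wpM2l// ler_norml.
have y4 : `|y k - y (- k)| <= 4.
  apply: le_trans (ler_normB _ _) _; have := y2 k; have := y2 (- k); lra.
pose C := 1 + K * k.
have C0 : 0 <= C by rewrite /C addr_ge0// mulr_ge0//; lra.
have Gp : 4 <= G C.
  have : int (fun=> 2 / 3) (- k) k <= G C.
    apply: le_int => //; first exact: locbdd_cst.
    move=> t tk; apply: le_trans gam1_ge _; apply: gam_homo.
    by have := Fb t tk; rewrite ler_norml /flux /C; lra.
  by rewrite int_cst//; lra.
have Gn : G (- C) <= - 4.
  have : G (- C) <= int (fun=> - (2 / 3)) (- k) k.
    apply: le_int => //; first exact: locbdd_cst.
    move=> t tk; rewrite -(opprK (flux _ _ _ _)) gamN lerN2.
    apply: le_trans gam1_ge _; apply: gam_homo.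
    by have := Fb t tk; rewrite ler_norml /flux /C; lra.
  by rewrite int_cst//; lra.
have NC : - C <= C by lra.
have [|c cC Gc] := IVT_continuous (v := y k - y (- k)) cG NC.
  by move: y4; rewrite ler_norml; lra.
by exists c => //; rewrite ler_norml.
Qed.

(** Let [q = flux b y c], [p = gam q], and let [v] be the primitive of [p] with the
    boundary values of [y], as given by [flux_bvp]. Comparing [y] with
    [(1 - s) * y + s * v] for a small fixed [s], near-minimality, the convexity
    of [Phi] and the expansion of [W] show that the integral of
    [Phi w - Phi p - b W'(y) * (v - y)] is bounded by a small error. Integrating
    by parts, the integral of [q * (w - p) + b W'(y) * (y - v)] is 0. By
    [Phi_young], the integral of [(w - p)^2 / 2] is then at most the error. *)
Lemma near_min_flux (k : R) : 4 <= k -> exists C, forall tau, 0 < tau ->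
  exists2 e, 0 < e & forall b y w, coeff b -> adm y w -> (forall t, `|y t| <= 2) ->
  (act b W y w setT <= minact b + e%:E)%E ->
  exists c v, let p := fun t => gam (flux b y c t) in
   [/\ `|c| <= C, curve v p, v (- k) = y (- k), v k = y k &
     int (fun t => (w t - p t) ^+ 2) (- k) k <= tau].
Proof.
move=> k4.
have [K K0 HK] := force_bound.
exists (1 + K * k) => tau tau0.
have a20 : 0 <= `|a2| by [].
(* D bounds |v - y| on [-k, k], as both are 1-Lipschitz and |y| <= 2; kap makes
   the expansion error a2 * kap * (2 * k) at most tau / 4 *)
pose D := 4 + 2 * k.
have k0 : 0 < k by lra.
pose kap := tau / (8 * k * (`|a2| + 1)).
have kap0 : 0 < kap by rewrite divr_gt0// mulr_gt0//; lra.
have D0 : 0 <= D by rewrite /D; lra.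
have [s /andP[s0 s1] Hs] := C1_taylor C1W 2 kap0 D0.
(* the variation gains a multiple of s, so the tolerance is proportional to s *)
exists (s * (tau / 4)) => [|b y w cb yw y2 ymin]; first by rewrite mulr_gt0// divr_gt0.
have cyw := adm_curve yw; have cy := curve_continuous cyw.
have HKb t : `|force b y t| <= K by exact: HK.
have [c cC Ec] := flux_bvp k4 cb cy K0 HKb y2.
pose p t := gam (flux b y c t).
have lf := locbdd_force cb cy.
pose v t := y (- k) - antider p (- k) + antider p t.
have cv : curve v p by exact: curve_gam_flux.
have lq : locbdd (flux b y c) by exact/locbdd_continuous/flux_continuous.
have lp := curve_locbdd cv; have lw := curve_locbdd cyw.
have ccv := curve_continuous cv.
have [_ p1 Pv] := cv; have [_ w1 Py] := cyw.
have kk : - k <= k by lra.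
have vmk : v (- k) = y (- k) by rewrite /v subrK.
have vk : v k = y k.
  by have := Pv _ _ kk; rewrite Ec vmk; lra.
exists c, v; split => //.
have ly := locbdd_continuous cy; have lv := locbdd_continuous ccv.
have lb := coeff_locbdd a1_gt0 cb.
(* the flux equation turns the boundary terms of the parts formula into the
   linearized potential *)
have IBP : int (fun t => flux b y c t * (w t - p t) + force b y t * (y t - v t)) (- k) k = 0.
  have P := prim_mul lf (locbddB lw lp) (prim_flux c cb cy) (primB lw lp Py Pv).
  by rewrite -P// vmk vk !subrr !mulr0 subrr.
pose z t := (1 - s) * y t + s * v t.
pose x t := (1 - s) * w t + s * p t.
have s01 : 0 <= s <= 1 by rewrite ltW.
have cz : curve z x.
  split.
  - by apply: measurable_funD; apply: measurable_funM => //; [exact: lw.1|exact: lp.1].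
  - move=> t; apply: le_trans (ler_normD _ _) _.
    rewrite (normrM (1 - s)) (normrM s) (ger0_norm (ltW s0)) (ger0_norm (x := 1 - s)) ?subr_ge0//.
    have s1' : 0 <= 1 - s by rewrite subr_ge0.
    have := ler_wpM2l s1' (w1 t); have := ler_wpM2l (ltW s0) (p1 t); lra.
  - by apply: primD; [exact: locbddZ|exact: locbddZ|exact: primZ|exact: primZ].
have zmk : z (- k) = y (- k) by rewrite /z vmk; ring.
have zk : z k = y k by rewrite /z vk; ring.
have M := replace_on_interval C1W W0 a1_gt0 cb yw cz kk zmk zk ymin W1 Wm1.
have lPhi f : locbdd f -> locbdd (fun t => Phi (f t)).
  by move=> lf'; apply: locbdd_comp => //; exact: Phi_continuous.
have lWo f : locbdd f -> locbdd (fun t => W (f t)) by move=> lf'; exact: locbdd_comp.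
have llag f g : locbdd f -> locbdd g -> locbdd (lag b W f g).
  by move=> lf' lg'; apply: locbddD; [exact: lPhi|apply: locbddM => //; exact: lWo].
pose g t := Phi (w t) - Phi (p t) - force b y t * (v t - y t) - b t * kap.
have lg : locbdd g.
  apply: locbddB; last by apply: locbddM => //; exact: locbdd_cst.
  apply: locbddB; first by apply: locbddB; exact: lPhi.
  by apply: locbddM => //; exact: locbddB.
have lz := curve_continuous cz.
have Hz t : - k <= t <= k -> lag b W z x t <= lag b W y w t - s * g t.
  move=> tk.
  have vD : `|v t - y t| <= D.
    have h1 := curve_lip cv (- k) t; rewrite vmk in h1.
    have h2 := y2 (- k); have h3 := y2 t.
    have h4 : `|t - - k| <= 2 * k by rewrite ger0_norm; lra.
    move: h1 h2 h3; rewrite !ler_norml /D; lra.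
  have T := Hs (y t) (v t - y t) (y2 t) vD.
  have zE : z t = y t + s * (v t - y t) by rewrite /z; ring.
  rewrite -zE in T.
  have [_ /(_ t)/andP[bt _]] := cb.
  have b0 : 0 <= b t by rewrite (le_trans _ bt)// ltW.
  have {}T := ler_wpM2l b0 T.
  have PC := Phi_convex s01 (w1 t) (p1 t).
  rewrite /lag /g /force -/(x t).
  move: PC T; rewrite -/(x t); lra.
have Ig : int g (- k) k <= tau / 4.
  have llz : locbdd (lag b W z x).
    by apply: llag; [exact: locbdd_continuous|case: cz => mx x1 _; exact: bounded_locbdd x1].
  have l1 : locbdd (lag b W y w) by exact: llag.
  have l2 : locbdd (fun t => s * g t) by exact: locbddZ.
  have := le_int llz (locbddB l1 l2) Hz; rewrite intB// intZ// => Hi.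
  have : s * int g (- k) k <= s * (tau / 4) by lra.
  by rewrite ler_pM2l.
have lwp := locbddB lw lp.
have lsq : locbdd (fun t => (w t - p t) ^+ 2).
  by have := locbddM lwp lwp.
have lI : locbdd (fun t => flux b y c t * (w t - p t) + force b y t * (y t - v t)).
  by apply: locbddD; apply: locbddM => //; exact: locbddB.
have Y t : 2^-1 * (w t - p t) ^+ 2 + (flux b y c t * (w t - p t) + force b y t * (y t - v t)) <= g t + a2 * kap.
  have := Phi_young (flux b y c t) (w1 t); rewrite -/(p t) /g => Hy.
  have [_ /(_ t)/andP[_ bt]] := cb.
  have := ler_wpM2r (ltW kap0) bt; lra.
have := le_int (locbddD (locbddZ 2^-1 lsq) lI) (locbddD lg (locbdd_cst (a2 * kap))) (fun t (_ : - k <= t <= k) => Y t).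
rewrite intD//; last exact: locbddZ.
rewrite intZ// IBP intD//; last exact: locbdd_cst.
rewrite int_cst// => Hfin.
have a2k : a2 * kap * (k - - k) <= tau / 4.
  have a2p := coeff_a2 a1_gt0 cb.
  rewrite /kap (gtr0_norm a2p).
  have -> : a2 * (tau / (8 * k * (a2 + 1))) * (k - - k) = (a2 / (a2 + 1)) * (tau / 4).
    by field; lra.
  rewrite -[leRHS]mul1r ler_wpM2r//; first by rewrite divr_ge0// ltW.
  by rewrite ler_pdivrMr; lra.
lra.
Qed.

End Flux.

(** * Pointwise compactness of bounded Lipschitz functions *)

Section Compactness.
Context {R : realType}.

(** The weak form of subsequence used below: [k <= phi k], without monotonicity. *)
Lemma cvg_subseq (f : nat -> R) (l : R) (phi : nat -> nat) :
  (forall k, k <= phi k)%N -> f n @[n --> \oo] --> l -> f (phi k) @[k --> \oo] --> l.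
Proof.
move=> kphi /cvgrPdist_lt fl; apply/cvgrPdist_lt => e e0.
have [N _ HN] := fl e e0; exists N => // k /= Nk; apply: HN => /=.
exact: leq_trans Nk (kphi k).
Qed.

(** An ultrafilter on the indices provides limits at all points at once. The index
    [phi k] is chosen close to the limit at the first [k] rational numbers, and
    the Lipschitz bound extends the convergence to all points. *)
Lemma lip_cvg_subseq (u_ : nat -> R -> R) (M : R) :
  (forall n s t, `|u_ n t - u_ n s| <= `|t - s|) -> (forall n t, `|u_ n t| <= M) ->
  exists phi u, (forall k, k <= phi k)%N /\ forall t : R, u_ (phi k) t @[k --> \oo] --> (u t : R).
Proof.
move=> ulip uM.
have [G [Gultra Goo]] := ultraFilterLemma (eventually_filter).
have GF : ProperFilter G by exact: ultra_proper.
have /choice[u Hu] : forall t : R, exists x : R, forall e, 0 < e -> G [set n | `|x - u_ n t| < e].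
  move=> t; have cM : compact `[- M, M] by exact: segment_compact.
  have [|x [_ xG]] := cM ((fun n => u_ n t) @ G) (fmap_proper_filter _ GF).
    by apply: (@filterE _ G) => n /=; rewrite in_itv/= -ler_norml.
  exists x => e e0; have [//|H] := in_ultra_setVsetC [set n | `|x - u_ n t| < e] Gultra.
  have [z [/= z1]] := xG [set z | ~ `|x - z| < e] (ball x e) H (nbhsx_ballx x e e0).
  by rewrite -ball_normE.
have ul s t : `|u t - u s| <= `|t - s|.
  rewrite leNgt; apply/negP => H.
  pose e := (`|u t - u s| - `|t - s|) / 2.
  have e0 : 0 < e by rewrite divr_gt0// subr_gt0.
  have [n [/= n1 n2]] := filter_ex (filterI (Hu t _ e0) (Hu s _ e0)).
  have := ulip n s t.
  have : `|u t - u s| <= `|u t - u_ n t| + `|u_ n t - u_ n s| + `|u s - u_ n s|.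
    have -> : u t - u s = (u t - u_ n t) + (u_ n t - u_ n s) - (u s - u_ n s) by ring.
    by apply: le_trans (ler_normB _ _) _; rewrite lerD2r ler_normD.
  move: n1 n2; rewrite /e; lra.
have /choice[phi Hphi] : forall k : nat, exists n, (k <= n)%N /\
    forall i : 'I_k, forall q : rat, unpickle i = Some q -> `|u (ratr q) - u_ n (ratr q)| < k.+1%:R^-1.
  move=> k.
  have H1 : G [set n | (k <= n)%N] by apply: Goo; exists k.
  have H2 : G [set n | forall i : 'I_k, forall q : rat, unpickle i = Some q -> `|u (ratr q) - u_ n (ratr q)| < k.+1%:R^-1].
    apply: filter_forall => i; case E : (unpickle i) => [q|]; last by apply: filterE.
    have k0 : 0 < k.+1%:R^-1 :> R by [].
    by apply: filterS (Hu (ratr q) _ k0) => n /= Hn _ [<-].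
  by have [n [n1 n2]] := filter_ex (filterI H1 H2); exists n.
exists phi, u; split => [k|t]; first by have [] := Hphi k.
apply/cvgrPdist_lt => e e0.
have e40 : 0 < e / 4 by rewrite divr_gt0.
have [q] : exists q : rat, ratr q \in `]t, t + e / 4[ by apply: rat_in_itvoo; rewrite ltrDl.
rewrite in_itv/= => /andP[q1 q2].
have hc : \forall n \near \oo, n.+1%:R^-1 < e / 4 :> R by apply: (cvgr_lt 0) => //; exact: cvg_harmonic.
have hp : \forall n \near \oo, (pickle q < n)%N by exists (pickle q).+1.
apply: filterS2 hc hp => k k1 k2.
have [_ /(_ (Ordinal k2) q)] := Hphi k; rewrite /= pickleK => /(_ erefl) H.
have h1 := ul (ratr q) t; have h2 := ulip (phi k) t (ratr q).
have tq : `|t - ratr q| <= e / 4 by rewrite distrC gtr0_norm; lra.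
rewrite distrC in h2; rewrite (distrC (ratr q)) in h2.
have -> : u t - u_ (phi k) t = (u t - u (ratr q)) + (u (ratr q) - u_ (phi k) (ratr q)) - (u_ (phi k) t - u_ (phi k) (ratr q)) by ring.
apply: le_lt_trans (ler_normB _ _) _.
have := ler_normD (u t - u (ratr q)) (u (ratr q) - u_ (phi k) (ratr q)).
have {}H := lt_trans H k1; move: {k1 Hphi} h1 h2 tq H; lra.
Qed.

Lemma antider_cvg (f_ : nat -> R -> R) (f : R -> R) (M : R) (t : R) :
  (forall n, locbdd (f_ n)) -> locbdd f -> (forall n x, `|f_ n x| <= M) ->
  (forall x, f_ n x @[n --> \oo] --> f x) ->
  antider (f_ n) t @[n --> \oo] --> antider f t.
Proof.
move=> lf_ lf fM fcvg; rewrite /antider; case: ifP => _.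
  by apply: (int_cvg (M := M)) => //.
by apply: cvgN; apply: (int_cvg (M := M)).
Qed.

End Compactness.

(** * Limits of minimizing sequences *)

Section Limit.
Context {R : realType}.
Variables (W : R -> R) (C1W : C1_fun W) (W0 : forall s, 0 <= W s).
Variables (Wm1 : W (- 1) = 0) (W1 : W 1 = 0).
Variables (a1 a2 : R) (a1_gt0 : 0 < a1).
Implicit Types (u w y v b f g : R -> R) (D : set R).
Notation minact := (minact W).
Notation coeff := (coeff a1 a2).
Notation force := (force W).
Notation flux := (flux W).

Let cW' : continuous (derive1 W) := C1W.2.
Let cW : continuous W := C1_continuous C1W.

(** Replaces the Cauchy-Schwarz inequality; pointwise, [`|g| <= d + g^2 / d]. *)
Lemma int_norm_sqr (g : R -> R) (s t d : R) : locbdd g -> s <= t -> 0 < d ->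
  `|int g s t| <= d * (t - s) + d^-1 * int (fun x => g x ^+ 2) s t.
Proof.
move=> lg st d0.
have lg2 : locbdd (fun x => g x ^+ 2) by have := locbddM lg lg.
have ld := locbddZ d^-1 lg2.
have H x : `|g x| <= d + d^-1 * g x ^+ 2.
  have -> : d + d^-1 * g x ^+ 2 = `|g x| + d^-1 * ((d - `|g x| / 2) ^+ 2 + 3 / 4 * `|g x| ^+ 2).
    have -> : g x ^+ 2 = `|g x| ^+ 2 by rewrite real_normK ?num_real.
    by field; rewrite gt_eqF.
  rewrite lerDl; apply: mulr_ge0; first by rewrite invr_ge0 ltW.
  by apply: addr_ge0; [exact: sqr_ge0|apply: mulr_ge0; [lra|exact: sqr_ge0]].
have -> : d * (t - s) + d^-1 * int (fun x => g x ^+ 2) s t = int (fun x => d + d^-1 * g x ^+ 2) s t.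
  by rewrite intD//; [rewrite int_cst// intZ|exact: locbdd_cst].
have lr : locbdd (fun x => d + d^-1 * g x ^+ 2) by apply: locbddD => //; exact: locbdd_cst.
rewrite ler_norml -mulN1r -intZ//; apply/andP; split; apply: le_int => //.
- exact: locbddZ.
- by move=> x _; have := H x; rewrite ler_norml => /andP[]; rewrite mulN1r.
- by move=> x _; apply: le_trans (ler_norm _) (H x).
Qed.

Lemma int_sqr_mono (g : R -> R) (s r t : R) : locbdd g -> s <= r <= t ->
  int (fun x => g x ^+ 2) s r <= int (fun x => g x ^+ 2) s t.
Proof.
move=> lg srt; have lg2 : locbdd (fun x => g x ^+ 2) by have := locbddM lg lg.
by rewrite [leRHS](int_split lg2 srt) lerDl; apply: int_ge0 => x _; exact: sqr_ge0.
Qed.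

(** By [near_min_flux], the near-minimizer [Y i] is uniformly close to the
    primitive [V i] of [P i = gam (Q i)], where [Q i] is a flux of [Y i] whose
    constant is bounded in [i]. Along a subsequence the constants converge, hence
    [Q i] and [P i] pointwise, and dominated convergence gives the equation of
    [u]. For the action, [Phi_young] and an integration by parts bound the action
    of [(Y i, P i)] by that of the near-minimizer up to a term controlled by
    [Y i - V i]; the former converges to the action of the limit. *)
Lemma minimizing_limit_flux b (y_ w_ : nat -> R -> R) (e_ : nat -> R) u (k : R) :
  coeff b -> (forall n, adm (y_ n) (w_ n)) -> (forall n t, `|y_ n t| <= 2) ->
  (forall n, (act b W (y_ n) (w_ n) setT <= minact b + (e_ n)%:E)%E) ->
  e_ n @[n --> \oo] --> 0 -> (forall t, y_ n t @[n --> \oo] --> u t) -> continuous u ->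
  4 <= k ->
  exists c, let p := fun t => gam (flux b u c t) in
    (forall t, - k <= t <= k -> u t - u (- k) = int p (- k) t) /\
    ((int (lag b W u p) (- k) k)%:E <= minact b)%E.
Proof.
move=> cb yw y2 ymin ecvg ycvg cu k4.
have [C HC] := near_min_flux C1W W0 Wm1 W1 a2 a1_gt0 k4.
have [K K0 HK] := force_bound C1W a2 a1_gt0.
pose rho (j : nat) : R := j.+1%:R^-1.
have rho0 j : 0 < rho j by rewrite /rho invr_gt0.
have /choice[n Hn] : forall j, exists n, (j <= n)%N /\ exists c v,
   let p := fun t => gam (flux b (y_ n) c t) in
   [/\ `|c| <= C, curve v p, v (- k) = y_ n (- k), v k = y_ n k &
     int (fun t => (w_ n t - p t) ^+ 2) (- k) k <= rho j ^+ 2].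
  move=> j; have r2 : 0 < rho j ^+ 2 by rewrite exprn_gt0.
  have [e e0 He] := HC _ r2.
  have h1 : \forall n \near \oo, e_ n < e by apply: (cvgr_lt 0).
  have h2 : \forall n \near \oo, (j <= n)%N by exists j.
  have [n [n1 n2]] := filter_ex (filterI h1 h2).
  exists n; split => //; apply: He => //; apply: le_trans (ymin n) _.
  by rewrite leeD2lE ?lee_fin ?(ltW n1)// (minact_fin_num cW W0 Wm1 W1 a1_gt0 cb).
have /choice[c0 Hc0] : forall j, exists c, exists v,
   let p := fun t => gam (flux b (y_ (n j)) c t) in
   [/\ `|c| <= C, curve v p, v (- k) = y_ (n j) (- k), v k = y_ (n j) k &
     int (fun t => (w_ (n j) t - p t) ^+ 2) (- k) k <= rho j ^+ 2].
  by move=> j; have [_ [c [v H]]] := Hn j; exists c, v.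
have [phi [cc [kphi cccvg]]] : exists phi cc, (forall k, k <= phi k)%N /\ forall t : R, c0 (phi k) @[k --> \oo] --> (cc t : R).
  apply: (lip_cvg_subseq (u_ := fun n _ => c0 n) (M := C)) => [m s t|m _].
    by rewrite subrr normr0.
  by have [v []] := Hc0 m.
pose N i := n (phi i).
have iN i : (i <= N i)%N by rewrite (leq_trans (kphi i))//; have [] := Hn (phi i).
pose c_ i := c0 (phi i).
pose c := cc 0.
pose Y i := y_ (N i).
pose Q i := flux b (Y i) (c_ i).
pose P i t := gam (Q i t).
have /choice[V HV] : forall i, exists v,
   [/\ curve v (P i), v (- k) = Y i (- k), v k = Y i k &
     int (fun t => (w_ (N i) t - P i t) ^+ 2) (- k) k <= rho (phi i) ^+ 2].
  by move=> i; have [v [_ v1 v2 v3 v4]] := Hc0 (phi i); exists v.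
have Ycvg t : Y i t @[i --> \oo] --> u t by exact: (cvg_subseq iN (ycvg t)).
have cY i : continuous (Y i) by exact: adm_continuous (yw _).
have Y2 i t : `|Y i t| <= 2 by exact: y2.
have u2 t : `|u t| <= 2.
  have h : `|Y i t| @[i --> \oo] --> `|u t| by apply: cvg_norm.
  by apply: (ler_cvg_to h (g := fun=> 2)); [exact: cvg_cst|exact: nearW].
have fcvg t : force b (Y i) t @[i --> \oo] --> force b u t.
  apply: cvgM; first exact: cvg_cst.
  by apply: (@cvg_comp _ _ _ (Y ^~ t) (derive1 W)); [exact: Ycvg|exact: cW'].
have lf i : locbdd (force b (Y i)) by exact: (locbdd_force C1W a1_gt0 cb (cY i)).
have lfu : locbdd (force b u) by exact: (locbdd_force C1W a1_gt0 cb cu).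
have Qcvg t : Q i t @[i --> \oo] --> flux b u c t.
  apply: cvgD; first exact: cccvg.
  by apply: (antider_cvg (M := K)) => // i x; exact: HK.
pose p t := gam (flux b u c t).
have Pcvg t : P i t @[i --> \oo] --> p t.
  by apply: (@cvg_comp _ _ _ (Q ^~ t) gam); [exact: Qcvg|exact: gam_continuous].
have lq : locbdd (flux b u c) by exact: locbdd_continuous (flux_continuous C1W a1_gt0 cb cu).
have lp : locbdd p := locbdd_comp gam_continuous lq.
have lQ i : locbdd (Q i) by exact: locbdd_continuous (flux_continuous C1W a1_gt0 cb (cY i)).
have lP i : locbdd (P i) := locbdd_comp gam_continuous (lQ i).
have P1 i t : `|P i t| <= 1 by exact/ltW/gam_lt1.
have lw i : locbdd (w_ (N i)) by exact: adm_locbdd (yw _).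
have kk : - k <= k by lra.
(* int_norm_sqr with d = rho gives rho * (2 * k) for the length of the
   interval and rho^-1 * rho^2 for the L^2 distance of the slopes *)
pose B i := rho i * (2 * k + 1).
have B0 : B i @[i --> \oo] --> 0.
  rewrite -(mul0r (2 * k + 1)); apply: cvgM; last exact: cvg_cst.
  exact: cvg_harmonic.
have rhophi i : rho (phi i) <= rho i.
  by rewrite /rho lef_pV2 ?posrE// ler_nat ltnS.
have YV i t : - k <= t <= k -> `|Y i t - V i t| <= B i.
  move=> tk; have [cv v1 _ v3] := HV i; have [_ _ Pv] := cv.
  have [_ _ Py _ _] := yw (N i).
  have lD := locbddB (lw i) (lP i).
  have kt : - k <= t by case/andP: tk.
  have -> : Y i t - V i t = int (fun t => w_ (N i) t - P i t) (- k) t.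
    by rewrite (intB _ _ (lw i) (lP i)) -(Pv _ _ kt) -(Py _ _ kt) v1 /Y; ring.
  apply: le_trans (int_norm_sqr lD kt (rho0 (phi i))) _.
  apply: (@le_trans _ _ (rho (phi i) * (2 * k + 1))); last first.
    by apply: ler_wpM2r => //; lra.
  have -> : rho (phi i) * (2 * k + 1) = rho (phi i) * (2 * k) + rho (phi i) by ring.
  apply: lerD.
    by apply: ler_wpM2l; [exact: ltW|case/andP: tk; lra].
  rewrite mulrC ler_pdivrMr ?rho0// -expr2; apply: le_trans v3.
  by apply: int_sqr_mono.
exists c; split => [t tk|].
  have kt : - k <= t by case/andP: tk.
  have h1 : Y i t - Y i (- k) @[i --> \oo] --> u t - u (- k) by apply: cvgB.
  have h2 : int (P i) (- k) t @[i --> \oo] --> int p (- k) t.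
    by apply: (int_cvg (M := 1)) => // *.
  have h3 : Y i t - Y i (- k) - int (P i) (- k) t @[i --> \oo] --> 0.
    apply/cvgrPdist_le => e e0; have /cvgrPdist_le /(_ _ e0) := B0.
    apply: filterS => i; rewrite sub0r normrN => He.
    have [cv v1 _ _] := HV i; have [_ _ Pv] := cv.
    rewrite sub0r normrN -(Pv _ _ kt) v1.
    have -> : Y i t - Y i (- k) - (V i t - Y i (- k)) = Y i t - V i t by ring.
    by apply: le_trans (YV i t tk) _; apply: le_trans He; exact: ler_norm.
  apply/eqP; rewrite -subr_eq0; apply/eqP.
  apply: (cvg_unique (@Rhausdorff R) _ h3); exact: cvgB.
have mf := minact_fin_num cW W0 Wm1 W1 a1_gt0 cb.
have lPhi f : locbdd f -> locbdd (fun t => Phi (f t)).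
  by move=> lf'; apply: locbdd_comp => //; exact: Phi_continuous.
have lb := coeff_locbdd a1_gt0 cb.
have lbW v : continuous v -> locbdd (fun t => b t * W (v t)).
  by move=> cv; apply: locbddM => //; apply: locbdd_comp => //; exact: locbdd_continuous.
rewrite -(fineK mf) lee_fin.
have [MW HMW] := (locbdd_continuous cW).2 2.
have llPi i : locbdd (lag b W (Y i) (P i)) := locbddD (lPhi _ (lP i)) (lbW _ (cY i)).
have llu : locbdd (lag b W u p) := locbddD (lPhi _ lp) (lbW _ cu).
have ll i : locbdd (lag b W (Y i) (w_ (N i))) := locbddD (lPhi _ (lw i)) (lbW _ (cY i)).
have L1 : int (lag b W (Y i) (P i)) (- k) k @[i --> \oo] --> int (lag b W u p) (- k) k.
  apply: (int_cvg (M := 1 + a2 * MW)).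
  - by move=> i; exact: (llPi i).
  - exact: llu.
  - move=> i x _; rewrite (ger0_norm (lag_ge0 (Y i) (P i) (coeff_ge0 a1_gt0 cb) W0 x)).
    apply: lerD; first exact: Phi_le1.
    have [_ /(_ x)/andP[_ bx]] := cb.
    apply: ler_pM; [exact: (coeff_ge0 a1_gt0 cb)|exact: W0|exact: bx|].
    by apply: le_trans (ler_norm _) (HMW _ (Y2 i x)).
  - move=> x _; apply: cvgD.
      by apply: (@cvg_comp _ _ _ (P ^~ x) Phi); [exact: Pcvg|exact: Phi_continuous].
    apply: cvgM; first exact: cvg_cst.
    by apply: (@cvg_comp _ _ _ (Y ^~ x) W); [exact: Ycvg|exact: cW].
have L2 : fine (minact b) + e_ (N i) + K * (2 * k) * B i @[i --> \oo] --> fine (minact b).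
  rewrite -[X in _ --> X]addr0 -(mulr0 (K * (2 * k))); apply: cvgD; last first.
    by apply: cvgM; [exact: cvg_cst|exact: B0].
  rewrite -[X in _ --> X]addr0; apply: cvgD; first exact: cvg_cst.
  exact: cvg_subseq iN ecvg.
apply: (ler_cvg_to L1 L2); apply: nearW => i.
have [cv v1 v2 _] := HV i; have [_ _ Pv] := cv.
have cyw := adm_curve (yw (N i)); have [mw w1 Py] := cyw.
have lV := locbdd_continuous (curve_continuous cv); have lY := locbdd_continuous (cY i).
have H1 : int (lag b W (Y i) (w_ (N i))) (- k) k <= fine (minact b) + e_ (N i).
  rewrite -lee_fin -(act_int cW _ _ lb (cY i) (lw i)).
  have h : (act b W (Y i) (w_ (N i)) `[(- k)%R, k] <= act b W (Y i) (w_ (N i)) setT)%E.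
    apply: (act_subset cW W0 _ (coeff_ge0 a1_gt0 cb) (cY i) mw) => //; by case: cb.
  by apply: le_trans h (le_trans (ymin _) _); rewrite EFinD fineK.
have lYV := locbddB lY lV.
have lwP := locbddB (lw i) (lP i).
have IBP : int (fun t => Q i t * (w_ (N i) t - P i t) + force b (Y i) t * (Y i t - V i t)) (- k) k = 0.
  have PQ : prim (Q i) (force b (Y i)) by exact: (prim_flux C1W a1_gt0 _ cb (cY i)).
  have X := prim_mul (lf i) lwP PQ (primB (lw i) (lP i) Py Pv).
  by rewrite -X// v1 v2 !subrr !mulr0 subrr.
have lfYV := locbddM (lf i) lYV.
have lQw := locbddM (lQ i) lwP.
have lI := locbddD lQw lfYV.
have H2 : int (lag b W (Y i) (P i)) (- k) k <= int (fun t => lag b W (Y i) (w_ (N i)) t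
    - (Q i t * (w_ (N i) t - P i t) + force b (Y i) t * (Y i t - V i t)) + K * B i) (- k) k.
  apply: (le_int (llPi i) (locbddD (locbddB (ll i) lI) (locbdd_cst _))).
  move=> x xk; rewrite /lag.
  have := Phi_young (Q i x) (w1 x); rewrite -/(P i x).
  have : force b (Y i) x * (Y i x - V i x) <= K * B i.
    apply: le_trans (ler_norm _) _; rewrite normrM; apply: ler_pM => //; first exact: HK.
    exact: YV.
  have := sqr_ge0 (w_ (N i) x - P i x); lra.
rewrite (intD _ _ (locbddB (ll i) lI) (locbdd_cst _)) (intB _ _ (ll i) lI) IBP (int_cst _ kk) in H2.
move: H1 H2; set I1 := int _ _ _; set I2 := int _ _ _ => H1 H2; lra.
Qed.

End Limit.

Section GlobalLimit.
Context {R : realType}.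
Variables (W : R -> R) (C1W : C1_fun W) (W0 : forall s, 0 <= W s).
Variables (Wm1 : W (- 1) = 0) (W1 : W 1 = 0).
Variable (Wgt0 : forall s, s != 1 -> s != - 1 -> 0 < W s).
Variables (a1 a2 : R) (a1_gt0 : 0 < a1).
Implicit Types (u w y v b f g : R -> R) (D : set R).
Notation minact := (minact W).
Notation coeff := (coeff a1 a2).
Notation flux := (flux W).

Let cW : continuous W := C1_continuous C1W.

Lemma act_setT_le b y w (m : \bar R) : coeff b -> curve y w ->
  (forall k : R, 4 <= k -> (act b W y w `[(- k)%R, k] <= m)%E) -> (act b W y w setT <= m)%E.
Proof.
move=> cb cyw H; have [mb _] := cb; have [mw _ _] := cyw.
have b0 := coeff_ge0 a1_gt0 cb; have cy := curve_continuous cyw.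
pose F (i : nat) := `[- (i%:R : R), i%:R]%classic.
have FT : \bigcup_i F i = setT by exact: bigcup_itvT.
have cv : act b W y w (F i) @[i --> \oo] --> act b W y w setT.
  rewrite -FT; apply: ge0_nondecreasing_set_cvg_integral.
  - apply/nondecreasing_seqP => n; apply/subsetPset => x; rewrite /F/= !in_itv/= -!ler_norml.
    by move/le_trans; apply; rewrite ler_nat.
  - by move=> n; exact: measurable_itv.
  - by move=> n; exact: (measurable_lag_EFin cW).
  - by move=> n x _; rewrite lee_fin lag_ge0.
apply: (cvge_le _ cv); near=> n.
apply: H; rewrite -[4]/(4%:R) ler_nat; near: n; exact: nbhs_infty_ge.
Unshelve. all: by end_near. Qed.

(** The bound [e_ n <= eps] makes [near_min_bound] apply to all terms of the
    sequence. *)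
Lemma minimizing_sequence b (eps : R) : coeff b -> 0 < eps ->
  exists (y_ w_ : nat -> R -> R) (e_ : nat -> R), [/\ forall n, adm (y_ n) (w_ n),
    forall n, (act b W (y_ n) (w_ n) setT <= minact b + (e_ n)%:E)%E,
    forall n, 0 < e_ n <= eps & e_ n @[n --> \oo] --> 0].
Proof.
move=> cb eps0.
pose e_ (n : nat) : R := eps / n.+1%:R.
have e0 n : 0 < e_ n by rewrite divr_gt0.
have /choice[yw Hyw] : forall n, exists yw : (R -> R) * (R -> R), adm yw.1 yw.2 /\
    (act b W yw.1 yw.2 setT <= minact b + (e_ n)%:E)%E.
  move=> n; have mf := minact_fin_num cW W0 Wm1 W1 a1_gt0 cb.
  have [_ [yw yw1 <-] /ltW yw2] := lb_ereal_inf_adherent (e0 n) mf.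
  by exists yw.
exists (fun n => (yw n).1), (fun n => (yw n).2), e_; split.
- by move=> n; have [] := Hyw n.
- by move=> n; have [] := Hyw n.
- by move=> n; rewrite e0 ler_pdivrMr// ler_peMr ?ler1n// ltW.
- rewrite -(mulr0 eps); apply: cvgM; [exact: cvg_cst|exact: cvg_harmonic].
Qed.

(** [near_min_bound] for every [eta] gives [-1 <= u <= 1]. The constants of the flux
    found on the different intervals [`[- k, k]] coincide, since [gam c] is the
    derivative of [u] at 0 and [gam] is injective. *)
Lemma minimizing_limit b (y_ w_ : nat -> R -> R) (e_ : nat -> R) :
  coeff b -> (forall n, adm (y_ n) (w_ n)) -> (forall n t, `|y_ n t| <= 2) ->
  (forall n, (act b W (y_ n) (w_ n) setT <= minact b + (e_ n)%:E)%E) ->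
  e_ n @[n --> \oo] --> 0 ->
  exists (phi : nat -> nat) u c, let p := fun t => gam (flux b u c t) in
  [/\ forall k, (k <= phi k)%N, forall t, y_ (phi k) t @[k --> \oo] --> u t, curve u p,
    forall t, -1 <= u t <= 1 & (act b W u p setT <= minact b)%E].
Proof.
move=> cb yw y2 ymin ecvg.
have [phi [u [kphi ycvg]]] := lip_cvg_subseq (fun n => adm_lip (yw n)) y2.
have ephi := cvg_subseq kphi ecvg.
have ulip s t : `|u t - u s| <= `|t - s|.
  have h : `|y_ (phi k) t - y_ (phi k) s| @[k --> \oo] --> `|u t - u s|.
    by apply: cvg_norm; apply: cvgB.
  apply: (ler_cvg_to h (g := fun=> `|t - s|)); first exact: cvg_cst.
  by apply: nearW => k; exact: adm_lip (yw _) _ _.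
have cu : continuous u.
  move=> x; apply/cvgrPdist_le => e e0; exists e => //= z; rewrite /ball_/= => xz.
  by rewrite distrC (le_trans (ulip _ _))// distrC ltW.
have u1 t : -1 <= u t <= 1.
  have B eta : 0 < eta -> -1 - eta <= u t <= 1 + eta.
    move=> eta0; have [eps eps0 H] := near_min_bound cW W0 Wm1 W1 Wgt0 a2 a1_gt0 eta0.
    have near_b : \forall k \near \oo, -1 - eta <= y_ (phi k) t <= 1 + eta.
      have : \forall k \near \oo, e_ (phi k) < eps by apply: (cvgr_lt 0).
      apply: filterS => k ek; apply: (H b _ (w_ (phi k))) => //.
      apply: le_trans (ymin _) _.
      by rewrite leeD2lE ?lee_fin ?(ltW ek)// (minact_fin_num cW W0 Wm1 W1 a1_gt0 cb).
    apply/andP; split.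
      apply: (ler_cvg_to (cvg_cst (-1 - eta)) (ycvg t)).
      by apply: filterS near_b => k /andP[].
    apply: (ler_cvg_to (ycvg t) (cvg_cst (1 + eta))).
    by apply: filterS near_b => k /andP[].
  by apply/andP; split; apply/ler_addgt0Pr => eta eta0; have := B eta eta0; lra.
have L k (k4 : 4 <= k) := minimizing_limit_flux C1W W0 Wm1 W1 a1_gt0 cb
  (fun n => yw (phi n)) (fun n => y2 (phi n)) (fun n => ymin (phi n)) ephi ycvg cu k4.
have [c [Hc _]] := L 4 (lexx _).
pose P c t := gam (flux b u c t).
have cP d : continuous (P d).
  move=> t; apply: (@continuous_comp _ _ _ (flux b u d) gam); last exact: gam_continuous.
  exact: (flux_continuous C1W a1_gt0 cb cu).
have D k d : 4 <= k -> (forall t, - k <= t <= k -> u t - u (- k) = int (P d) (- k) t) ->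
    derive1 u 0 = gam d.
  move=> k4 Hd.
  have lP := locbdd_continuous (cP d).
  have PA := prim_antider lP.
  pose v t := u (- k) - antider (P d) (- k) + antider (P d) t.
  have dv : is_derive (0 : R) 1 v (P d 0).
    by apply: (prim_is_derive lP); [exact: primDc|exact: cP].
  have uv : {near (0 : R), u =1 v}.
    exists k => /=; first lra.
    move=> t; rewrite /ball_/= sub0r normrN => tk.
    have tk' : - k <= t <= k by rewrite -ler_norml ltW.
    have := Hd t tk'; rewrite /v -PA; last by case/andP: tk'.
    lra.
  rewrite derive1E (near_eq_derive _ uv) (derive_val (is_derive := dv)).
  by rewrite /P /flux antider0 addr0.
have cE k d : 4 <= k -> (forall t, - k <= t <= k -> u t - u (- k) = int (P d) (- k) t) -> d = c.
  move=> k4 /(D k d k4) h; have := D 4 c (lexx _) Hc; rewrite h => h'.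
  by rewrite -(gamK d) h' gamK.
have Lc k : 4 <= k -> (forall t, - k <= t <= k -> u t - u (- k) = int (P c) (- k) t) /\
    ((int (lag b W u (P c)) (- k) k)%:E <= minact b)%E.
  move=> k4; have [d [Hd1 Hd2]] := L k k4.
  by have dc := cE k d k4 Hd1; rewrite dc in Hd1 Hd2.
have cup : curve u (P c).
  split; first exact: continuous_measurable_fun (cP c).
    by move=> t; exact/ltW/gam_lt1.
  move=> s t st.
  pose k := 4 + `|s| + `|t|.
  have k4 : 4 <= k by rewrite /k -addrA lerDl addr_ge0.
  have sk : - k <= s <= k by rewrite -ler_norml /k; have := normr_ge0 t; lra.
  have tk : - k <= t <= k by rewrite -ler_norml /k; have := normr_ge0 s; lra.
  have [Hk _] := Lc k k4.
  have := int_split (r := s) (s := - k) (t := t) (locbdd_continuous (cP c)).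
  have := Hk s sk; have := Hk t tk.
  by move: sk => /andP[sk _] h1 h2; rewrite sk st => /(_ isT) h3; lra.
exists phi, u, c; split => //.
apply: act_setT_le => // k k4.
rewrite (act_int cW _ _ (coeff_locbdd a1_gt0 cb) cu (locbdd_continuous (cP c))).
by have [] := Lc k k4.
Qed.

End GlobalLimit.

(** * Invariance under translations *)

Section Translation.
Context {R : realType}.
Implicit Types (w y : R -> R) (D : set R).
Notation mu := (@lebesgue_measure R).

Lemma measurable_shift (c : R) : measurable_fun [set: measurableTypeR R]
  ((fun t => t + c) : measurableTypeR R -> measurableTypeR R).
Proof.
apply: (@continuous_measurable_fun R (fun t : R => t + c)) => x.
by apply: cvgD; [exact: cvg_id|exact: cvg_cst].
Qed.

Lemma lebesgue_measure_shift (c : R) D : measurable D ->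
  mu ((fun t => t + c) @^-1` D) = mu D.
Proof.
move=> mD; apply/esym; apply: (@lebesgue_measure_unique R
  (measure_function_pushforward__canonical__measure_function_Measure mu (measurable_shift c))) => //.
move=> X [[x1 x2] _ <-] /=.
transitivity (mu `]x1 - c, x2 - c]); last first.
  by congr mu; apply/seteqP; split => t /=; rewrite !in_itv/= ltrBlDr lerBrDr.
rewrite [LHS](lebesgue_measure_itv `]x1, x2])/= [RHS](lebesgue_measure_itv `]x1 - c, x2 - c])/=.
rewrite !lte_fin ltrD2r; case: ifP => // _.
by rewrite -!EFinD; congr (_%:E); ring.
Qed.

Lemma ge0_integral_shift (c : R) (f : R -> \bar R) D : measurable D ->
  measurable_fun setT f -> (forall t, (0 <= f t)%E) ->
  (\int[mu]_(t in (fun t => (t + c)%R) @^-1` D) f (t + c)%R = \int[mu]_(t in D) f t)%E.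
Proof.
move=> mD mf f0.
rewrite -(@ge0_integral_pushforward _ _ _ _ _ _ (measurable_shift c) mu D f) => //.
  rewrite [RHS](@eq_measure_integral _ (measurableTypeR R) R D
    (measure_function_pushforward__canonical__measure_function_Measure mu (measurable_shift c)))//.
  by move=> A mA _; apply/esym; exact: lebesgue_measure_shift.
exact: measurable_funTS.
Qed.

Lemma int_shift (c : R) w (s t : R) : measurable_fun setT w -> (forall t, `|w t| <= 1) -> s <= t ->
  int (fun t => w (t + c)) s t = int w (s + c) (t + c).
Proof.
move=> mw w1 st.
have lw := bounded_locbdd mw w1.
have mwc : measurable_fun setT (fun t : R => w (t + c)).
  by apply: (measurableT_comp mw); exact: measurable_shift.
have lwc : locbdd (fun t => w (t + c)) by exact: (bounded_locbdd mwc (fun t => w1 (t + c))).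
have l1 := locbdd_cst (1 : R).
(* adding 1 makes the integrand nonnegative *)
have E : int (fun t => 1 + w (t + c)) s t = int (fun t => 1 + w t) (s + c) (t + c).
  rewrite /int /Rintegral; congr fine.
  have -> : `[s, t]%classic = (fun t => t + c) @^-1` `[s + c, t + c].
    by apply/seteqP; split => x /=; rewrite !in_itv/= !lerD2r.
  rewrite (ge0_integral_shift c (f := fun t => (1 + w t)%:E))//.
    by apply/measurable_EFinP; apply: measurable_funD.
  by move=> x; rewrite lee_fin; have := w1 x; rewrite ler_norml; lra.
move: E; rewrite (intD _ _ l1 lwc) (intD _ _ l1 lw) !int_cst ?lerD2r//; lra.
Qed.

Lemma cvg_pinfty_shift y (l c : R) : y t @[t --> +oo] --> l -> y (t + c) @[t --> +oo] --> l.
Proof.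
move=> /cvgrPdist_le yl; apply/cvgrPdist_le => e /yl[A [_ HA]].
exists (A - c); split; first exact: num_real.
by move=> t tA; apply: HA; lra.
Qed.

Lemma cvg_ninfty_shift y (l c : R) : y t @[t --> -oo] --> l -> y (t + c) @[t --> -oo] --> l.
Proof.
move=> /cvgrPdist_le yl; apply/cvgrPdist_le => e /yl[A [_ HA]].
exists (A - c); split; first exact: num_real.
by move=> t tA; apply: HA; lra.
Qed.

Lemma adm_shift y w c : adm y w -> adm (fun t => y (t + c)) (fun t => w (t + c)).
Proof.
move=> [mw w1 yw yp yn]; split.
- by apply: (measurableT_comp mw); exact: measurable_shift.
- by move=> t.
- by move=> s t st; rewrite int_shift// -yw// lerD2r.
- exact: cvg_pinfty_shift.
- exact: cvg_ninfty_shift.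
Qed.

Lemma act_shift (W : R -> R) (a c : R) y w : continuous W -> (forall s, 0 <= W s) -> 0 <= a ->
  adm y w -> act (fun=> a) W (fun t => y (t + c)) (fun t => w (t + c)) setT =
    act (fun=> a) W y w setT.
Proof.
move=> cW W0 a0 yw; have [mw _ _ _ _] := yw.
rewrite /act -[RHS](ge0_integral_shift c (f := fun t => (lag (fun=> a) W y w t)%:E))//.
  apply: measurable_lag_EFin => //; exact: adm_continuous yw.
by move=> t; rewrite lee_fin lag_ge0.
Qed.

End Translation.

(** * Limits at infinity and the autonomous problem *)

Section Existence.
Context {R : realType}.
Variables (W : R -> R) (C1W : C1_fun W) (W0 : forall s, 0 <= W s).
Variables (Wm1 : W (- 1) = 0) (W1 : W 1 = 0).
Variable (Wgt0 : forall s, s != 1 -> s != - 1 -> 0 < W s).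
Variables (a1 a2 : R) (a1_gt0 : 0 < a1).
Implicit Types (u w y v b f g : R -> R) (D : set R).
Notation minact := (minact W).
Notation coeff := (coeff a1 a2).
Notation flux := (flux W).

Let cW : continuous W := C1_continuous C1W.

(** Each new interval can be chosen outside a ball containing the previous ones, so
    the costs add up. *)
Lemma act_unbounded b u p (k : R) : coeff b -> curve u p -> 0 < k ->
  (forall T, exists s t : R, [/\ s <= t, (T < s) || (t < - T) & (k%:E <= act b W u p `[s, t])%E]) ->
  act b W u p setT = +oo%E.
Proof.
move=> cb cup k0 H; have [mb _] := cb; have b0 := coeff_ge0 a1_gt0 cb.
have [mp _ _] := cup; have cu := curve_continuous cup.
have S n : exists2 r, 0 <= r & ((k *+ n)%:E <= act b W u p `[(- r)%R, r])%E.
  elim: n => [|n [r r0 IH]]; first by exists 0 => //; rewrite mulr0n act_ge0.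
  have [s [t [st rst kst]]] := H r.
  exists (r + `|s| + `|t|); first by rewrite !addr_ge0.
  have := normr_ge0 s; have := normr_ge0 t => t0 s0.
  have sn := ler_norm s; have tn := ler_norm t; have sn' := ler_norm (- s); have tn' := ler_norm (- t).
  rewrite normrN in sn' tn'.
  apply: (@le_trans _ _ (act b W u p (`[(- r)%R, r] `|` `[s, t]))).
    rewrite act_setU//.
      by rewrite mulrS addrC EFinD; exact: leeD.
    move=> x /=; rewrite !in_itv/= => /andP[x1 x2] /andP[x3 x4].
    by case/orP: rst => h; lra.
  apply: act_subset => //; first exact: measurableU.
  by move=> x [|]/=; rewrite !in_itv/= => /andP[x1 x2]; apply/andP; split; lra.
apply/eqP; rewrite -leye_eq leNgt; apply/negP => h.
have /fineK mE : act b W u p setT \is a fin_num by rewrite ge0_fin_numE// act_ge0.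
set M := fine _ in mE.
have [n Hn] : exists n : nat, M < k *+ n.
  pose n := Num.truncn (`|M| / k); exists n.+1.
  have := truncnS_gt (`|M| / k); rewrite -/n ltr_pdivrMr// => h'.
  by rewrite -mulr_natl (le_lt_trans (ler_norm _)).
have [r _ Hr] := S n.
have : ((k *+ n)%:E <= act b W u p setT)%E by apply: le_trans Hr _; exact: act_subset.
by rewrite -mE lee_fin leNgt Hn.
Qed.

(** If [u t < 1 - e] for arbitrarily large [t], then by the Lipschitz bound [u] lies
    between [- 1 + d] and [1 - e / 2] on far intervals of length [e / 2], where
    [W] is bounded below; the action would be infinite. *)
Lemma act_lty_pinfty b u p (d : R) T : coeff b -> curve u p -> 0 < d ->
  (forall t, u t <= 1) -> (forall t, T <= t -> - 1 + d <= u t) ->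
  (act b W u p setT < +oo)%E -> u t @[t --> +oo] --> (1 : R).
Proof.
move=> cb cup d0 u1 uT fin; apply/cvgrPdist_le => e e0.
apply: contrapT => H.
suff : act b W u p setT = +oo%E by move=> E; rewrite E ltxx in fin.
have [ed|ed] := leP (1 - e / 2) (- 1 + d).
  exfalso; apply: H; exists T; split; first exact: num_real.
  move=> t /ltW /uT ut; have := u1 t => u1t.
  by rewrite ger0_norm ?subr_ge0//; lra.
have [s sh|c c0 Hc] := @W_ge_pos _ W cW Wgt0 (- 1 + d) (1 - e / 2) (ltW ed).
  by split; apply/eqP; lra.
apply: (@act_unbounded b u p (a1 * c * (e / 2)) cb cup).
  by rewrite !mulr_gt0//; lra.
move=> T'.
have [t [tT ut]] : exists t, Num.max T T' < t /\ u t < 1 - e.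
  apply: contrapT => H'; apply: H; exists (Num.max T T'); split; first exact: num_real.
  move=> t tT; rewrite ger0_norm ?subr_ge0//.
  rewrite leNgt; apply/negP => h; apply: H'; exists t; split => //; lra.
move: tT; rewrite gt_max => /andP[tT tT'].
exists t, (t + e / 2); split; [lra|by rewrite tT'|].
have := @act_itv_ge _ W cW a1 a2 a1_gt0 b u p t (t + e / 2) c cb cup _ (ltW c0).
have -> : t + e / 2 - t = e / 2 by ring.
apply; first lra.
move=> r /andP[tr rt]; apply: Hc; apply/andP; split; first by apply: uT; lra.
have := curve_lip cup t r; rewrite (ger0_norm (x := r - t)) ?subr_ge0//.
have := ler_norm (u r - u t); lra.
Qed.

(** Mirror image of [act_lty_pinfty]. *)
Lemma act_lty_ninfty b u p (d : R) T : coeff b -> curve u p -> 0 < d ->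
  (forall t, - 1 <= u t) -> (forall t, t <= T -> u t <= 1 - d) ->
  (act b W u p setT < +oo)%E -> u t @[t --> -oo] --> (- 1 : R).
Proof.
move=> cb cup d0 u1 uT fin; apply/cvgrPdist_le => e e0.
apply: contrapT => H.
suff : act b W u p setT = +oo%E by move=> E; rewrite E ltxx in fin.
have [ed|ed] := leP (1 - d) (- 1 + e / 2).
  exfalso; apply: H; exists T; split; first exact: num_real.
  move=> t /ltW /uT ut; have := u1 t => u1t.
  by rewrite distrC ger0_norm ?opprK; lra.
have [s sh|c c0 Hc] := @W_ge_pos _ W cW Wgt0 (- 1 + e / 2) (1 - d) (ltW ed).
  by split; apply/eqP; lra.
apply: (@act_unbounded b u p (a1 * c * (e / 2)) cb cup).
  by rewrite !mulr_gt0//; lra.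
move=> T'.
have [t [tT ut]] : exists t, t < Num.min T (- T') /\ - 1 + e < u t.
  apply: contrapT => H'; apply: H; exists (Num.min T (- T')); split; first exact: num_real.
  move=> t tT; rewrite distrC ger0_norm; last by have := u1 t; lra.
  rewrite leNgt; apply/negP => h; apply: H'; exists t; split => //; lra.
move: tT; rewrite lt_min => /andP[tT tT'].
exists (t - e / 2), t; split; [lra|by rewrite tT' orbT|].
have := @act_itv_ge _ W cW a1 a2 a1_gt0 b u p (t - e / 2) t c cb cup _ (ltW c0).
have -> : t - (t - e / 2) = e / 2 by ring.
apply; first lra.
move=> r /andP[tr rt]; apply: Hc; apply/andP; split; last by apply: uT; lra.
have := curve_lip cup t r; rewrite (distrC r) (ger0_norm (x := t - r)) ?subr_ge0//.
have := ler_norm (u t - u r); rewrite distrC; lra.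
Qed.

Lemma act_split_ge b y w (s : R) (r t k : R) : coeff b -> curve y w ->
  (k%:E <= act b W y w `[r, t])%E -> t <= s ->
  (k%:E + act b W y w `]s, +oo[ <= act b W y w setT)%E.
Proof.
move=> cb cyw kr ts; have [mb _] := cb; have b0 := coeff_ge0 a1_gt0 cb.
have [mw _ _] := cyw; have cy := curve_continuous cyw.
rewrite (act_split cW W0 s)//; apply: leeD => //; apply: le_trans kr _.
by apply: act_subset => // x /=; rewrite !in_itv/= => /andP[_ xt]; exact: le_trans ts.
Qed.

Lemma act_split_ge_l b y w (s : R) (r t k : R) : coeff b -> curve y w ->
  (k%:E <= act b W y w `[r, t])%E -> s < r ->
  (act b W y w `]-oo, s] + k%:E <= act b W y w setT)%E.
Proof.
move=> cb cyw kr sr; have [mb _] := cb; have b0 := coeff_ge0 a1_gt0 cb.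
have [mw _ _] := cyw; have cy := curve_continuous cyw.
rewrite (act_split cW W0 s)//; apply: leeD => //; apply: le_trans kr _.
by apply: act_subset => // x /=; rewrite !in_itv/= => /andP[rx _]; rewrite andbT (lt_le_trans sr).
Qed.

(** A minimizer between the wells, with the Euler-Lagrange equation in integrated
    form. *)
Definition minimizer b u c := let p := fun t => gam (flux b u c t) in
  [/\ adm u p, forall t, -1 <= u t <= 1 & (act b W u p setT <= minact b)%E].

(** By translation, a minimizing sequence may be assumed to vanish at 0. Each of the
    two intervals of length 1/2 next to 0 costs a fixed amount [k]. If a curve
    were within [d] of -1 at a time [s > 0], [complete_left] would charge almost
    the minimal action after [s], on top of [k]. So the limit stays away from -1
    on the right of 0 and, symmetrically, from 1 on the left, and the finiteness
    of its action gives its limits at infinity. *)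
Lemma autonomous_minimizer : coeff (fun=> a2) -> exists u c, minimizer (fun=> a2) u c.
Proof.
move=> cb; pose b : R -> R := fun=> a2.
have a20 : 0 <= a2 by exact: (coeff_ge0 a1_gt0 cb 0).
have mf := minact_fin_num cW W0 Wm1 W1 a1_gt0 cb.
have [eps eps0 Heps] := near_min_bound cW W0 Wm1 W1 Wgt0 a2 a1_gt0 ltr01.
have [y_ [w_ [e_ [yw ymin eb ecvg]]]] := minimizing_sequence C1W W0 Wm1 W1 a1_gt0 cb eps0.
have /choice[tau Htau] : forall n, exists t, y_ n t = 0.
  move=> n; have [_ _ _ yp _] := yw n; have cy := adm_continuous (yw n).
  have [_ _ _ _ yn] := yw n.
  have [A HA] := cvg_ninfty_lt (v := 0) yn (ltrN10 _).
  have [|s _ ys] := IVT_pinfty (v := 0) (t := A) cy yp; last by exists s.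
  by apply/orP; right; rewrite ltr01 (ltW (HA _ (lexx _))).
pose Y n t := y_ n (t + tau n); pose V n t := w_ n (t + tau n).
have YV n : adm (Y n) (V n) by exact: adm_shift.
have Ymin n : (act b W (Y n) (V n) setT <= minact b + (e_ n)%:E)%E by rewrite act_shift.
have Y2 n t : `|Y n t| <= 2.
  have h : (act b W (Y n) (V n) setT <= minact b + eps%:E)%E.
    by apply: le_trans (Ymin n) _; rewrite leeD2lE ?lee_fin//; case/andP: (eb n).
  have := Heps b (Y n) (V n) cb (YV n) h t; rewrite ler_norml; lra.
have [phi [u [c [kphi ycvg cup u1 umin]]]] := minimizing_limit C1W W0 Wm1 W1 Wgt0 a1_gt0 cb YV Y2 Ymin ecvg.
have ephi := cvg_subseq kphi ecvg.
have [|s sh|c1 c10 Hc1] := @W_ge_pos _ W cW Wgt0 (- 2^-1) 2^-1; first lra.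
  by split; apply/eqP; lra.
pose k := a1 * c1 * 2^-1.
have k0 : 0 < k by rewrite !mulr_gt0//; lra.
have C0 := ramp_cost_gt0 cW W0 W1 a1_gt0 cb.
set C := ramp_cost W a2 in C0.
(* the ramp that completes a curve within d of a well costs at most k / 4; and
   as d <= 1 / 4, a curve vanishing at 0 needs more than a time 1 / 2 to get there *)
pose d := Num.min 4^-1 (k / (4 * C)).
have d0 : 0 < d by rewrite lt_min; apply/andP; split; [lra|rewrite divr_gt0// mulr_gt0//; lra].
have d4 : d <= 4^-1 by rewrite ge_min lexx.
have dC : C * d <= k / 4.
  apply: (@le_trans _ _ (C * (k / (4 * C)))).
    by rewrite ler_wpM2l ?(ltW C0)// ge_min lexx orbT.
  by rewrite le_eqVlt; apply/orP; left; apply/eqP; field; rewrite gt_eqF.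
have d02 : 0 <= d <= 2 by rewrite (ltW d0); lra.
have near_k : \forall n \near \oo, e_ (phi n) < k / 4 by apply: (cvgr_lt 0) => //; lra.
have half n (s t : R) : - 2^-1 <= s -> t <= 2^-1 -> t - s = 2^-1 ->
    (k%:E <= act b W (Y n) (V n) `[s, t])%E.
  move=> s2 t2 ts.
  have := @act_itv_ge _ W cW a1 a2 a1_gt0 b (Y n) (V n) s t c1 cb (adm_curve (YV n)) _ (ltW c10).
  rewrite ts; apply; first lra.
  move=> r /andP[sr rt]; apply: Hc1.
  have := adm_lip (YV n) 0 r; rewrite {2}/Y add0r Htau !subr0 -ler_norml => h.
  by apply: le_trans h _; rewrite ler_norml; lra.
have contra n (X : \bar R) : e_ (phi n) < k / 4 -> (minact b <= X + (C * d)%:E)%E ->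
   (X + k%:E <= minact b + (e_ (phi n))%:E)%E -> False.
  move=> ek; rewrite -(fineK mf); case: X => [x||]//=.
  by rewrite -!EFinD !lee_fin; lra.
have uR t : 0 <= t -> - 1 + d <= u t.
  move=> t0; rewrite leNgt; apply/negP => ut.
  have near_y : \forall n \near \oo, Y (phi n) t < - 1 + d by exact: (cvgr_lt _ (ycvg t)).
  have [n [n1 n2]] := filter_ex (filterI near_k near_y).
  set N := phi n in n1 n2.
  have [_ _ _ yp _] := YV N; have cY := adm_continuous (YV N).
  have [|s ts ys] := IVT_pinfty (v := - 1 + d) (t := t) cY yp.
    by apply/orP; right; rewrite (ltW n2)/=; lra.
  have s2 : 2^-1 <= s.
    have := adm_lip (YV N) 0 s; rewrite {2}/Y add0r Htau !subr0 ys.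
    rewrite (ger0_norm (x := s)); last exact: le_trans ts.
    by rewrite ler0_norm; lra.
  apply: (contra n (act b W (Y N) (V N) `]s, +oo[)) => //.
    exact: (complete_left cW W0 Wm1 W1 a1_gt0 cb (adm_curve (YV N)) yp d02 ys).
  rewrite addeC; apply: le_trans (Ymin N).
  apply: (act_split_ge cb (adm_curve (YV N)) (half N 0 2^-1 _ _ _) s2); lra.
have uL t : t <= 0 -> u t <= 1 - d.
  move=> t0; rewrite leNgt; apply/negP => ut.
  have near_y : \forall n \near \oo, 1 - d < Y (phi n) t by exact: (cvgr_gt _ (ycvg t)).
  have [n [n1 n2]] := filter_ex (filterI near_k near_y).
  set N := phi n in n1 n2.
  have [_ _ _ _ yn] := YV N; have cY := adm_continuous (YV N).
  have [|s ts ys] := IVT_ninfty (v := 1 - d) (t := t) cY yn.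
    by apply/orP; left; rewrite (ltW n2) andbT; lra.
  have s2 : s < - 2^-1.
    have := adm_lip (YV N) 0 s; rewrite {2}/Y add0r Htau !subr0 ys.
    rewrite (ler0_norm (x := s)); last exact: le_trans t0.
    by rewrite ger0_norm; lra.
  apply: (contra n (act b W (Y N) (V N) `]-oo, s])) => //.
    exact: (complete_right cW W0 W1 a1_gt0 cb (adm_curve (YV N)) yn d02 ys).
  apply: le_trans (Ymin N).
  apply: (act_split_ge_l cb (adm_curve (YV N)) (half N (- 2^-1) 0 _ _ _) s2); lra.
have fin : (act b W u (fun t => gam (flux b u c t)) setT < +oo)%E.
  by apply: le_lt_trans umin _; rewrite ltey_eq mf.
exists u, c; split => //; split; [by case: cup..| |].
  by apply: (act_lty_pinfty cb cup d0 _ uR fin) => t; case/andP: (u1 t).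
by apply: (act_lty_ninfty cb cup d0 _ uL fin) => t; case/andP: (u1 t).
Qed.

End Existence.

(** * Existence of minimizers *)

Section ExistenceNonautonomous.
Context {R : realType}.

(** [th] measures the distance of the coefficient to its limit and [d] the distance
    of a curve to a well; each of the two errors is a quarter of the gap [g]. *)
Lemma small_parameters (m g C : R) : 0 <= m -> 0 < g -> 0 < C ->
  exists th d : R, [/\ 0 < th <= 1, 0 < d, d <= 4^-1, 0 <= d <= 2 & th * m <= g / 4 /\ C * d <= g / 4].
Proof.
move=> m0 g0 C0.
exists (Num.min 1 (g / (4 * (m + 1)))), (Num.min 4^-1 (g / (4 * C))); have d0 : 0 < Num.min 4^-1 (g / (4 * C)).
  by rewrite lt_min; apply/andP; split; [lra|rewrite divr_gt0// mulr_gt0//; lra].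
have d4 : Num.min 4^-1 (g / (4 * C)) <= 4^-1 by rewrite ge_min lexx.
split => //.
- rewrite ge_min lexx andbT lt_min; apply/andP.
  by split; [lra|rewrite divr_gt0// mulr_gt0//; lra].
- by rewrite (ltW d0)/= (le_trans d4)//; lra.
split.
  apply: (@le_trans _ _ (g / (4 * (m + 1)) * m)).
    by rewrite ler_wpM2r// ge_min lexx orbT.
  have -> : g / (4 * (m + 1)) * m = g / 4 * (m / (m + 1)) by field; lra.
  rewrite -[leRHS]mulr1 ler_wpM2l//; first lra.
  by rewrite ler_pdivrMr; lra.
apply: (@le_trans _ _ (C * (g / (4 * C)))).
  by rewrite ler_wpM2l ?(ltW C0)// ge_min lexx orbT.
by rewrite le_eqVlt; apply/orP; left; apply/eqP; field; rewrite gt_eqF.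
Qed.

Variables (W : R -> R) (C1W : C1_fun W) (W0 : forall s, 0 <= W s).
Variables (Wm1 : W (- 1) = 0) (W1 : W 1 = 0).
Variable (Wgt0 : forall s, s != 1 -> s != - 1 -> 0 < W s).
Variables (a1 a2 : R) (a1_gt0 : 0 < a1).
Implicit Types (u w y v b f g : R -> R) (D : set R).
Notation minact := (minact W).
Notation coeff := (coeff a1 a2).
Notation flux := (flux W).
Notation minimizer := (minimizer W).

Let cW : continuous W := C1_continuous C1W.

Lemma coeff_cst b : coeff b -> coeff (fun=> a2).
Proof.
move=> [_ H]; split; first exact: measurable_cst.
by move=> t; have /andP[h1 h2] := H 0; rewrite lexx andbT (le_trans h1).
Qed.

Lemma act_scale b y w (th : R) D : coeff b -> curve y w -> 0 <= th <= 1 -> measurable D ->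
  (forall t, D t -> (1 - th) * a2 <= b t) ->
  ((1 - th)%:E * act (fun=> a2) W y w D <= act b W y w D)%E.
Proof.
move=> cb cyw /andP[th0 th1] mD H; have [mb _] := cb; have b0 := coeff_ge0 a1_gt0 cb.
have cb2 := coeff_cst cb; have b20 := coeff_ge0 a1_gt0 cb2.
have [mw _ _] := cyw; have cy := curve_continuous cyw.
have s0 : 0 <= 1 - th by rewrite subr_ge0.
rewrite /act -ge0_integralZl_EFin//; last first.
  apply: (measurable_lag_EFin cW) => //; exact: measurable_cst.
  by move=> t _; rewrite lee_fin lag_ge0.
apply: ge0_le_integral => //.
- by move=> t _; rewrite -EFinM lee_fin mulr_ge0// lag_ge0.
- apply: measurable_funeM; apply: (measurable_lag_EFin cW) => //; exact: measurable_cst.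
- exact: measurable_lag_EFin.
- move=> t Dt; rewrite -EFinM lee_fin /lag mulrDr; apply: lerD.
    by rewrite mulrBl mul1r gerBl mulr_ge0 ?Phi_ge0.
  by rewrite mulrA ler_wpM2r ?H.
Qed.

Lemma act_coeff_le b y w : coeff b -> curve y w ->
  (act b W y w setT <= act (fun=> a2) W y w setT)%E.
Proof.
move=> cb cyw; have [mb bb] := cb; have b0 := coeff_ge0 a1_gt0 cb.
have [mw _ _] := cyw; have cy := curve_continuous cyw.
apply: le_act => // t _; rewrite /lag lerD2l ler_wpM2r//.
by case/andP: (bb t).
Qed.

(** A constant sequence is minimizing, so its limit satisfies the Euler-Lagrange
    equation. *)
Lemma minimizer_of_adm b u p : coeff b -> adm u p -> (forall t, -1 <= u t <= 1) ->
  (act b W u p setT <= minact b)%E -> exists c, minimizer b u c.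
Proof.
move=> cb up u1 umin.
have u2 t : `|u t| <= 2 by have := u1 t; rewrite ler_norml; lra.
have [|phi [v [c [_ ucvg cup v1 vmin]]]] := minimizing_limit C1W W0 Wm1 W1 Wgt0 a1_gt0 (e_ := fun=> 0) cb (fun n : nat => up)
  (fun n => u2) _ (@cvg_cst _ _ _ _ _).
  by move=> _; rewrite adde0.
have uv : v = u.
  apply/funext => t; apply: (cvg_unique (@Rhausdorff R) (ucvg t)); exact: cvg_cst.
subst v; exists c; split => //.
by have [_ _ _ ? ?] := up; have [? ? ?] := cup.
Qed.

(** A curve that comes close to 1 while the coefficient is still close to [a2] pays
    almost the price of a transition in the autonomous problem. *)
Lemma far_transition_right b y w (th d s : R) : coeff b -> adm y w -> 0 <= th <= 1 -> 0 <= d <= 2 ->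
  (forall t, t <= s -> (1 - th) * a2 <= b t) -> y s = 1 - d ->
  ((1 - th)%:E * (minact (fun=> a2) - (ramp_cost W a2 * d)%:E) <= act b W y w setT)%E.
Proof.
move=> cb yw th01 d02 bs ys; have cyw := adm_curve yw; have cb2 := coeff_cst cb.
have [_ _ _ _ yn] := yw.
have H := complete_right cW W0 W1 a1_gt0 cb2 cyw yn d02 ys.
have th0 : 0 <= 1 - th by case/andP: th01 => _; rewrite subr_ge0.
apply: (@le_trans _ _ ((1 - th)%:E * act (fun=> a2) W y w `]-oo, s])%E).
  by apply: lee_wpmul2l; rewrite ?lee_fin// leeBlDr.
apply: le_trans (act_scale cb cyw th01 (measurable_itv _) _) _.
  by move=> t /=; rewrite in_itv/=; exact: bs.
apply: act_subset => //; [by case: cb|exact: (coeff_ge0 a1_gt0 cb)|exact: curve_continuous cyw|by case: cyw].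
Qed.

(** Mirror image of [far_transition_right]. *)
Lemma far_transition_left b y w (th d s : R) : coeff b -> adm y w -> 0 <= th <= 1 -> 0 <= d <= 2 ->
  (forall t, s <= t -> (1 - th) * a2 <= b t) -> y s = - 1 + d ->
  ((1 - th)%:E * (minact (fun=> a2) - (ramp_cost W a2 * d)%:E) <= act b W y w setT)%E.
Proof.
move=> cb yw th01 d02 bs ys; have cyw := adm_curve yw; have cb2 := coeff_cst cb.
have [_ _ _ yp _] := yw.
have H := complete_left cW W0 Wm1 W1 a1_gt0 cb2 cyw yp d02 ys.
have th0 : 0 <= 1 - th by case/andP: th01 => _; rewrite subr_ge0.
apply: (@le_trans _ _ ((1 - th)%:E * act (fun=> a2) W y w `]s, +oo[)%E).
  by apply: lee_wpmul2l; rewrite ?lee_fin// leeBlDr.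
apply: le_trans (act_scale cb cyw th01 (measurable_itv _) _) _.
  by move=> t /=; rewrite in_itv/= andbT => /ltW; exact: bs.
apply: act_subset => //; [by case: cb|exact: (coeff_ge0 a1_gt0 cb)|exact: curve_continuous cyw|by case: cyw].
Qed.

Lemma exists_minimizer b : coeff b -> b t @[t --> +oo] --> a2 -> b t @[t --> -oo] --> a2 ->
  exists u c, minimizer b u c.
Proof.
move=> cb bp bn; have cb2 := coeff_cst cb.
have mf := minact_fin_num cW W0 Wm1 W1 a1_gt0 cb.
have mf2 := minact_fin_num cW W0 Wm1 W1 a1_gt0 cb2.
(* if the constant coefficient is not more expensive, its minimizer is also a
   minimizer for b, as b <= a2 *)
have [m2m|mm2] := leP (minact (fun=> a2)) (minact b).
  have [u [c [up u1 umin]]] := autonomous_minimizer C1W W0 Wm1 W1 Wgt0 a1_gt0 cb2.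
  have [|c' Hc'] := minimizer_of_adm cb up u1; last by exists u, c'.
  exact: le_trans (act_coeff_le cb (adm_curve up)) (le_trans umin m2m).
have a20 := coeff_a2 a1_gt0 cb.
set C := ramp_cost W a2.
have C0 : 0 < C := ramp_cost_gt0 cW W0 W1 a1_gt0 cb.
set m := fine (minact b); set m2 := fine (minact (fun=> a2)).
have m20 : 0 <= m2 by rewrite -lee_fin fineK// (minact_ge0 W0 a1_gt0 cb2).
pose g := m2 - m.
have g0 : 0 < g by rewrite subr_gt0 -lte_fin !fineK.
have [th [d [/andP[th0 th2] d0 d4 d02 [thm dC]]]] := small_parameters m20 g0 C0.
have th01 : 0 <= th <= 1 by rewrite (ltW th0) th2.
(* an escaped transition costs more than the near-minimizers are allowed to spend *)
have key : m + g / 4 < (1 - th) * (m2 - C * d).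
  have : 0 <= th * (C * d) by rewrite !mulr_ge0// ltW.
  have gE : g = m2 - m by [].
  have -> : (1 - th) * (m2 - C * d) = m2 - th * m2 - C * d + th * (C * d) by ring.
  lra.
have bth : (1 - th) * a2 < a2.
  by have := mulr_gt0 th0 a20; lra.
have [A HA] := cvg_ninfty_gt bn bth.
have [B HB] := cvg_pinfty_gt bp bth.
have [eps eps0 Heps] := near_min_bound cW W0 Wm1 W1 Wgt0 a2 a1_gt0 ltr01.
have [y_ [w_ [e_ [yw ymin eb ecvg]]]] := minimizing_sequence C1W W0 Wm1 W1 a1_gt0 cb eps0.
have y2 n t : `|y_ n t| <= 2.
  have h : (act b W (y_ n) (w_ n) setT <= minact b + eps%:E)%E.
    by apply: le_trans (ymin n) _; rewrite leeD2lE ?lee_fin//; case/andP: (eb n).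
  have := Heps b _ _ cb (yw n) h t; rewrite ler_norml; lra.
have [phi [u [c [kphi ycvg cup u1 umin]]]] := minimizing_limit C1W W0 Wm1 W1 Wgt0 a1_gt0 cb yw y2 ymin ecvg.
have ephi := cvg_subseq kphi ecvg.
have near_g : \forall n \near \oo, e_ (phi n) < g / 4 by apply: (cvgr_lt 0) => //; lra.
have contra n : e_ (phi n) < g / 4 ->
   ((1 - th)%:E * (minact (fun=> a2) - (C * d)%:E) <= act b W (y_ (phi n)) (w_ (phi n)) setT)%E -> False.
  move=> en h; have := le_trans h (ymin _).
  by rewrite -(fineK mf) -(fineK mf2) -/m -/m2 -EFinB -EFinM -EFinD lee_fin; lra.
have uL t : t <= A -> u t <= 1 - d.
  move=> tA; rewrite leNgt; apply/negP => ut.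
  have near_y : \forall n \near \oo, 1 - d < y_ (phi n) t by exact: (cvgr_gt _ (ycvg t)).
  have [n [n1 n2]] := filter_ex (filterI near_g near_y).
  have [_ _ _ _ yn] := yw (phi n); have cY := adm_continuous (yw (phi n)).
  have [|s ts ys] := IVT_ninfty (v := 1 - d) (t := t) cY yn.
    by apply/orP; left; rewrite (ltW n2) andbT; lra.
  apply: (contra n n1); apply: far_transition_right (yw _) th01 d02 _ ys => //.
  by move=> r rs; apply/ltW/HA; rewrite (le_trans rs)// (le_trans ts).
have uR t : B <= t -> - 1 + d <= u t.
  move=> tB; rewrite leNgt; apply/negP => ut.
  have near_y : \forall n \near \oo, y_ (phi n) t < - 1 + d by exact: (cvgr_lt _ (ycvg t)).
  have [n [n1 n2]] := filter_ex (filterI near_g near_y).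
  have [_ _ _ yp _] := yw (phi n); have cY := adm_continuous (yw (phi n)).
  have [|s ts ys] := IVT_pinfty (v := - 1 + d) (t := t) cY yp.
    by apply/orP; right; rewrite (ltW n2)/=; lra.
  apply: (contra n n1); apply: far_transition_left (yw _) th01 d02 _ ys => //.
  by move=> r rs; apply/ltW/HB; rewrite (le_trans tB)// (le_trans ts).
have fin : (act b W u (fun t => gam (flux b u c t)) setT < +oo)%E.
  by apply: le_lt_trans umin _; rewrite ltey_eq mf.
exists u, c; split => //; split; [by case: cup..| |].
  by apply: (act_lty_pinfty C1W W0 Wgt0 a1_gt0 cb cup d0 _ uR fin) => t; case/andP: (u1 t).
by apply: (act_lty_ninfty C1W W0 Wgt0 a1_gt0 cb cup d0 _ uL fin) => t; case/andP: (u1 t).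
Qed.

End ExistenceNonautonomous.

(** * Regularity of minimizers *)

Section Regularity.
Context {R : realType}.
Variables (W : R -> R) (C1W : C1_fun W) (W0 : forall s, 0 <= W s).
Variables (a1 a2 : R) (a1_gt0 : 0 < a1).
Implicit Types (u w y v b f g : R -> R) (D : set R).
Notation mu := (@lebesgue_measure R).
Notation coeff := (coeff a1 a2).
Notation force := (force W).
Notation flux := (flux W).

Lemma locbdd_L2loc f : locbdd f -> L2loc f.
Proof.
move=> lf; split; first exact: lf.1.
have lf2 : locbdd (fun x => f x ^+ 2) by have := locbddM lf lf.
move=> K cK; have [_ _ /(_ K (@subsetT _ K) cK)] := locbdd_locally_integrable lf2.
by under eq_integral do rewrite normrX.
Qed.

(** As the slope is Lipschitz, [h * p t] differs from the increment of [u] on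
    [`[t, t + h]] by at most [L * h^2], and this increment tends to 0. *)
Lemma prim_lip_cvg0 (F : set_system R) u p (L l : R) : ProperFilter F ->
  (forall c, 0 <= c -> u (t + c) @[t --> F] --> l) -> continuous p -> prim u p -> 0 <= L ->
  (forall s t, `|p t - p s| <= L * `|t - s|) -> p t @[t --> F] --> (0 : R).
Proof.
move=> FF ul cp up L0 pL; apply/cvgrPdist_le => e e0.
have lp := locbdd_continuous cp.
(* then (L + 1) * h = e / 2 *)
pose h := e / (2 * (L + 1)).
have h0 : 0 < h by rewrite divr_gt0// mulr_gt0//; lra.
have he : 0 < h * e / 4 by rewrite divr_gt0// mulr_gt0.
have /cvgrPdist_le /(_ _ he) H1 := ul _ (ltW h0).
have /cvgrPdist_le /(_ _ he) H2 := ul _ (lexx 0).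
near=> t.
have u1 : `|l - u (t + h)| <= h * e / 4 by near: t; exact: H1.
have u2 : `|l - u t| <= h * e / 4 by rewrite -[t in u t]addr0; near: t; exact: H2.
rewrite sub0r normrN.
have th : t <= t + h by rewrite lerDl ltW.
have E : h * p t = (u (t + h) - u t) - int (fun x => p x - p t) t (t + h).
  by rewrite (up _ _ th) (intB _ _ lp (locbdd_cst _)) int_cst//; ring.
have B : `|int (fun x => p x - p t) t (t + h)| <= h * (e / 2).
  have hb : forall x, t <= x <= t + h -> `|p x - p t| <= e / 2.
    move=> x /andP[tx xt]; apply: le_trans (pL _ _) _.
    apply: (@le_trans _ _ ((L + 1) * h)); last first.
      by rewrite /h le_eqVlt; apply/orP; left; apply/eqP; field; lra.
    by apply: ler_pM => //; [lra|rewrite ger0_norm ?subr_ge0//; lra].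
  have := int_bound (locbddB lp (locbdd_cst (p t))) th hb.
  by have -> : e / 2 * (t + h - t) = h * (e / 2) by ring.
rewrite -(ler_pM2l h0) -{1}(gtr0_norm h0) -normrM E.
apply: le_trans (ler_normB _ _) _.
have -> : u (t + h) - u t = (l - u t) - (l - u (t + h)) by ring.
have := ler_normB (l - u t) (l - u (t + h)); lra.
Unshelve. all: by end_near.
Qed.

Section Extremal.
Variables (b u : R -> R) (c : R).
Hypotheses (cb : coeff b) (cu : curve u (fun t => gam (flux b u c t))).
Hypothesis u1 : forall t, -1 <= u t <= 1.

Let q := flux b u c.
Let p t := gam (q t).
Let ucont : continuous u := curve_continuous cu.
Let lf : locbdd (force b u) := locbdd_force C1W a1_gt0 cb ucont.
Let primq : prim q (force b u) := prim_flux C1W a1_gt0 c cb ucont.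
Let cq : continuous q := flux_continuous C1W a1_gt0 cb ucont.

Let cp : continuous p.
Proof. by move=> t; apply: (@continuous_comp _ _ _ q gam); [exact: cq|exact: gam_continuous]. Qed.

Let primu : prim u p.
Proof. by case: cu. Qed.

Let u2 t : `|u t| <= 2.
Proof. by have := u1 t; rewrite ler_norml; lra. Qed.

Lemma derive1_extremal : derive1 u = fun t => gam (flux b u c t).
Proof.
apply/funext => t; rewrite derive1E.
exact: (derive_val (is_derive := prim_is_derive (locbdd_continuous cp) primu (@cp t))).
Qed.

Lemma extremal_C1 : C1_fun u.
Proof.
split=> [t|]; last by rewrite derive1_extremal.
exact: (ex_derive (is_derive := prim_is_derive (locbdd_continuous cp) primu (@cp t))).
Qed.

Lemma extremal_flux : (fun t => derive1 u t / Num.sqrt (1 - `|derive1 u t| ^+ 2)) = q.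
Proof.
by rewrite derive1_extremal; apply/funext => t; rewrite real_normK ?num_real// gamK.
Qed.

(** A flux above [1 + 4 * K] at [t] would stay above 1 on [`[t, t + 4]], as its
    derivative is bounded by [K], and by [gam1_ge] [u] would increase there by
    more than 2, leaving [[-1, 1]]. *)
Lemma flux_bounded : exists Q, forall t, `|q t| <= Q.
Proof.
have [K K0 HK] := force_bound C1W a2 a1_gt0.
have fK t : `|force b u t| <= K by exact: HK.
exists (1 + 4 * K) => t.
have lp := locbdd_continuous cp.
have tt4 : t <= t + 4 by lra.
have near_t r : t <= r <= t + 4 -> `|q r - q t| <= 4 * K.
  move=> /andP[tr rt]; apply: le_trans (prim_bound lf primq fK t r) _.
  rewrite mulrC ler_wpM2r// ger0_norm ?subr_ge0//; lra.
have du := primu tt4.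
rewrite ler_norml; apply/andP; split; rewrite leNgt; apply/negP => qt.
  have : int p t (t + 4) <= int (fun=> - (2 / 3)) t (t + 4).
    apply: le_int => //; first exact: locbdd_cst.
    move=> r /near_t; rewrite ler_norml => /andP[_ h].
    rewrite /p -(opprK (q r)) gamN lerN2; apply: le_trans gam1_ge _; apply: gam_homo; lra.
  rewrite int_cst// -du; have := u1 t; have := u1 (t + 4); lra.
have : int (fun=> 2 / 3) t (t + 4) <= int p t (t + 4).
  apply: le_int => //; first exact: locbdd_cst.
  move=> r /near_t; rewrite ler_norml => /andP[h _].
  by apply: le_trans gam1_ge _; apply: gam_homo; lra.
rewrite int_cst// -du; have := u1 t; have := u1 (t + 4); lra.
Qed.

(** A bound on the flux [q] keeps the slope [gam q] uniformly away from 1. *)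
Lemma extremal_slope_lt1 : ('N[mu]_+oo[EFin \o derive1 u] < 1)%E.
Proof.
have [Q HQ] := flux_bounded.
apply: (@le_lt_trans _ _ (gam Q)%:E).
  apply/Lnorm_oo_le; apply: aeW => t /=; rewrite derive1_extremal lee_fin -/(p t).
  have := HQ t; rewrite !ler_norml => /andP[h1 h2].
  by rewrite -gamN !gam_homo.
by rewrite lte_fin (le_lt_trans (ler_norm _))// gam_lt1.
Qed.

Lemma extremal_slope_cvg0 : u t @[t --> +oo] --> (1 : R) -> u t @[t --> -oo] --> (- 1 : R) ->
  p t @[t --> +oo] --> (0 : R) /\ p t @[t --> -oo] --> (0 : R).
Proof.
move=> up un; have [K K0 HK] := force_bound C1W a2 a1_gt0.
have pL s t : `|p t - p s| <= K * `|t - s|.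
  apply: le_trans (gam_lip _ _) _; apply: (prim_bound lf primq) => r; exact: HK.
split; apply: (prim_lip_cvg0 _ _ cp primu K0 pL).
- by move=> d _; exact: cvg_pinfty_shift up.
- by move=> d _; exact: cvg_ninfty_shift un.
Qed.

(** The slope is the composite of the C^1 function [gam] with the Lipschitz flux. *)
Lemma extremal_W22loc : W22loc u.
Proof.
pose r t := derive1 gam (q t) * force b u t.
have lp := locbdd_continuous cp.
have lr : locbdd r.
  apply: locbddM => //; apply: locbdd_continuous => t.
  by apply: (@continuous_comp _ _ _ q (derive1 gam)); [exact: cq|exact: C1_gam.2].
have pr : prim p r by exact: (prim_chain C1_gam.1 C1_gam.2 lf primq).
exists p, r; split.
- exact: prim_weak_derivative lp primu.
- exact: prim_weak_derivative lr pr.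
- exact: locbdd_L2loc (locbdd_continuous ucont).
- exact: locbdd_L2loc.
- exact: locbdd_L2loc.
Qed.

Lemma extremal_solves_EL a (N : set R) : measurable N -> mu N = 0 ->
  (forall t, ~ N t -> a t = b t) -> solves_EL a W u.
Proof.
move=> mN N0 ab; exists (force b u).
  by rewrite extremal_flux; exact: prim_weak_derivative lf primq.
exists N; split => // t /= H; apply: contrapT => /ab Nt.
by apply: H; rewrite /force Nt.
Qed.

End Extremal.

End Regularity.

Theorem corollary1p4 (R : realType) (W a : R -> R) (a1 a2 : R)
  (W_C1 : C1_fun W)
  (W_m1 : W (- 1) = 0) (W_1 : W 1 = 0)
  (W_gt0 : forall s : R, s != 1 -> s != - 1 -> 0 < W s)
  (a_meas : lebesgue_measurable_fun a)
  (a1_gt0 : 0 < a1)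
  (a_bounds : forall t, a1 <= a t <= a2)
  (a_pinfty : a t @[t --> +oo] --> a2)
  (a_ninfty : a t @[t --> -oo] --> a2) :
  exists ua : R -> R,
    [/\ X1 ua,
        action a W ua = ereal_inf [set action a W u | u in X1],
        [/\ C1_fun ua, W22loc ua & solves_EL a W ua],
        (ua t, derive1 ua t) @[t --> +oo] --> ((1, 0) : R * R) /\
        (ua t, derive1 ua t) @[t --> -oo] --> ((- 1, 0) : R * R) &
        ('N[lebesgue_measure]_+oo[EFin \o derive1 ua] < 1)%E].
Proof.
have W0 s : 0 <= W s.
  have [->|s1] := eqVneq s 1; first by rewrite W_1.
  have [->|s2] := eqVneq s (- 1); first by rewrite W_m1.
  exact/ltW/W_gt0.
have cW := C1_continuous W_C1.
have [N [mN N0] HN] := lebesgue_measurable_borel_off_null a_meas.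
(* the value a2 on N preserves the bounds and the limits *)
pose b t := if t \in N then a2 else a t.
have ab t : ~ N t -> a t = b t by move=> Nt; rewrite /b memNset.
have cb : coeff a1 a2 b.
  split; first exact: HN.
  move=> t; rewrite /b; case: ifP => // _; have /andP[h1 h2] := a_bounds t.
  by rewrite (le_trans h1 h2) lexx.
have b_cvg (F : set_system R) : Filter F -> a t @[t --> F] --> a2 -> b t @[t --> F] --> a2.
  move=> FF /cvgrPdist_le H; apply/cvgrPdist_le => e e0.
  apply: filterS (H e e0) => t; rewrite /b; case: ifP => // _ _.
  by rewrite subrr normr0 ltW.
have [u [c [up u1 umin]]] := exists_minimizer W_C1 W0 W_m1 W_1 W_gt0 a1_gt0 cb
  (b_cvg _ _ a_pinfty) (b_cvg _ _ a_ninfty).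
have cu := adm_curve up; have [mp _ primu lp ln] := up.
have b0 := coeff_ge0 a1_gt0 cb.
have a0 t : 0 <= a t by have /andP[h _] := a_bounds t; rewrite (le_trans _ h)// ltW.
have act_eq v w : adm v w -> {ae lebesgue_measure, forall t, wderiv v t = w t} ->
    action a W v = act b W v w setT.
  move=> vw; have [mw _ _ _ _] := vw.
  by apply: (action_act mN N0 ab) => //; [case: cb|exact: adm_continuous vw].
have Xu := adm_X1 up.
have [p0 n0] := extremal_slope_cvg0 W_C1 a1_gt0 cb cu u1 lp ln.
have dE := derive1_extremal W_C1 a1_gt0 cb cu.
exists u; split => //.
- apply/eqP; rewrite eq_le; apply/andP; split; last first.
    by apply: ereal_inf_lbound; exists u.
  apply: le_ereal_inf_tmp => _ [v /X1_adm[w vw dv] <-].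
  rewrite (act_eq v w)// (act_eq u _ up); last first.
    by apply: wderiv_ae_prim primu; exact: adm_locbdd up.
  exact: le_trans umin (minact_le W b vw).
- split; [exact: (extremal_C1 W_C1 a1_gt0 cb cu)|exact: (extremal_W22loc W_C1 a1_gt0 cb cu)|].
  exact: (extremal_solves_EL W_C1 a1_gt0 cb cu mN N0 ab).
- by rewrite dE; split; [exact: (cvg_pair lp p0)|exact: (cvg_pair ln n0)].
- exact: (extremal_slope_lt1 W_C1 a1_gt0 cb cu u1).
Qed.
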